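(* Let $g\in H(\mathbb{D})$ be such that $\log(g)\in\mathcal{B}$, let $\nu$ be a weight that is analytic and quasi-normal, and let $\mu$ be an arbitrary weight. Then $S_g: H^{\infty}_\nu\rightarrow H^{\infty}_\mu$ is bounded if and only if $$\sup_{0\leq t<1}\ \sup_{0\leq\theta<2\pi}\mu(t)\int_0^t\frac{|g(re^{i\theta})|}{(1-r^2)\nu(r)}\,dr<+\infty\,.$$
   Context: $\mathbb{D}$ is the open unit disk and $H(\mathbb{D})$ the space of analytic functions on $\mathbb{D}$. A weight is a non-negative continuous function $\nu$ on $\mathbb{D}$ with $\nu(z)=\nu(|z|)$ for all $z$, which is decreasing in $|z|$; we write $\nu(r)$ for its value at $|z|=r$. For a weight $\nu$: $H^{\infty}_\nu=\{f\in H(\mathbb{D}): \sup_{z}\nu(z)|f(z)|<\infty\}$, $H^{0}_\nu=\{f\in H(\mathbb{D}): \lim_{|z|\to1^-}\nu(z)|f(z)|=0\}$, $\mathcal{B}^{0}_\nu=\{f\in H(\mathbb{D}): \lim_{|z|\to1^-}\nu(z)|f'(z)|=0\}$. The Bloch space is $\mathcal{B}=\{f\in H(\mathbb{D}): |f(0)|+\sup_{z}(1-|z|^2)|f'(z)|<\infty\}$; ''$\log(g)\in\mathcal{B}$'' means $g$ has no zeros in $\mathbb{D}$ and an analytic branch of $\log g$ belongs to $\mathcal{B}$. A weight $\nu$ is analytic if $\nu(z)=1/F(|z|)$ for some $F\in H(\mathbb{D})$ with $|F(z)|\leq F(|z|)$ for all $z$. A weight $\nu$ is quasi-normal if $H^0_{\nu}=\mathcal{B}^0_{\nu_1}$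 where $\nu_1(z)=\nu(z)(1-|z|^2)$. For $g\in H(\mathbb{D})$, $(S_gf)(z)=\int_0^z f'(\omega)g(\omega)\,d\omega$. *)

(* Defs.v *)
From Stdlib Require Import Reals.
From Coquelicot Require Import Coquelicot.
Open Scope R_scope.

Definition inD (z : C) : Prop := Cmod z < 1.

Definition holo (f : C -> C) : Prop :=
  forall z : C, inD z -> @ex_derive C_AbsRing C_NormedModule f z.

Definition cexp (z : C) : C := (exp (Re z) * cos (Im z), exp (Re z) * sin (Im z)).
Definition eit (theta : R) : C := (cos theta, sin theta).

Definition weight (nu : C -> R) : Prop :=
  (forall z, inD z -> 0 <= nu z) /\
  (forall z, inD z -> continuous nu z) /\
  (forall z, inD z -> nu z = nu (RtoC (Cmod z))) /\
  (forall z w, inD z -> inD w -> Cmod z <= Cmod w -> nu w <= nu z).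

Definition Hinf (nu : C -> R) (f : C -> C) : Prop :=
  holo f /\ exists M : R, forall z, inD z -> nu z * Cmod (f z) <= M.

Definition H0 (nu : C -> R) (f : C -> C) : Prop :=
  holo f /\ forall eps : R, 0 < eps -> exists r : R, r < 1 /\
    forall z, r < Cmod z -> Cmod z < 1 -> nu z * Cmod (f z) < eps.

Definition B0 (nu : C -> R) (f : C -> C) : Prop :=
  holo f /\ forall eps : R, 0 < eps -> exists r : R, r < 1 /\
    forall z, r < Cmod z -> Cmod z < 1 -> nu z * Cmod (C_derive f z) < eps.

Definition Bloch (h : C -> C) : Prop :=
  holo h /\ exists M : R, forall z, inD z ->
    (1 - Cmod z ^ 2) * Cmod (C_derive h z) <= M.

Definition log_in_Bloch (g : C -> C) : Prop :=
  (forall z, inD z -> g z <> 0%C) /\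
  exists h : C -> C, Bloch h /\ forall z, inD z -> cexp (h z) = g z.

Definition analytic_weight (nu : C -> R) : Prop :=
  weight nu /\ exists F : C -> C, holo F /\
    forall z, inD z ->
      (RtoC (nu z) * F (RtoC (Cmod z)) = 1)%C /\
      Im (F (RtoC (Cmod z))) = 0 /\
      Cmod (F z) <= Re (F (RtoC (Cmod z))).

Definition quasi_normal (nu : C -> R) : Prop :=
  weight nu /\
  forall f : C -> C, H0 nu f <-> B0 (fun z => nu z * (1 - Cmod z ^ 2)) f.

(* the integral operator (S_g f)(z) = int_0^z f'(w) g(w) dw,
   integrated along the segment [0,z]: w = t z, dw = z dt *)
Definition Sg (g f : C -> C) (z : C) : C :=
  RInt (V := C_R_CompleteNormedModule)
       (fun t : R => (C_derive f (RtoC t * z) * g (RtoC t * z) * z)%C) 0 1.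

(* S_g : H^inf_nu -> H^inf_mu is a bounded (linear) operator:
   maps H^inf_nu into H^inf_mu and ||S_g f||_mu <= K ||f||_nu *)
Definition Sg_bounded (g : C -> C) (nu mu : C -> R) : Prop :=
  exists K : R, 0 <= K /\
    forall f : C -> C, Hinf nu f ->
      Hinf mu (Sg g f) /\
      forall M : R, (forall z, inD z -> nu z * Cmod (f z) <= M) ->
        forall z, inD z -> mu z * Cmod (Sg g f z) <= K * M.

(* Main.v *)
(* Write nu = 1/F on the radius. Testing quasi-normality on the series sum_n 2^-n F(rho_n z) and on
   the primitive of sum_n 2^-n v(rho_n z), v = F/(1 - z^2), whose terms are nonnegative on the
   radius, gives (1 - r^2) F'(r) <= C F(r) and int_0^r F/(1 - s^2) <= C F(r). The first inequality
   is a doubling condition on F, so that Cauchy's estimate bounds nu (1 - |z|^2) |f'| by the norm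
   of f: this gives sufficiency. The second one bounds the norm of f by the supremum of
   nu (1 - |z|^2) |f'|. For necessity, f must have |f'| comparable to F/(1 - r^2) and f' g of almost
   constant argument on a given radius. Since log g is Bloch, the argument b of g on the radius is
   Lipschitz for the hyperbolic distance d, and a bounded analytic multiplier aligned with e^(-ib)
   is a finite sum of e^(-i b(a_j)) k_j^m, with k_j equal to sech^2 d(., a_j) on the radius, over
   nodes a_j in hyperbolic arithmetic progression; its bounds do not depend on the number of nodes. *)
Require Import Defs.
From Stdlib Require Import Reals Lra Lia Psatz ClassicalEpsilon.
From Coquelicot Require Import Coquelicot.
Open Scope R_scope.

(** Quasi-normality is an equality of sets and carries no constants. The constants come from a
    gliding hump: if one of the two inequalities were not uniform, parameters with excess 4^n could
    be placed in one series with weights 2^-n, which lies in the first space but violates the bound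
    that membership in the second one imposes. The terms are dilations because [F] itself is not in
    H^0_nu, nu F being 1 on the radius; F(rho z) with rho < 1 is bounded, and the inequalities for
    [F] follow as rho tends to 1. The obstacle to necessity is that e^(-ib) is not the restriction
    of an evident bounded analytic function. The node spacing is taken so small that b moves by at
    most one radian over two steps, which makes the nearby terms contribute with a cosine of at
    least 1/2; a high power of the peaks makes the nodes of uncontrolled phase negligible. Spacing
    and power depend only on the Bloch constant of log g. *)

Notation is_Cderive f z l :=
  (@is_derive C_AbsRing C_NormedModule (f : C -> C) (z : C) (l : C)).
Notation is_CInt f a b l :=
  (@is_RInt C_R_NormedModule (f : R -> C) a b (l : C)).
Notation CInt := (@RInt C_R_CompleteNormedModule).
Notation ex_CInt := (@ex_RInt C_R_NormedModule).

(** * Complex derivatives and curves *)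

Lemma Cmod_minus_le (a b : C) : Cmod (a - b) <= Cmod a + Cmod b.
Proof.
  unfold Cminus. eapply Rle_trans; [apply Cmod_triangle|].
  rewrite Cmod_opp. lra.
Qed.

Lemma Cmod_minus_ge (a b : C) : Cmod a - Cmod b <= Cmod (a - b).
Proof.
  generalize (Cmod_triangle (a - b) b).
  replace (a - b + b)%C with a by ring. lra.
Qed.

Lemma im_le_Cmod (c : C) : Rabs (Im c) <= Cmod c.
Proof.
  eapply Rle_trans; [|apply Rmax_Cmod]. apply Rmax_r.
Qed.

Lemma Cmod_le_re_im (c : C) : Cmod c <= Rabs (Re c) + Rabs (Im c).
Proof.
  replace c with (RtoC (Re c) + Ci * RtoC (Im c))%C at 1.
  - eapply Rle_trans; [apply Cmod_triangle|].
    rewrite Cmod_mult, Cmod_Ci, !Cmod_R. lra.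
  - destruct c as [x y]. apply injective_projections; simpl; ring.
Qed.

Lemma is_Cderive_eps (f : C -> C) (z l : C) :
  is_Cderive f z l <->
  (forall eps, 0 < eps -> exists d, 0 < d /\ forall h, Cmod h < d ->
     Cmod (f (z + h) - f z - h * l) <= eps * Cmod h)%C.
Proof.
  split.
  - intros [_ H] eps He.
    destruct (H z (fun P HP => HP) (mkposreal eps He)) as [d Hd].
    exists d; split; [apply cond_pos|]. intros h Hh.
    assert (Hb : @ball (AbsRing_UniformSpace C_AbsRing) z d (z + h)%C).
    { unfold ball; simpl. unfold AbsRing_ball, minus, plus, opp, abs; simpl.
      replace (z + h + - z)%C with h by ring. exact Hh. }
    specialize (Hd _ Hb).
    unfold minus, plus, opp, scal, norm in Hd; simpl in Hd.
    unfold mult in Hd; simpl in Hd.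
    unfold abs in Hd; simpl in Hd.
    replace (z + h + - z)%C with h in Hd by ring. exact Hd.
  - intros H. split.
    + apply (@is_linear_scal_l C_AbsRing C_NormedModule l).
    + intros x Hx eps.
      assert (E := @is_filter_lim_locally_unique C_AbsRing (AbsRing_NormedModule C_AbsRing) z x Hx).
      subst x. destruct (H eps (cond_pos eps)) as [d [Hd0 Hd]].
      exists (mkposreal d Hd0). intros y Hy.
      unfold ball in Hy; simpl in Hy.
      unfold AbsRing_ball, minus, plus, opp, abs in Hy; simpl in Hy.
      specialize (Hd (y + - z)%C Hy).
      unfold minus, plus, opp, scal, norm; simpl. unfold mult; simpl.
      unfold abs; simpl.
      assert (E : forall a b : C, (b + (a + - b))%C = a) by (intros; ring).
      rewrite E in Hd. exact Hd.
Qed.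

(* The library has two non-convertible uniform structures on [C]. *)
Lemma is_Cderive_AbsRing (f : C -> C) (z l : C) :
  is_Cderive f z l <-> @is_derive C_AbsRing (AbsRing_NormedModule C_AbsRing) f z l.
Proof.
  split; intros [_ H].
  - split; [apply (@is_linear_scal_l C_AbsRing (AbsRing_NormedModule C_AbsRing) l)|exact H].
  - split; [apply (@is_linear_scal_l C_AbsRing C_NormedModule l)|exact H].
Qed.

Lemma is_Cderive_plus (f g : C -> C) (z a b : C) :
  is_Cderive f z a -> is_Cderive g z b ->
  is_Cderive (fun x => f x + g x)%C z (a + b)%C.
Proof. intros Hf Hg. exact (@is_derive_plus C_AbsRing C_NormedModule f g z a b Hf Hg). Qed.

Lemma is_Cderive_mult (f g : C -> C) (z a b : C) :
  is_Cderive f z a -> is_Cderive g z b ->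
  is_Cderive (fun x => f x * g x)%C z (a * g z + f z * b)%C.
Proof.
  rewrite !is_Cderive_AbsRing. intros Hf Hg.
  exact (@is_derive_mult C_AbsRing f g z a b Hf Hg Cmult_comm).
Qed.

Lemma is_Cderive_comp (f g : C -> C) (z a b : C) :
  is_Cderive f (g z) a -> is_Cderive g z b ->
  is_Cderive (fun x => f (g x)) z (b * a)%C.
Proof.
  rewrite (is_Cderive_AbsRing g). intros Hf Hg.
  exact (@is_derive_comp C_AbsRing C_NormedModule f g z a b Hf Hg).
Qed.

Lemma is_Cderive_const (c z : C) : is_Cderive (fun _ => c) z 0%C.
Proof. apply (@is_derive_const C_AbsRing C_NormedModule c z). Qed.

Lemma is_Cderive_id (z : C) : is_Cderive (fun x => x) z 1%C.
Proof. apply is_Cderive_AbsRing. exact (@is_derive_id C_AbsRing z). Qed.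

(** Remainders of this shape can be integrated or summed with a uniform [K], so differentiation
    under an integral sign or through a series needs no separate limit argument. *)
Lemma is_Cderive_quadratic_error (f : C -> C) (z l : C) (K r : R) :
  0 < r ->
  (forall h, Cmod h < r ->
     Cmod (f (z + h) - f z - h * l)%C <= K * Cmod h ^ 2) ->
  is_Cderive f z l.
Proof.
  intros Hr H. apply is_Cderive_eps. intros eps He.
  assert (HK : 0 < Rabs K + 1) by (generalize (Rabs_pos K); lra).
  exists (Rmin r (eps / (Rabs K + 1))). split.
  - apply Rmin_glb_lt; auto. apply Rdiv_lt_0_compat; auto.
  - intros h Hh.
    assert (H1 := Rlt_le_trans _ _ _ Hh (Rmin_l _ _)).
    assert (H2 := Rlt_le_trans _ _ _ Hh (Rmin_r _ _)).
    eapply Rle_trans; [apply H, H1|].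
    assert (H0 := Cmod_ge_0 h).
    apply Rle_trans with ((Rabs K + 1) * Cmod h ^ 2).
    + apply Rmult_le_compat_r; [apply pow2_ge_0|].
      generalize (Rle_abs K); lra.
    + assert ((Rabs K + 1) * Cmod h <= eps).
      { apply Rlt_le in H2. apply (Rmult_le_compat_l (Rabs K + 1)) in H2; [|lra].
        eapply Rle_trans; [exact H2|]. right; field; lra. }
      nra.
Qed.

Lemma is_Cderive_inv (z : C) : z <> 0%C ->
  is_Cderive Cinv z (- / (z * z))%C.
Proof.
  intros Hz.
  assert (Hm : 0 < Cmod z) by (apply Cmod_gt_0; exact Hz).
  apply is_Cderive_quadratic_error with (K := 2 / Cmod z ^ 3) (r := Cmod z / 2).
  - lra.
  - intros h Hh.
    assert (Hzh : Cmod z / 2 <= Cmod (z + h)).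
    { generalize (Cmod_minus_ge z (- h)). rewrite Cmod_opp.
      replace (z - - h)%C with (z + h)%C by ring. lra. }
    assert (Hzh0 : (z + h)%C <> 0%C) by (apply Cmod_gt_0; lra).
    replace (/ (z + h) - / z - h * - / (z * z))%C with (h * h * / (z * z * (z + h)))%C
      by (field; auto).
    rewrite !Cmod_mult, Cmod_inv, !Cmod_mult by (repeat apply Cmult_neq_0; auto).
    replace (2 / Cmod z ^ 3 * Cmod h ^ 2)
      with (Cmod h * Cmod h * / (Cmod z * Cmod z * (Cmod z / 2))) by (field; lra).
    assert (H0 := Cmod_ge_0 h).
    apply Rmult_le_compat_l; [nra|].
    apply Rinv_le_contravar; [|apply Rmult_le_compat_l; nra].
    apply Rmult_lt_0_compat; nra.
Qed.

Lemma is_Cderive_div (f g : C -> C) (z a b : C) :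
  g z <> 0%C -> is_Cderive f z a -> is_Cderive g z b ->
  is_Cderive (fun x => f x / g x)%C z (a / g z - f z * b / (g z * g z))%C.
Proof.
  intros H0 Hf Hg.
  replace (a / g z - f z * b / (g z * g z))%C
    with (a * / g z + f z * (b * - / (g z * g z)))%C by (field; auto).
  apply (is_Cderive_mult f (fun x => / g x)%C); auto.
  apply (is_Cderive_comp Cinv g); auto. apply is_Cderive_inv; auto.
Qed.

Lemma ex_Cderive_correct (f : C -> C) (z : C) :
  @ex_derive C_AbsRing C_NormedModule f z -> is_Cderive f z (C_derive f z).
Proof. intros H. apply C_derive_correct; auto. Qed.

Lemma continuous_R_C_eps (phi : R -> C) (t : R) :
  continuous phi t <->
  (forall eps, 0 < eps -> exists d, 0 < d /\ forall s, Rabs (s - t) < d ->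
     Cmod (phi s - phi t) < eps)%C.
Proof.
  split.
  - intros H eps He.
    (* Balls of [C] are products of intervals here, whence half of [eps] for each coordinate. *)
    assert (He2 : 0 < eps / 2) by lra.
    destruct (proj1 (filterlim_locally phi (phi t)) H (mkposreal _ He2)) as [d Hd].
    exists d; split; [apply cond_pos|]. intros s Hs.
    destruct (Hd s Hs) as [H1 H2].
    eapply Rle_lt_trans; [apply Cmod_le_re_im|].
    unfold ball in H1, H2; simpl in H1, H2.
    unfold AbsRing_ball, abs, minus, plus, opp in H1, H2; simpl in H1, H2.
    unfold Re, Im. simpl. lra.
  - intros H. apply filterlim_locally. intros eps.
    destruct (H eps (cond_pos eps)) as [d [Hd0 Hd]].
    exists (mkposreal d Hd0). intros s Hs.
    specialize (Hd s Hs).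
    split; unfold ball; simpl;
      unfold AbsRing_ball, abs, minus, plus, opp; simpl.
    + eapply Rle_lt_trans; [|exact Hd]. apply (re_le_Cmod (phi s - phi t)%C).
    + eapply Rle_lt_trans; [|exact Hd]. apply (im_le_Cmod (phi s - phi t)%C).
Qed.

Lemma continuous_R_Cmult (f g : R -> C) (t : R) :
  continuous f t -> continuous g t -> continuous (fun s => f s * g s)%C t.
Proof.
  intros Hf Hg.
  assert (Hf1 : continuous (fun s => fst (f s)) t)
    by (apply continuous_comp; [exact Hf | apply continuous_fst]).
  assert (Hf2 : continuous (fun s => snd (f s)) t)
    by (apply continuous_comp; [exact Hf | apply continuous_snd]).
  assert (Hg1 : continuous (fun s => fst (g s)) t)
    by (apply continuous_comp; [exact Hg | apply continuous_fst]).
  assert (Hg2 : continuous (fun s => snd (g s)) t)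
    by (apply continuous_comp; [exact Hg | apply continuous_snd]).
  apply filterlim_locally. intros eps.
  assert (A1 : continuous (fun s => fst (f s) * fst (g s) - snd (f s) * snd (g s)) t).
  { apply (@continuous_minus R_UniformSpace R_AbsRing R_NormedModule);
    apply (@continuous_mult R_UniformSpace R_AbsRing); auto. }
  assert (A2 : continuous (fun s => fst (f s) * snd (g s) + snd (f s) * fst (g s)) t).
  { apply (@continuous_plus R_UniformSpace R_AbsRing R_NormedModule);
    apply (@continuous_mult R_UniformSpace R_AbsRing); auto. }
  generalize (filter_and _ _ (proj1 (filterlim_locally _ _) A1 eps)
    (proj1 (filterlim_locally _ _) A2 eps)). apply filter_imp.
  intros s [B1 B2]. split; [exact B1 | exact B2].
Qed.

Lemma continuous_R_Cmod (phi : R -> C) (t : R) :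
  continuous phi t -> continuous (fun s => Cmod (phi s)) t.
Proof.
  intros H. rewrite continuous_R_C_eps in H.
  apply filterlim_locally. intros eps.
  destruct (H eps (cond_pos eps)) as [d [Hd0 Hd]].
  exists (mkposreal d Hd0). intros s Hs.
  unfold ball; simpl. unfold AbsRing_ball, abs, minus, plus, opp; simpl.
  eapply Rle_lt_trans; [|apply (Hd s Hs)].
  apply Rabs_le. split.
  - generalize (Cmod_minus_ge (phi t) (phi s)).
    rewrite <- (Cmod_opp (phi t - phi s)).
    replace (- (phi t - phi s))%C with (phi s - phi t)%C by ring. lra.
  - generalize (Cmod_minus_ge (phi s) (phi t)). lra.
Qed.

Lemma is_Cderive_continuous_comp (f : C -> C) (g : R -> C) (t : R) (l : C) :
  is_Cderive f (g t) l -> continuous g t -> continuous (fun s => f (g s)) t.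
Proof.
  intros Hf Hg. rewrite continuous_R_C_eps in *. intros eps He.
  rewrite is_Cderive_eps in Hf.
  destruct (Hf 1 Rlt_0_1) as [d [Hd H]].
  assert (HK : 0 < 1 + Cmod l) by (generalize (Cmod_ge_0 l); lra).
  assert (Hm : 0 < Rmin d (eps / (1 + Cmod l))).
  { apply Rmin_glb_lt; auto. apply Rdiv_lt_0_compat; auto. }
  destruct (Hg _ Hm) as [d' [Hd' H']].
  exists d'; split; auto. intros s Hs.
  specialize (H' s Hs).
  assert (H1 := Rlt_le_trans _ _ _ H' (Rmin_l _ _)).
  assert (H2 := Rlt_le_trans _ _ _ H' (Rmin_r _ _)).
  specialize (H _ H1).
  replace (g t + (g s - g t))%C with (g s) in H by ring.
  replace (f (g s) - f (g t))%C
    with (f (g s) - f (g t) - (g s - g t) * l + (g s - g t) * l)%C by ring.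
  eapply Rle_lt_trans; [apply Cmod_triangle|].
  rewrite Cmod_mult.
  apply Rle_lt_trans with ((1 + Cmod l) * Cmod (g s - g t)); [lra|].
  apply (Rmult_lt_compat_l (1 + Cmod l)) in H2; auto.
  eapply Rlt_le_trans; [exact H2|]. right. field. lra.
Qed.

Lemma continuous_line (p v : C) (t : R) :
  continuous (fun s : R => p + RtoC s * v)%C t.
Proof.
  apply continuous_R_C_eps. intros eps He.
  exists (eps / (1 + Cmod v)).
  assert (Hv := Cmod_ge_0 v).
  split; [apply Rdiv_lt_0_compat; lra|].
  intros s Hs.
  replace (p + RtoC s * v - (p + RtoC t * v))%C with (RtoC (s - t) * v)%C
    by (rewrite RtoC_minus; ring).
  rewrite Cmod_mult, Cmod_R.
  apply Rle_lt_trans with (Rabs (s - t) * (1 + Cmod v)).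
  - apply Rmult_le_compat_l; [apply Rabs_pos|lra].
  - apply (Rmult_lt_compat_r (1 + Cmod v)) in Hs; [|lra].
    eapply Rlt_le_trans; [exact Hs|]. right. field. lra.
Qed.

Lemma is_derive_line (f : C -> C) (p v l : C) (t : R) :
  is_Cderive f (p + RtoC t * v)%C l ->
  @is_derive R_AbsRing C_R_NormedModule (fun s : R => f (p + RtoC s * v)%C) t (l * v)%C.
Proof.
  intros H. rewrite is_Cderive_eps in H.
  split; [apply is_linear_scal_l|].
  intros x Hx eps.
  assert (E := @is_filter_lim_locally_unique R_AbsRing (AbsRing_NormedModule R_AbsRing) t x Hx).
  subst x. assert (Hv := Cmod_ge_0 v).
  assert (He : 0 < eps / (1 + Cmod v)).
  { apply Rdiv_lt_0_compat; [apply cond_pos|lra]. }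
  destruct (H _ He) as [d [Hd0 Hd]].
  assert (Hd' : 0 < d / (1 + Cmod v)) by (apply Rdiv_lt_0_compat; lra).
  exists (mkposreal _ Hd'). intros s Hs.
  unfold ball in Hs; simpl in Hs.
  unfold AbsRing_ball, abs, minus, plus, opp in Hs; simpl in Hs.
  change R in s.
  rewrite <- Cmod_norm.
  change (Cmod (f (p + RtoC s * v) - f (p + RtoC t * v) - @scal R_AbsRing C_R_NormedModule (s - t)%R (l * v)%C)%C <= eps * Rabs (s - t)).
  rewrite scal_R_Cmult.
  specialize (Hd (RtoC (s - t) * v)%C).
  replace (p + RtoC t * v + RtoC (s - t) * v)%C with (p + RtoC s * v)%C in Hd
    by (rewrite RtoC_minus; ring).
  rewrite (Cmult_comm l v), Cmult_assoc.
  rewrite Cmod_mult, Cmod_R in Hd.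
  eapply Rle_trans; [apply Hd|].
  - apply Rle_lt_trans with (Rabs (s - t) * (1 + Cmod v)).
    + apply Rmult_le_compat_l; [apply Rabs_pos|lra].
    + apply (Rmult_lt_compat_r (1 + Cmod v)) in Hs; [|lra].
      eapply Rlt_le_trans; [exact Hs|]. right. field. lra.
  - apply Rle_trans with (eps / (1 + Cmod v) * (Rabs (s - t) * (1 + Cmod v))).
    + apply Rmult_le_compat_l; [lra|]. apply Rmult_le_compat_l; [apply Rabs_pos|lra].
    + right. field. lra.
Qed.

Lemma CInt_line (f df : C -> C) (p v : C) (a b : R) :
  (forall t, Rmin a b <= t <= Rmax a b ->
     is_Cderive f (p + RtoC t * v)%C (df (p + RtoC t * v)%C)) ->
  (forall t, Rmin a b <= t <= Rmax a b ->
     continuous (fun s : R => df (p + RtoC s * v)%C) t) ->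
  is_CInt (fun t : R => df (p + RtoC t * v) * v)%C a b
    (f (p + RtoC b * v) - f (p + RtoC a * v))%C.
Proof.
  intros Hf Hc.
  apply (@is_RInt_derive C_R_CompleteNormedModule
           (fun t : R => f (p + RtoC t * v)%C) (fun t : R => (df (p + RtoC t * v) * v)%C)).
  - intros t Ht. apply is_derive_line. apply Hf, Ht.
  - intros t Ht. apply continuous_R_Cmult; [apply Hc, Ht|].
    apply continuous_const.
Qed.

(* Projecting on the direction of [f (p + v) - f p] reduces to the real mean value theorem. *)
Lemma Cderive_segment_bound (f df : C -> C) (p v : C) (K : R) :
  (forall t, 0 <= t <= 1 -> is_Cderive f (p + RtoC t * v)%C (df (p + RtoC t * v)%C)) ->
  (forall t, 0 <= t <= 1 -> Cmod (df (p + RtoC t * v)%C) <= K) ->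
  Cmod (f (p + v) - f p)%C <= K * Cmod v.
Proof.
  intros Hf HK.
  set (w := (f (p + v) - f p)%C).
  set (psi := fun c : C => Re w * Re c + Im w * Im c).
  assert (Hpsi : forall c, Rabs (psi c) <= Cmod w * Cmod c).
  { intros c. rewrite <- (Cmod_conj w), <- Cmod_mult.
    replace (psi c) with (Re (Cconj w * c)%C) by (unfold psi; destruct w, c; simpl; ring).
    apply re_le_Cmod. }
  assert (Hd : forall t, 0 <= t <= 1 ->
    is_derive (fun s : R => psi (f (p + RtoC s * v)%C)) t
      (psi (df (p + RtoC t * v)%C * v)%C)).
  { intros t Ht. assert (D := is_derive_line _ _ _ _ _ (Hf t Ht)).
    assert (D1 : is_derive (fun s : R => Re (f (p + RtoC s * v)%C)) t
               (Re (df (p + RtoC t * v)%C * v)%C)).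
    { apply (filterdiff_comp' (fun s : R => f (p + RtoC s * v)%C) (fst : C_R_NormedModule -> R) t
               _ (fst : C_R_NormedModule -> R) D).
      apply filterdiff_linear. apply is_linear_fst. }
    assert (D2 : is_derive (fun s : R => Im (f (p + RtoC s * v)%C)) t
               (Im (df (p + RtoC t * v)%C * v)%C)).
    { apply (filterdiff_comp' (fun s : R => f (p + RtoC s * v)%C) (snd : C_R_NormedModule -> R) t
               _ (snd : C_R_NormedModule -> R) D).
      apply filterdiff_linear. apply is_linear_snd. }
    unfold psi.
    apply (is_derive_plus (fun s : R => Re w * Re (f (p + RtoC s * v)%C))
             (fun s : R => Im w * Im (f (p + RtoC s * v)%C)));
    apply is_derive_scal; assumption. }
  destruct (MVT_gen (fun s : R => psi (f (p + RtoC s * v)%C)) 0 1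
     (fun t => psi (df (p + RtoC t * v)%C * v)%C)) as [c [Hc E]].
  - intros t. rewrite Rmin_left, Rmax_right by lra. intros Ht. apply Hd; lra.
  - intros t. rewrite Rmin_left, Rmax_right by lra. intros Ht.
    apply continuity_pt_filterlim, (ex_derive_continuous (K:=R_AbsRing) (V:=R_NormedModule)). eexists. apply Hd, Ht.
  - rewrite Rmin_left, Rmax_right in Hc by lra.
    replace (p + RtoC 1 * v)%C with (p + v)%C in E by ring.
    replace (p + RtoC 0 * v)%C with p in E by ring.
    assert (E2 : psi (f (p + v)%C) - psi (f p) = Cmod w ^ 2).
    { rewrite Cmod2_alt. unfold psi, w. destruct (f (p + v)%C), (f p). simpl. ring. }
    rewrite E2 in E.
    assert (B := Hpsi (df (p + RtoC c * v)%C * v)%C).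
    rewrite Cmod_mult in B.
    assert (B2 := HK c Hc).
    assert (Hw := Cmod_ge_0 w). assert (Hv := Cmod_ge_0 v).
    destruct (Req_dec (Cmod w) 0) as [W|W]; [rewrite W|].
    + assert (0 <= K) by (eapply Rle_trans; [apply Cmod_ge_0|exact B2]). nra.
    + assert (Cmod w * Cmod w <= Cmod w * (K * Cmod v)).
      { generalize (Rle_abs (psi (df (p + RtoC c * v)%C * v)%C)). intros.
        assert (Cmod (df (p + RtoC c * v)%C) * Cmod v <= K * Cmod v)
          by (apply Rmult_le_compat_r; auto).
        assert (Cmod w * (Cmod (df (p + RtoC c * v)%C) * Cmod v) <= Cmod w * (K * Cmod v))
          by (apply Rmult_le_compat_l; auto).
        simpl in E. lra. }
      apply Rmult_le_reg_l in H; lra.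
Qed.

(** * Integrals of complex functions of a real variable *)

Lemma ex_CInt_continuous (phi : R -> C) (a b : R) : a <= b ->
  (forall t, a <= t <= b -> continuous phi t) -> ex_CInt phi a b.
Proof.
  intros Hab H. apply (@ex_RInt_continuous C_R_CompleteNormedModule).
  intros t. rewrite Rmin_left, Rmax_right by lra. apply H.
Qed.

Lemma CInt_correct (f : R -> C) (a b : R) :
  ex_CInt f a b -> is_CInt f a b (CInt f a b).
Proof. apply (@RInt_correct C_R_CompleteNormedModule). Qed.

Lemma is_CInt_unique (f : R -> C) (a b : R) (l : C) :
  is_CInt f a b l -> CInt f a b = l.
Proof. apply (@is_RInt_unique C_R_CompleteNormedModule). Qed.

Lemma Cmod_CInt_le_const (phi : R -> C) (a b M : R) : a <= b ->
  ex_CInt phi a b -> (forall t, a <= t <= b -> Cmod (phi t) <= M) ->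
  Cmod (CInt phi a b) <= (b - a) * M.
Proof.
  intros Hab He H.
  rewrite Cmod_norm. apply (@norm_RInt_le_const C_R_NormedModule phi a b); auto.
  { intros t Ht. rewrite <- Cmod_norm. auto. }
  apply (@RInt_correct C_R_CompleteNormedModule), He.
Qed.

Lemma Cmod_CInt_le (phi : R -> C) (g : R -> R) (a b : R) : a <= b ->
  ex_CInt phi a b -> ex_RInt g a b ->
  (forall t, a <= t <= b -> Cmod (phi t) <= g t) ->
  Cmod (CInt phi a b) <= RInt g a b.
Proof.
  intros Hab He Hg H.
  rewrite Cmod_norm. apply (@norm_RInt_le C_R_NormedModule phi g a b); auto.
  { intros t Ht. rewrite <- Cmod_norm. auto. }
  - apply (@RInt_correct C_R_CompleteNormedModule), He.
  - apply (@RInt_correct R_CompleteNormedModule), Hg.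
Qed.

(** The integral takes values in a real normed module, so it is linear over the reals by
    construction; complex scalars go through real and imaginary parts. *)
Lemma is_CInt_Cmult (c : C) (phi : R -> C) (a b : R) (l : C) :
  is_CInt phi a b l ->
  is_CInt (fun t => c * phi t)%C a b (c * l)%C.
Proof.
  intros H.
  assert (H1 : is_RInt (fun t => Re (phi t)) a b (Re l))
    by (apply (@is_RInt_fct_extend_fst R_NormedModule R_NormedModule phi a b l H)).
  assert (H2 : is_RInt (fun t => Im (phi t)) a b (Im l))
    by (apply (@is_RInt_fct_extend_snd R_NormedModule R_NormedModule phi a b l H)).
  apply (@is_RInt_fct_extend_pair R_NormedModule R_NormedModule
           (fun t => (c * phi t)%C) a b (Re (c * l)%C) (Im (c * l)%C)).
  - apply (is_RInt_ext (fun t => minus (scal (Re c) (Re (phi t))) (scal (Im c) (Im (phi t))))).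
    + intros t _. reflexivity.
    + apply (@is_RInt_minus R_NormedModule); apply (@is_RInt_scal R_NormedModule); auto.
  - apply (is_RInt_ext (fun t => plus (scal (Re c) (Im (phi t))) (scal (Im c) (Re (phi t))))).
    + intros t _. reflexivity.
    + apply (@is_RInt_plus R_NormedModule); apply (@is_RInt_scal R_NormedModule); auto.
Qed.

Lemma is_CInt_plus (f g : R -> C) (a b : R) (lf lg : C) :
  is_CInt f a b lf -> is_CInt g a b lg ->
  is_CInt (fun t => f t + g t)%C a b (lf + lg)%C.
Proof. intros Hf Hg. apply (@is_RInt_plus C_R_NormedModule); auto. Qed.

Lemma is_CInt_minus (f g : R -> C) (a b : R) (lf lg : C) :
  is_CInt f a b lf -> is_CInt g a b lg ->
  is_CInt (fun t => f t - g t)%C a b (lf - lg)%C.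
Proof. intros Hf Hg. apply (@is_RInt_minus C_R_NormedModule); auto. Qed.

(** The integration lemmas leave equalities in the carrier of a module; [ring] works once the type
    is displayed as [C]. *)
Ltac Cring := match goal with |- @eq _ ?x ?y => change (@eq C x y) end; ring.

(** * Goursat's theorem *)

Lemma Cplus_sub_cancel (a b : C) : (a + (b - a))%C = b.
Proof. ring. Qed.

Section Bisection.

Variable P : R -> R -> R -> R -> Prop.
Hypothesis P_split : forall a b c d, a <= b -> c <= d ->
  let m := (a + b) / 2 in let n := (c + d) / 2 in
  P a m c n -> P m b c n -> P a m n d -> P m b n d -> P a b c d.

Let quarter (r r' : R * R * (R * R)) : Prop :=
  let '((a, b), (c, d)) := r in let '((a', b'), (c', d')) := r' in
  a <= a' /\ b' <= b /\ b' - a' = (b - a) / 2 /\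
  c <= c' /\ d' <= d /\ d' - c' = (d - c) / 2 /\
  ~ P a' b' c' d'.

(** The hypotheses stand under the existential so that a choice function is defined on every
    quadruple; the zero rectangle is a default value for the irrelevant ones. *)
Lemma bad_quarter (r : R * R * (R * R)) : exists r' : R * R * (R * R),
  let '((a, b), (c, d)) := r in
  a <= b -> c <= d -> ~ P a b c d -> quarter r r'.
Proof.
  destruct r as [[a b] [c d]].
  destruct (classic (a <= b /\ c <= d /\ ~ P a b c d)) as [[Hab [Hcd H]]|H];
    [|exists (0, 0, (0, 0)); tauto].
  set (m := (a + b) / 2). set (n := (c + d) / 2).
  destruct (classic (P a m c n)) as [H1|H1];
    [|exists (a, m, (c, n)); intros; unfold quarter; repeat split; auto; unfold m, n; lra].
  destruct (classic (P m b c n)) as [H2|H2];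
    [|exists (m, b, (c, n)); intros; unfold quarter; repeat split; auto; unfold m, n; lra].
  destruct (classic (P a m n d)) as [H3|H3];
    [|exists (a, m, (n, d)); intros; unfold quarter; repeat split; auto; unfold m, n; lra].
  destruct (classic (P m b n d)) as [H4|H4];
    [|exists (m, b, (n, d)); intros; unfold quarter; repeat split; auto; unfold m, n; lra].
  elim H. apply P_split; auto.
Qed.

(** Compactness of a rectangle in inductive form. If [P] failed, choosing a failing quarter again
    and again would give nested rectangles shrinking to a point, and there the local hypothesis
    applies. It serves both Goursat's theorem and the boundedness of analytic functions on compact
    discs. *)
Lemma bisection_induction (a b c d : R) : a <= b -> c <= d ->
  (forall x y, a <= x <= b -> c <= y <= d -> exists delta, 0 < delta /\
     forall a' b' c' d', a <= a' <= x -> x <= b' <= b -> c <= c' <= y -> y <= d' <= d ->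
       b' - a' < delta -> d' - c' < delta -> P a' b' c' d') ->
  P a b c d.
Proof.
  intros Hab Hcd Hloc. apply NNPP. intros Hbad.
  set (next := fun r => proj1_sig (constructive_indefinite_description _ (bad_quarter r))).
  set (u := fix u n := match n with O => (a, b, (c, d)) | S k => next (u k) end).
  set (A := fun n => fst (fst (u n))). set (B := fun n => snd (fst (u n))).
  set (C' := fun n => fst (snd (u n))). set (D := fun n => snd (snd (u n))).
  assert (Hu : forall n, A n <= B n /\ C' n <= D n /\ ~ P (A n) (B n) (C' n) (D n) /\
     B n - A n = (b - a) / 2 ^ n /\ D n - C' n = (d - c) / 2 ^ n /\
     A n <= A (S n) /\ B (S n) <= B n /\ C' n <= C' (S n) /\ D (S n) <= D n).
  { assert (Hs : forall n, A n <= B n -> C' n <= D n -> ~ P (A n) (B n) (C' n) (D n) ->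
       A n <= A (S n) /\ B (S n) <= B n /\ B (S n) - A (S n) = (B n - A n) / 2 /\
       C' n <= C' (S n) /\ D (S n) <= D n /\ D (S n) - C' (S n) = (D n - C' n) / 2 /\
       ~ P (A (S n)) (B (S n)) (C' (S n)) (D (S n))).
    { intros n. unfold A, B, C', D. simpl. unfold next.
      destruct (constructive_indefinite_description _ (bad_quarter (u n))) as [r' Hr'].
      simpl. destruct (u n) as [[a1 b1] [c1 d1]]. destruct r' as [[a2 b2] [c2 d2]].
      simpl. intros H1 H2 H3. apply Hr'; auto. }
    assert (Hi : forall n, A n <= B n /\ C' n <= D n /\ ~ P (A n) (B n) (C' n) (D n) /\
     B n - A n = (b - a) / 2 ^ n /\ D n - C' n = (d - c) / 2 ^ n).
    { induction n as [|n [H1 [H2 [H3 [H4 H5]]]]].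
      - unfold A, B, C', D; simpl. repeat split; auto; field.
      - destruct (Hs n H1 H2 H3) as [S1 [S2 [S3 [S4 [S5 [S6 S7]]]]]].
        assert (H0 : 0 < 2 ^ n) by (apply pow_lt; lra).
        repeat split; auto; try lra.
        + rewrite S3, H4. simpl. field. lra.
        + rewrite S6, H5. simpl. field. lra. }
    intros n. destruct (Hi n) as [H1 [H2 [H3 [H4 H5]]]].
    destruct (Hs n H1 H2 H3) as [S1 [S2 [S3 [S4 [S5 [S6 S7]]]]]].
    repeat split; auto. }
  assert (Hlim : forall X Y : nat -> R,
    (forall n, X n <= Y n /\ X n <= X (S n) /\ Y (S n) <= Y n) ->
    exists x, forall n, X n <= x <= Y n).
  { intros X Y HXY.
    assert (HX : forall n m, (n <= m)%nat -> X n <= X m).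
    { induction 1; [lra|]. eapply Rle_trans; [eassumption|]. apply HXY. }
    assert (HY : forall n m, (n <= m)%nat -> Y m <= Y n).
    { induction 1; [lra|]. eapply Rle_trans; [|eassumption]. apply HXY. }
    assert (HXY' : forall n m, X n <= Y m).
    { intros n m. apply Rle_trans with (X (n + m)%nat); [apply HX; lia|].
      apply Rle_trans with (Y (n + m)%nat); [apply HXY|apply HY; lia]. }
    destruct (completeness (fun x => exists n, x = X n)) as [x [Hx1 Hx2]].
    - exists (Y 0%nat). intros x [n ->]. apply HXY'.
    - exists (X 0%nat), 0%nat. reflexivity.
    - exists x. intros n. split; [apply Hx1; exists n; reflexivity|].
      apply Hx2. intros y [m ->]. apply HXY'. }
  destruct (Hlim A B) as [x Hx]. { intros n. repeat split; apply Hu. }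
  destruct (Hlim C' D) as [y Hy]. { intros n. repeat split; apply Hu. }
  destruct (Hloc x y (Hx 0%nat) (Hy 0%nat)) as [delta [Hd H]].
  assert (Hn : exists n, (b - a) / 2 ^ n < delta /\ (d - c) / 2 ^ n < delta).
  { set (L := (b - a) + (d - c)).
    destruct (pow_lt_1_zero (1 / 2)) with (y := delta / (L + 1)) as [n Hn].
    - rewrite Rabs_pos_eq; lra.
    - apply Rdiv_lt_0_compat; unfold L; lra.
    - exists n. specialize (Hn n (le_n n)).
      rewrite Rabs_pos_eq in Hn by (apply pow_le; lra).
      assert (HL : 0 < L + 1) by (unfold L; lra).
      assert (H2 : 0 < 2 ^ n) by (apply pow_lt; lra).
      replace ((1 / 2) ^ n) with (/ 2 ^ n) in Hn
        by (unfold Rdiv; rewrite Rmult_1_l, pow_inv; reflexivity).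
      apply (Rmult_lt_compat_r (L + 1)) in Hn; [|lra].
      replace (delta / (L + 1) * (L + 1)) with delta in Hn by (field; lra).
      assert (H3 : 0 < / 2 ^ n) by (apply Rinv_0_lt_compat; lra).
      unfold Rdiv, L in *. split; nra. }
  destruct Hn as [n [Hn1 Hn2]].
  assert (Hmono : forall m, a <= A m /\ B m <= b /\ c <= C' m /\ D m <= d).
  { induction m as [|m IH]; [unfold A, B, C', D; simpl; lra|].
    destruct (Hu m) as [_ [_ [_ [_ [_ [? [? [? ?]]]]]]]]. lra. }
  destruct (Hu n) as [H1 [H2 [H3 [H4 [H5 _]]]]].
  apply H3. specialize (Hmono n). specialize (Hx n). specialize (Hy n).
  apply H; lra.
Qed.

End Bisection.

(** Counterclockwise contour integral over the boundary of [a,b] x [c,d]; the factor i is dz/dt on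
    the vertical sides. *)
Definition rect_int (phi : C -> C) (a b c d : R) : C :=
  (CInt (fun s : R => phi (s, c)) a b - CInt (fun s : R => phi (s, d)) a b
   + Ci * (CInt (fun t : R => phi (b, t)) c d - CInt (fun t : R => phi (a, t)) c d))%C.

Definition Cdiff_on_rect (phi : C -> C) (a b c d : R) : Prop :=
  forall x y, a <= x <= b -> c <= y <= d ->
    @ex_derive C_AbsRing C_NormedModule phi (x, y).

Lemma continuous_horizontal (y t : R) : continuous (fun s : R => (s, y) : C) t.
Proof.
  apply (continuous_ext (fun s : R => (0, y) + RtoC s * 1)%C).
  - intros s. apply injective_projections; simpl; ring.
  - apply continuous_line.
Qed.

Lemma continuous_vertical (x t : R) : continuous (fun s : R => (x, s) : C) t.
Proof.
  apply (continuous_ext (fun s : R => (x, 0) + RtoC s * Ci)%C).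
  - intros s. apply injective_projections; simpl; ring.
  - apply continuous_line.
Qed.

Section RectInt.

Variables (phi : C -> C) (a b c d : R).
Hypothesis Hphi : Cdiff_on_rect phi a b c d.

Lemma ex_CInt_horizontal (y x1 x2 : R) : a <= x1 <= x2 -> x2 <= b -> c <= y <= d ->
  ex_CInt (fun s : R => phi (s, y)) x1 x2.
Proof.
  intros H1 H2 Hy. apply ex_CInt_continuous; [lra|]. intros t Ht.
  apply (is_Cderive_continuous_comp phi (fun s : R => (s, y)) t (C_derive phi (t, y))).
  - apply ex_Cderive_correct, Hphi; lra.
  - apply continuous_horizontal.
Qed.

Lemma ex_CInt_vertical (x y1 y2 : R) : c <= y1 <= y2 -> y2 <= d -> a <= x <= b ->
  ex_CInt (fun t : R => phi (x, t)) y1 y2.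
Proof.
  intros H1 H2 Hx. apply ex_CInt_continuous; [lra|]. intros t Ht.
  apply (is_Cderive_continuous_comp phi (fun s : R => (x, s)) t (C_derive phi (x, t))).
  - apply ex_Cderive_correct, Hphi; lra.
  - apply continuous_vertical.
Qed.

End RectInt.

Lemma CInt_Chasles (f : R -> C) (a b c : R) : ex_CInt f a b -> ex_CInt f b c ->
  CInt f a c = (CInt f a b + CInt f b c)%C.
Proof.
  intros H1 H2. symmetry. apply (@RInt_Chasles C_R_CompleteNormedModule); auto.
Qed.

Lemma CInt_minus (f g : R -> C) (a b : R) : ex_CInt f a b -> ex_CInt g a b ->
  CInt (fun t => f t - g t)%C a b = (CInt f a b - CInt g a b)%C.
Proof.
  intros H1 H2. apply (@RInt_minus C_R_CompleteNormedModule); auto.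
Qed.

Lemma rect_int_split (phi : C -> C) (a b c d m n : R) :
  a <= m <= b -> c <= n <= d -> Cdiff_on_rect phi a b c d ->
  rect_int phi a b c d =
  (rect_int phi a m c n + rect_int phi m b c n
   + rect_int phi a m n d + rect_int phi m b n d)%C.
Proof.
  intros Hm Hn H. unfold rect_int.
  rewrite (CInt_Chasles (fun s : R => phi (s, c)) a m b);
    [|apply (ex_CInt_horizontal phi a b c d); auto; lra..].
  rewrite (CInt_Chasles (fun s : R => phi (s, d)) a m b);
    [|apply (ex_CInt_horizontal phi a b c d); auto; lra..].
  rewrite (CInt_Chasles (fun t : R => phi (a, t)) c n d);
    [|apply (ex_CInt_vertical phi a b c d); auto; lra..].
  rewrite (CInt_Chasles (fun t : R => phi (b, t)) c n d);
    [|apply (ex_CInt_vertical phi a b c d); auto; lra..].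
  ring.
Qed.

Lemma rect_int_minus (f g : C -> C) (a b c d : R) : a <= b -> c <= d ->
  Cdiff_on_rect f a b c d -> Cdiff_on_rect g a b c d ->
  rect_int (fun z => f z - g z)%C a b c d = (rect_int f a b c d - rect_int g a b c d)%C.
Proof.
  intros Hab Hcd Hf Hg. unfold rect_int.
  assert (Hh : forall y, c <= y <= d ->
    CInt (fun s : R => (f (s, y) - g (s, y))%C) a b
    = (CInt (fun s : R => f (s, y)) a b - CInt (fun s : R => g (s, y)) a b)%C).
  { intros y Hy. apply CInt_minus.
    - apply (ex_CInt_horizontal f a b c d); auto; lra.
    - apply (ex_CInt_horizontal g a b c d); auto; lra. }
  assert (Hv : forall x, a <= x <= b ->
    CInt (fun t : R => (f (x, t) - g (x, t))%C) c d
    = (CInt (fun t : R => f (x, t)) c d - CInt (fun t : R => g (x, t)) c d)%C).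
  { intros x Hx. apply CInt_minus.
    - apply (ex_CInt_vertical f a b c d); auto; lra.
    - apply (ex_CInt_vertical g a b c d); auto; lra. }
  rewrite (Hh c), (Hh d), (Hv a), (Hv b) by lra. ring.
Qed.

Lemma rect_int_bound (phi : C -> C) (a b c d M : R) : a <= b -> c <= d ->
  Cdiff_on_rect phi a b c d ->
  (forall x y, a <= x <= b -> c <= y <= d -> Cmod (phi (x, y)) <= M) ->
  Cmod (rect_int phi a b c d) <= 2 * ((b - a) + (d - c)) * M.
Proof.
  intros Hab Hcd H HM. unfold rect_int.
  eapply Rle_trans; [apply Cmod_triangle|].
  rewrite Cmod_mult, Cmod_Ci.
  assert (B1 := Cmod_minus_le (CInt (fun s : R => phi (s, c)) a b) (CInt (fun s : R => phi (s, d)) a b)).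
  assert (B2 := Cmod_minus_le (CInt (fun s : R => phi (b, s)) c d) (CInt (fun s : R => phi (a, s)) c d)).
  assert (H1 : forall y, c <= y <= d -> Cmod (CInt (fun s : R => phi (s, y)) a b) <= (b - a) * M).
  { intros y Hy. apply Cmod_CInt_le_const; auto.
    apply (ex_CInt_horizontal phi a b c d); auto; lra. }
  assert (H2 : forall x, a <= x <= b -> Cmod (CInt (fun s : R => phi (x, s)) c d) <= (d - c) * M).
  { intros x Hx. apply Cmod_CInt_le_const; auto.
    apply (ex_CInt_vertical phi a b c d); auto; lra. }
  assert (H1c : c <= c <= d) by lra. assert (H1d : c <= d <= d) by lra.
  assert (H2a : a <= a <= b) by lra. assert (H2b : a <= b <= b) by lra.
  generalize (H1 _ H1c) (H1 _ H1d) (H2 _ H2a) (H2 _ H2b). lra.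
Qed.

(** Disposes of the affine approximation in Goursat's argument. *)
Lemma rect_int_primitive (G phi dphi : C -> C) (a b c d : R) : a <= b -> c <= d ->
  (forall z, is_Cderive G z (phi z)) -> (forall z, is_Cderive phi z (dphi z)) ->
  rect_int phi a b c d = 0%C.
Proof.
  intros Hab Hcd HG Hp.
  assert (Hh : forall y, CInt (fun s : R => phi (s, y)) a b = (G (b, y) - G (a, y))%C).
  { intros y.
    assert (E : forall s : R, ((0, y) + RtoC s * 1)%C = (s, y))
      by (intros s; apply injective_projections; simpl; ring).
    apply (@is_RInt_unique C_R_CompleteNormedModule).
    rewrite <- (E b), <- (E a).
    apply (is_RInt_ext (fun s : R => (phi ((0, y) + RtoC s * 1) * 1)%C)).
    - intros s _. rewrite E. Cring.
    - apply (CInt_line G phi).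
      + intros t _. apply HG.
      + intros t _. eapply is_Cderive_continuous_comp; [apply Hp|apply continuous_line]. }
  assert (Hv : forall x, (Ci * CInt (fun s : R => phi (x, s)) c d)%C = (G (x, d) - G (x, c))%C).
  { intros x.
    assert (E : forall s : R, ((x, 0) + RtoC s * Ci)%C = (x, s))
      by (intros s; apply injective_projections; simpl; ring).
    assert (I : is_CInt (fun t : R => phi (x, t) * Ci)%C c d (G (x, d) - G (x, c))%C).
    { rewrite <- (E d), <- (E c).
      apply (is_RInt_ext (fun s : R => (phi ((x, 0) + RtoC s * Ci) * Ci)%C)).
      - intros s _. rewrite E. reflexivity.
      - apply (CInt_line G phi).
        + intros t _. apply HG.
        + intros t _. eapply is_Cderive_continuous_comp; [apply Hp|apply continuous_line]. }
    apply (is_CInt_Cmult (- Ci)%C) in I.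
    assert (I2 : CInt (fun s : R => phi (x, s)) c d = (- Ci * (G (x, d) - G (x, c)))%C).
    { apply (@is_RInt_unique C_R_CompleteNormedModule).
      eapply is_RInt_ext; [|exact I]. intros s _. simpl.
      replace (- Ci * (phi (x, s) * Ci))%C with ((- (Ci * Ci)) * phi (x, s))%C by ring.
      replace (Ci * Ci)%C with (- RtoC 1)%C by (apply injective_projections; simpl; ring).
      apply injective_projections; simpl; ring. }
    rewrite I2.
    replace (Ci * (- Ci * (G (x, d) - G (x, c))))%C with ((- (Ci * Ci)) * (G (x, d) - G (x, c)))%C by ring.
    replace (Ci * Ci)%C with (- RtoC 1)%C by (apply injective_projections; simpl; ring).
    ring. }
  unfold rect_int. rewrite !Hh.
  replace (Ci * (CInt (fun t : R => phi (b, t)) c d - CInt (fun t : R => phi (a, t)) c d))%C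
    with (Ci * CInt (fun t : R => phi (b, t)) c d - Ci * CInt (fun t : R => phi (a, t)) c d)%C by ring.
  rewrite !Hv. ring.
Qed.

(** The bound eps (width^2 + height^2) is additive under division into four quarters, so bisection
    reduces it to small rectangles around a point. There the affine approximation [L] integrates to
    zero and only the differentiability error remains. *)
Lemma Goursat (phi : C -> C) (a b c d : R) : a <= b -> c <= d ->
  Cdiff_on_rect phi a b c d -> rect_int phi a b c d = 0%C.
Proof.
  intros Hab Hcd Hphi.
  assert (H : forall eps, 0 < eps ->
    Cmod (rect_int phi a b c d) <= eps * ((b - a) ^ 2 + (d - c) ^ 2)).
  { intros eps He.
    cut (Cdiff_on_rect phi a b c d ->
      Cmod (rect_int phi a b c d) <= eps * ((b - a) ^ 2 + (d - c) ^ 2)); [auto|].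
    apply (bisection_induction (fun a b c d => Cdiff_on_rect phi a b c d ->
      Cmod (rect_int phi a b c d) <= eps * ((b - a) ^ 2 + (d - c) ^ 2))); auto.
    - clear. intros a b c d Hab Hcd m n H1 H2 H3 H4 H.
      assert (Hm : a <= m <= b) by (unfold m; lra).
      assert (Hn : c <= n <= d) by (unfold n; lra).
      rewrite (rect_int_split phi a b c d m n); auto.
      assert (S : forall a' b' c' d', a <= a' -> b' <= b -> c <= c' -> d' <= d ->
        Cdiff_on_rect phi a' b' c' d').
      { intros a' b' c' d' ? ? ? ? x y Hx Hy. apply H; lra. }
      assert (K1 := H1 (S a m c n ltac:(lra) ltac:(lra) ltac:(lra) ltac:(lra))).
      assert (K2 := H2 (S m b c n ltac:(lra) ltac:(lra) ltac:(lra) ltac:(lra))).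
      assert (K3 := H3 (S a m n d ltac:(lra) ltac:(lra) ltac:(lra) ltac:(lra))).
      assert (K4 := H4 (S m b n d ltac:(lra) ltac:(lra) ltac:(lra) ltac:(lra))).
      eapply Rle_trans; [apply Cmod_triangle|].
      eapply Rle_trans; [apply Rplus_le_compat_r, Cmod_triangle|].
      eapply Rle_trans; [apply Rplus_le_compat_r, Rplus_le_compat_r, Cmod_triangle|].
      eapply Rle_trans; [repeat apply Rplus_le_compat; eassumption|].
      right. unfold m, n. field.
    - intros x y Hx Hy.
      assert (D := ex_Cderive_correct _ _ (Hphi x y Hx Hy)).
      set (l := C_derive phi (x, y)) in D. rewrite is_Cderive_eps in D.
      (* With s = width + height, the error is at most (eps/4) s on a boundary of length 2 s, and
         s^2 / 2 <= width^2 + height^2. Sides below r/2 keep s below r. *)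
      destruct (D (eps / 4)) as [r [Hr HD]]; [lra|].
      exists (r / 2). split; [lra|].
      intros a' b' c' d' Ha Hb Hc Hd Hab' Hcd' H.
      set (L := fun z : C => (phi (x, y) + (z - (x, y)) * l)%C).
      set (G := fun z : C => (phi (x, y) * z + RtoC (/ 2) * ((z - (x, y)) * (z - (x, y))) * l)%C).
      assert (HL : forall z, is_Cderive L z l).
      { intros z.
        assert (HZ := is_Cderive_plus _ _ _ _ _ (is_Cderive_id z) (is_Cderive_const (- (x, y))%C z)).
        assert (HZ2 := is_Cderive_mult _ _ _ _ _ HZ (is_Cderive_const l z)).
        assert (HZ3 := is_Cderive_plus _ _ _ _ _ (is_Cderive_const (phi (x, y)) z) HZ2).
        match type of HZ3 with is_derive _ _ ?e => replace l with e; [exact HZ3|ring] end. }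
      assert (HG : forall z, is_Cderive G z (L z)).
      { intros z. unfold G.
        assert (HZ : is_Cderive (fun z => z - (x, y))%C z (1 + 0)%C).
        { apply is_Cderive_plus; [apply is_Cderive_id|apply (is_Cderive_const (- (x, y))%C)]. }
        assert (HZ2 := is_Cderive_mult _ _ _ _ _ HZ HZ).
        assert (HZ3 := is_Cderive_mult _ _ _ _ _ (is_Cderive_const (RtoC (/ 2)) z) HZ2).
        assert (HZ4 := is_Cderive_mult _ _ _ _ _ HZ3 (is_Cderive_const l z)).
        assert (HZ5 := is_Cderive_mult _ _ _ _ _ (is_Cderive_const (phi (x, y)) z) (is_Cderive_id z)).
        assert (HZ6 := is_Cderive_plus _ _ _ _ _ HZ5 HZ4).
        unfold L. simpl in HZ6.
        match type of HZ6 with is_derive _ _ ?e =>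
          replace (phi (x, y) + (z - (x, y)) * l)%C with e; [exact HZ6|] end.
        assert (E : (RtoC (/ 2) + RtoC (/ 2))%C = 1%C)
          by (apply injective_projections; simpl; field).
        transitivity (phi (x, y) + (RtoC (/ 2) + RtoC (/ 2)) * ((z - (x, y)) * l))%C;
          [ring|rewrite E; ring]. }
      assert (E0 : rect_int L a' b' c' d' = 0%C).
      { apply (rect_int_primitive G L (fun _ => l)); auto; lra. }
      replace (rect_int phi a' b' c' d')
        with (rect_int (fun z => phi z - L z)%C a' b' c' d').
      2:{ rewrite rect_int_minus; auto; try lra.
          - rewrite E0. ring.
          - intros x' y' _ _. exists l. apply HL. }
      set (s := (b' - a') + (d' - c')).
      eapply Rle_trans; [apply (rect_int_bound _ _ _ _ _ (eps / 4 * s)); try lra|].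
      + intros x' y' Hx' Hy'.
        assert (DD := is_Cderive_plus _ _ _ _ _ (ex_Cderive_correct _ _ (H x' y' Hx' Hy'))
           (is_Cderive_mult _ _ _ _ _ (is_Cderive_const (- RtoC 1)%C (x', y')) (HL (x', y')))).
        eexists. eapply (@is_derive_ext C_AbsRing C_NormedModule); [|exact DD].
        intros t. simpl. change (phi t + (- RtoC 1) * L t = phi t - L t)%C. ring.
      + intros x' y' Hx' Hy'.
        assert (Hs : Cmod ((x', y') - (x, y))%C <= s).
        { eapply Rle_trans; [apply Cmod_le_re_im|]. simpl. unfold s.
          apply Rplus_le_compat; apply Rabs_le; lra. }
        specialize (HD ((x', y') - (x, y))%C).
        rewrite Cplus_sub_cancel in HD.
        unfold L.
        replace (phi (x', y') - (phi (x, y) + ((x', y') - (x, y)) * l))%C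
          with (phi (x', y') - phi (x, y) - ((x', y') - (x, y)) * l)%C by ring.
        eapply Rle_trans; [apply HD; unfold s in Hs; lra|].
        apply Rmult_le_compat_l; lra.
      + unfold s. generalize (pow2_ge_0 ((b' - a') - (d' - c'))). intros Hsq.
        apply (Rmult_le_compat_l (eps / 2)) in Hsq; lra. }
  set (K := (b - a) ^ 2 + (d - c) ^ 2) in H.
  assert (HK : 0 <= K) by (unfold K; generalize (pow2_ge_0 (b - a)) (pow2_ge_0 (d - c)); lra).
  apply Cmod_eq_0. apply Rle_antisym; [|apply Cmod_ge_0].
  apply Rnot_lt_le. intros Hpos.
  specialize (H (Cmod (rect_int phi a b c d) / (2 * (K + 1)))).
  assert (0 < Cmod (rect_int phi a b c d) / (2 * (K + 1))) by (apply Rdiv_lt_0_compat; lra).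
  specialize (H H0).
  set (X := Cmod (rect_int phi a b c d)) in *.
  replace (X / (2 * (K + 1)) * K) with (X / 2 - X / (2 * (K + 1))) in H by (field; lra).
  lra.
Qed.

(** * Cauchy's formula for the derivative *)

Lemma cexp_plus (z w : C) : cexp (z + w)%C = (cexp z * cexp w)%C.
Proof.
  unfold cexp. destruct z as [x y], w as [u v]. simpl.
  rewrite exp_plus, cos_plus, sin_plus.
  apply injective_projections; simpl; ring.
Qed.

Lemma cexp_0 : cexp 0%C = 1%C.
Proof.
  unfold cexp. simpl. rewrite exp_0, cos_0, sin_0.
  apply injective_projections; simpl; ring.
Qed.

Lemma Cmod_eit (t : R) : Cmod (eit t) = 1.
Proof.
  unfold Cmod, eit. simpl. transitivity (sqrt 1); [f_equal|apply sqrt_1].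
  generalize (sin2_cos2 t). unfold Rsqr. lra.
Qed.

Lemma cexp_polar (z : C) : cexp z = (RtoC (exp (Re z)) * eit (Im z))%C.
Proof. unfold cexp, eit. apply injective_projections; simpl; ring. Qed.

Lemma Cmod_cexp (z : C) : Cmod (cexp z) = exp (Re z).
Proof.
  rewrite cexp_polar, Cmod_mult, Cmod_eit, Cmod_R, Rabs_pos_eq; [ring|].
  left. apply exp_pos.
Qed.

Lemma eit_opp (t : R) : (eit t * eit (- t))%C = 1%C.
Proof.
  unfold eit. rewrite cos_neg, sin_neg.
  generalize (sin2_cos2 t). unfold Rsqr. intros E.
  apply injective_projections; simpl; lra.
Qed.

Lemma derivable_pt_lim_at_0 (f : R -> R) (l eps : R) :
  derivable_pt_lim f 0 l -> 0 < eps -> exists d, 0 < d /\ forall h, Rabs h < d ->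
    Rabs (f h - f 0 - l * h) <= eps * Rabs h.
Proof.
  intros H He. destruct (H eps He) as [d Hd].
  exists d; split; [apply cond_pos|]. intros h Hh.
  destruct (Req_dec h 0) as [->|Hn].
  - rewrite Rabs_R0. replace (f 0 - f 0 - l * 0) with 0 by ring. rewrite Rabs_R0. lra.
  - specialize (Hd h Hn Hh). rewrite Rplus_0_l in Hd.
    replace (f h - f 0 - l * h) with (((f h - f 0) / h - l) * h) by (field; auto).
    rewrite Rabs_mult. apply Rmult_le_compat_r; [apply Rabs_pos|lra].
Qed.

(** At 0 the claim follows from the derivatives of [exp], [cos] and [sin] there; the addition
    formula carries it to every point. *)
Lemma is_Cderive_cexp (z : C) : is_Cderive cexp z (cexp z).
Proof.
  assert (D0 : is_Cderive cexp 0 1%C).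
  { apply is_Cderive_eps. intros eps He.
    assert (He8 : 0 < eps / 8) by lra.
    destruct (derivable_pt_lim_at_0 exp 1 (eps / 8)) as [d1 [Hd1 H1]];
      [apply derivable_pt_lim_exp_0|lra|].
    destruct (derivable_pt_lim_at_0 cos 0 (eps / 8)) as [d2 [Hd2 H2]];
      [generalize (derivable_pt_lim_cos 0); rewrite sin_0, Ropp_0; auto|lra|].
    destruct (derivable_pt_lim_at_0 sin 1 (eps / 8)) as [d3 [Hd3 H3]];
      [generalize (derivable_pt_lim_sin 0); rewrite cos_0; auto|lra|].
    exists (Rmin (Rmin d1 d2) (Rmin d3 (Rmin 1 (eps / 8)))). split.
    { repeat apply Rmin_glb_lt; lra. }
    intros h Hh.
    assert (B1 : Cmod h < d1) by (eapply Rlt_le_trans; [exact Hh|]; eapply Rle_trans; apply Rmin_l).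
    assert (B2 : Cmod h < d2).
    { eapply Rlt_le_trans; [exact Hh|]. eapply Rle_trans; [apply Rmin_l|apply Rmin_r]. }
    assert (B3 : Cmod h < d3).
    { eapply Rlt_le_trans; [exact Hh|]. eapply Rle_trans; [apply Rmin_r|apply Rmin_l]. }
    assert (B4 : Cmod h < 1).
    { eapply Rlt_le_trans; [exact Hh|]. eapply Rle_trans; [apply Rmin_r|].
      eapply Rle_trans; [apply Rmin_r|apply Rmin_l]. }
    assert (B5 : Cmod h < eps / 8).
    { eapply Rlt_le_trans; [exact Hh|]. eapply Rle_trans; [apply Rmin_r|].
      eapply Rle_trans; apply Rmin_r. }
    assert (Hx := re_le_Cmod h). assert (Hy := im_le_Cmod h).
    rewrite Cplus_0_l, cexp_0.
    set (x := Re h) in *. set (y := Im h) in *.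
    specialize (H1 x ltac:(lra)). specialize (H2 y ltac:(lra)). specialize (H3 y ltac:(lra)).
    rewrite exp_0 in H1. rewrite cos_0 in H2. rewrite sin_0 in H3.
    (* For h = x + iy: e^h - 1 - h = (e^x - 1 - x) e^(iy) + (1 + x)(e^(iy) - 1 - iy) + x (iy), each
       term being o(|h|). *)
    replace (cexp h - 1 - h * 1)%C
      with (RtoC (exp x - 1 - 1 * x) * eit y + RtoC (1 + x) * (eit y - 1 - RtoC y * Ci)
            + RtoC x * (RtoC y * Ci))%C.
    2:{ rewrite cexp_polar. fold x y.
        replace h with (RtoC x + RtoC y * Ci)%C at 1.
        - unfold eit. apply injective_projections; simpl; ring.
        - unfold x, y. destruct h. apply injective_projections; simpl; ring. }
    eapply Rle_trans; [apply Cmod_triangle|].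
    eapply Rle_trans; [apply Rplus_le_compat_r, Cmod_triangle|].
    rewrite !Cmod_mult, !Cmod_R, Cmod_eit, Cmod_Ci.
    assert (E : Cmod (eit y - 1 - RtoC y * Ci)%C <= eps / 4 * Rabs y).
    { eapply Rle_trans; [apply Cmod_le_re_im|]. unfold eit. simpl.
      replace (cos y + - (1) + - (y * 0 - 0 * 1)) with (cos y - 1 - 0 * y) by ring.
      replace (sin y + - 0 + - (y * 1 + 0 * 0)) with (sin y - 0 - 1 * y) by ring. lra. }
    assert (A1 := Rabs_pos x). assert (A2 := Rabs_pos y).
    assert (A3 : Rabs (1 + x) <= 2).
    { eapply Rle_trans; [apply Rabs_triang|]. rewrite Rabs_R1. lra. }
    assert (A4 : Rabs (1 + x) * Cmod (eit y - 1 - RtoC y * Ci)%C <= 2 * (eps / 4 * Rabs y)).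
    { apply Rmult_le_compat; auto. apply Rabs_pos. apply Cmod_ge_0. }
    assert (A5 : Rabs x * (Rabs y * 1) <= eps / 8 * Rabs y).
    { rewrite Rmult_1_r. apply Rmult_le_compat_r; lra. }
    assert (A6 : eps * Rabs x <= eps * Cmod h) by (apply Rmult_le_compat_l; lra).
    assert (A7 : eps * Rabs y <= eps * Cmod h) by (apply Rmult_le_compat_l; lra).
    assert (A8 : 0 <= eps * Rabs x) by (apply Rmult_le_pos; lra).
    lra. }
  assert (D1 : is_Cderive (fun u => u - z)%C z (1 + 0)%C).
  { apply is_Cderive_plus; [apply is_Cderive_id|apply (is_Cderive_const (- z)%C)]. }
  assert (E0 : (z - z)%C = 0%C) by ring. rewrite <- E0 in D0.
  assert (D2 := is_Cderive_comp cexp (fun u => u - z)%C z _ _ D0 D1).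
  assert (D3 := is_Cderive_mult _ _ _ _ _ (is_Cderive_const (cexp z) z) D2).
  cbv beta in D3.
  match type of D3 with is_derive _ _ ?e => replace (cexp z) with e end.
  - eapply (@is_derive_ext C_AbsRing C_NormedModule); [|exact D3].
    intros u. simpl. rewrite <- cexp_plus. f_equal.
    rewrite Cplus_sub_cancel. reflexivity.
  - ring.
Qed.

Lemma continuous_eit (t : R) : continuous eit t.
Proof.
  apply (continuous_ext (fun s : R => cexp (0 + RtoC s * Ci)%C)).
  - intros s. change R in s. rewrite cexp_polar. simpl.
    replace (0 + (s * 0 - 0 * 1)) with 0 by ring.
    replace (0 + (s * 1 + 0 * 0)) with s by ring.
    rewrite exp_0. apply Cmult_1_l.
  - eapply is_Cderive_continuous_comp; [apply is_Cderive_cexp|apply continuous_line].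
Qed.

Lemma continuous_eit_opp (t : R) : continuous (fun s : R => eit (- s)) t.
Proof.
  apply (continuous_comp Ropp eit); [|apply continuous_eit].
  apply (@continuous_opp R_UniformSpace R_AbsRing R_NormedModule), continuous_id.
Qed.

Lemma continuous_circle (w : C) (rho t : R) :
  continuous (fun s : R => w + RtoC rho * eit s)%C t.
Proof.
  apply (@continuous_plus R_UniformSpace R_AbsRing C_R_NormedModule).
  - apply continuous_const.
  - apply continuous_R_Cmult; [apply continuous_const|apply continuous_eit].
Qed.

Definition Cdiff_on_disc (f : C -> C) (w : C) (rho : R) : Prop :=
  forall z, Cmod (z - w)%C <= rho -> @ex_derive C_AbsRing C_NormedModule f z.

Lemma Cmod_circle (w : C) (rho t : R) : 0 <= rho ->
  Cmod (w + RtoC rho * eit t - w)%C = rho.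
Proof.
  intros H. replace (w + RtoC rho * eit t - w)%C with (RtoC rho * eit t)%C by ring.
  rewrite Cmod_mult, Cmod_eit, Cmod_R, Rabs_pos_eq; lra.
Qed.

(** A full period integrates to zero: this removes the contribution of the constant term f(w) in
    Cauchy's formula. *)
Lemma is_CInt_cexp_circle (a : R) :
  is_CInt (fun t : R => cexp (- (a, t))%C) 0 (2 * PI) 0%C.
Proof.
  assert (I := CInt_line cexp cexp (- (a, 0))%C (- Ci)%C 0 (2 * PI)
    (fun t _ => is_Cderive_cexp _)
    (fun t _ => is_Cderive_continuous_comp _ _ _ _ (is_Cderive_cexp _) (continuous_line _ _ _))).
  apply (is_CInt_Cmult Ci) in I.
  assert (E : forall t : R, (- (a, 0) + RtoC t * - Ci)%C = (- (a, t))%C).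
  { intros t. apply injective_projections; simpl; ring. }
  assert (E0 : (Ci * (cexp (- (a, 0) + RtoC (2 * PI) * - Ci) - cexp (- (a, 0) + RtoC 0 * - Ci)))%C = 0%C).
  { rewrite !E. unfold cexp. simpl.
    rewrite cos_neg, sin_neg, cos_2PI, sin_2PI, Ropp_0, cos_0, sin_0.
    apply injective_projections; simpl; ring. }
  rewrite E0 in I.
  eapply is_RInt_ext; [|exact I]. intros t _. cbv beta. rewrite E.
  set (X := cexp _). transitivity (- (Ci * Ci) * X)%C; [Cring|].
  apply injective_projections; simpl; ring.
Qed.

(* In the coordinate [sigma = log (z - w)] the disc minus its centre is a half-plane, circles are
   vertical segments, and Goursat makes the circle integral independent of the radius. *)
Lemma Cauchy_derive (f : C -> C) (w : C) (rho : R) : 0 < rho ->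
  Cdiff_on_disc f w rho ->
  is_CInt (fun t : R => f (w + RtoC rho * eit t) * eit (- t))%C
    0 (2 * PI) (RtoC (2 * PI * rho) * C_derive f w)%C.
Proof.
  intros Hrho Hf.
  assert (HPI := PI_RGT_0).
  (* With z = w + e^s one has phi(s) ds = f(z) dz / (z - w)^2. *)
  set (phi := fun s : C => (f (w + cexp s) * cexp (- s))%C).
  set (b := ln rho).
  assert (Hphi : forall a, Cdiff_on_rect phi a b 0 (2 * PI)).
  { intros a x y Hx Hy.
    assert (Hm : Cmod (w + cexp (x, y) - w)%C <= rho).
    { replace (w + cexp (x, y) - w)%C with (cexp (x, y)) by ring.
      rewrite Cmod_cexp. simpl. rewrite <- (exp_ln rho) by auto. fold b.
      destruct Hx as [_ [H|H]]; [left; apply exp_increasing; auto|right; rewrite H; auto]. }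
    assert (D1 := ex_Cderive_correct _ _ (Hf _ Hm)).
    assert (D2 := is_Cderive_plus _ _ _ _ _ (is_Cderive_const w (x, y)) (is_Cderive_cexp (x, y))).
    assert (D3 := is_Cderive_comp f (fun s => w + cexp s)%C (x, y) _ _ D1 D2).
    assert (D4 := is_Cderive_mult _ _ _ _ _ (is_Cderive_const (- RtoC 1)%C (x, y)) (is_Cderive_id (x, y))).
    assert (D5 := is_Cderive_comp cexp (fun s => - RtoC 1 * s)%C (x, y) _ _ (is_Cderive_cexp _) D4).
    assert (D6 := is_Cderive_mult _ _ _ _ _ D3 D5).
    eexists. eapply (@is_derive_ext C_AbsRing C_NormedModule); [|exact D6].
    intros s. unfold phi. simpl. do 2 f_equal. Cring. }
  set (J := (fun a : R => CInt (fun t : R => phi (a, t)) 0 (2 * PI)) : R -> C).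
  assert (HJ : forall a, a <= b -> J b = J a).
  { intros a Ha.
    assert (G := Goursat phi a b 0 (2 * PI) Ha ltac:(lra) (Hphi a)).
    unfold rect_int in G.
    (* [phi] has period 2 pi i, so the horizontal sides cancel. *)
    replace (CInt (fun s : R => phi (s, 2 * PI)) a b) with (CInt (fun s : R => phi (s, 0)) a b) in G.
    2:{ apply (@RInt_ext C_R_CompleteNormedModule). intros s _. unfold phi, cexp. simpl.
        rewrite !cos_neg, !sin_neg, cos_2PI, sin_2PI, Ropp_0, cos_0, sin_0, Ropp_0. reflexivity. }
    fold (J b) (J a) in G.
    assert (G2 : (Ci * (J b - J a))%C = 0%C).
    { assert (Z : forall X Y : C, (X - X + Y)%C = 0%C -> Y = 0%C)
        by (intros X Y E; rewrite <- E; Cring).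
      exact (Z _ _ G). }
    assert (E : (J b - J a)%C = 0%C).
    { replace (J b - J a)%C with (- Ci * (Ci * (J b - J a)))%C.
      - rewrite G2. ring.
      - generalize (J b - J a)%C. intros X. apply injective_projections; simpl; ring. }
    transitivity (J b - J a + J a)%C; [Cring|rewrite E; Cring]. }
  assert (Hex : forall a, a <= b -> ex_CInt (fun t : R => phi (a, t)) 0 (2 * PI)).
  { intros a Ha. apply (ex_CInt_vertical phi a b 0 (2 * PI)); auto; lra. }
  set (l := C_derive f w).
  assert (Dl : is_Cderive f w l).
  { apply ex_Cderive_correct, Hf. replace (w - w)%C with (RtoC 0) by ring. rewrite Cmod_0. lra. }
  assert (Hlim : forall eps, 0 < eps -> Cmod (J b - RtoC (2 * PI) * l)%C <= 2 * PI * eps).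
  { intros eps He. rewrite is_Cderive_eps in Dl. destruct (Dl eps He) as [d [Hd Hl]].
    set (a := Rmin b (ln (d / 2))).
    assert (Had : exp a < d).
    { apply Rle_lt_trans with (exp (ln (d / 2))).
      - destruct (Rmin_r b (ln (d / 2))) as [H|H]; fold a in H;
          [left; apply exp_increasing; auto|right; rewrite H; auto].
      - rewrite exp_ln; lra. }
    rewrite (HJ a) by apply Rmin_l.
    (* On the small circle of radius e^a, the first-order part of f contributes exactly 2 pi l, and
       the rest is at most eps e^a times the factor e^(-a) of [phi]. *)
    assert (I1 : is_CInt (fun t : R => f w * cexp (- (a, t)) + l)%C 0 (2 * PI)
       (f w * 0 + RtoC (2 * PI) * l)%C).
    { apply is_CInt_plus; [apply is_CInt_Cmult, is_CInt_cexp_circle|].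
      assert (I := @is_RInt_const C_R_NormedModule 0 (2 * PI) l).
      rewrite scal_R_Cmult in I. rewrite Rminus_0_r in I. exact I. }
    assert (I2 := is_CInt_minus _ _ _ _ _ _ (CInt_correct _ _ _ (Hex a (Rmin_l _ _))) I1).
    fold (J a) in I2.
    replace (J a - RtoC (2 * PI) * l)%C with (J a - (f w * 0 + RtoC (2 * PI) * l))%C by ring.
    rewrite <- (is_CInt_unique _ _ _ _ I2).
    eapply Rle_trans; [apply Cmod_CInt_le_const with (M := eps)|]; [lra|eexists; exact I2| |lra].
    intros t _. unfold phi.
    assert (Ee : (cexp (a, t) * cexp (- (a, t)))%C = 1%C).
    { rewrite <- cexp_plus, <- cexp_0. f_equal. ring. }
    specialize (Hl (cexp (a, t))). rewrite Cmod_cexp in Hl. specialize (Hl Had). simpl in Hl.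
    replace (f (w + cexp (a, t)) * cexp (- (a, t)) - (f w * cexp (- (a, t)) + l))%C
      with ((f (w + cexp (a, t)) - f w - cexp (a, t) * l) * cexp (- (a, t)))%C.
    2:{ replace l with (l * 1)%C at 2 by ring. rewrite <- Ee. ring. }
    rewrite Cmod_mult, Cmod_cexp. simpl.
    apply (Rmult_le_compat_r (exp (- a))) in Hl; [|left; apply exp_pos].
    eapply Rle_trans; [exact Hl|]. rewrite Rmult_assoc, <- exp_plus, Rplus_opp_r, exp_0. lra. }
  assert (HJb : J b = (RtoC (2 * PI) * l)%C).
  { set (X := (J b - RtoC (2 * PI) * l)%C) in *.
    assert (HX : X = 0%C).
    { apply Cmod_eq_0, Rle_antisym; [|apply Cmod_ge_0].
      apply Rnot_lt_le. intros H.
      specialize (Hlim (Cmod X / (4 * PI)) ltac:(apply Rdiv_lt_0_compat; lra)).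
      replace (2 * PI * (Cmod X / (4 * PI))) with (Cmod X / 2) in Hlim by (field; lra). lra. }
    transitivity (X + RtoC (2 * PI) * l)%C; [unfold X; Cring|rewrite HX; Cring]. }
  assert (I := CInt_correct _ _ _ (Hex b (Rle_refl b))).
  fold (J b) in I. rewrite HJb in I.
  apply (is_CInt_Cmult (RtoC rho)) in I.
  replace (RtoC (2 * PI * rho) * l)%C with (RtoC rho * (RtoC (2 * PI) * l))%C
    by (rewrite (RtoC_mult (2 * PI) rho); ring).
  eapply is_RInt_ext; [|exact I]. intros t _. cbv beta. unfold phi.
  rewrite !cexp_polar. simpl. unfold b. rewrite exp_Ropp, exp_ln by auto.
  replace (RtoC rho * (f (w + RtoC rho * eit t) * (RtoC (/ rho) * eit (- t))))%C
    with ((RtoC rho * RtoC (/ rho)) * (f (w + RtoC rho * eit t) * eit (- t)))%C by ring.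
  rewrite <- RtoC_mult, Rinv_r by lra. Cring.
Qed.

(** * Cauchy estimates and Taylor remainders on a disc *)

Section LocalEstimates.

Variables (f : C -> C) (w : C) (rho B : R).
Hypothesis Hrho : 0 < rho.
Hypothesis Hf : Cdiff_on_disc f w rho.
Hypothesis HB : forall z, Cmod (z - w)%C <= rho -> Cmod (f z) <= B.

Lemma Cdiff_on_disc_sub (z : C) (r : R) : Cmod (z - w)%C + r <= rho -> Cdiff_on_disc f z r.
Proof.
  intros H x Hx. apply Hf.
  replace (x - w)%C with ((x - z) + (z - w))%C by ring.
  eapply Rle_trans; [apply Cmod_triangle|]. lra.
Qed.

Lemma bound_on_disc_sub (z : C) (r : R) : Cmod (z - w)%C + r <= rho ->
  forall x, Cmod (x - z)%C <= r -> Cmod (f x) <= B.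
Proof.
  intros H x Hx. apply HB.
  replace (x - w)%C with ((x - z) + (z - w))%C by ring.
  eapply Rle_trans; [apply Cmod_triangle|]. lra.
Qed.

Lemma Cauchy_estimate : Cmod (C_derive f w) <= B / rho.
Proof.
  assert (HPI := PI_RGT_0).
  assert (I := Cauchy_derive f w rho Hrho Hf).
  assert (H : Cmod (RtoC (2 * PI * rho) * C_derive f w)%C <= (2 * PI - 0) * B).
  { rewrite <- (is_CInt_unique _ _ _ _ I).
    apply Cmod_CInt_le_const; [lra|eexists; exact I|].
    intros t _. rewrite Cmod_mult, Cmod_eit, Rmult_1_r. apply HB.
    rewrite Cmod_circle; lra. }
  rewrite Cmod_mult, Cmod_R, Rabs_pos_eq in H by nra.
  apply Rmult_le_reg_l with (2 * PI * rho); [nra|].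
  replace (2 * PI * rho * (B / rho)) with (2 * PI * B) by (field; lra). lra.
Qed.

End LocalEstimates.

(** Subtracting two instances of Cauchy's formula controls increments of f' by increments of f,
    before f' is known to be differentiable. *)
Lemma Cauchy_difference_estimate (f : C -> C) (w w' : C) (rho M : R) : 0 < rho ->
  Cdiff_on_disc f w rho -> Cdiff_on_disc f w' rho ->
  (forall t, Cmod (f (w' + RtoC rho * eit t) - f (w + RtoC rho * eit t))%C <= M) ->
  Cmod (C_derive f w' - C_derive f w)%C <= M / rho.
Proof.
  intros Hrho Hw Hw' HM. assert (HPI := PI_RGT_0).
  assert (I := is_CInt_minus _ _ _ _ _ _ (Cauchy_derive f w' rho Hrho Hw') (Cauchy_derive f w rho Hrho Hw)).
  assert (H : Cmod (RtoC (2 * PI * rho) * (C_derive f w' - C_derive f w))%C <= (2 * PI - 0) * M).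
  { replace (RtoC (2 * PI * rho) * (C_derive f w' - C_derive f w))%C
      with (RtoC (2 * PI * rho) * C_derive f w' - RtoC (2 * PI * rho) * C_derive f w)%C by ring.
    rewrite <- (is_CInt_unique _ _ _ _ I).
    apply Cmod_CInt_le_const; [lra|eexists; exact I|].
    intros t _.
    replace (f (w' + RtoC rho * eit t) * eit (- t) - f (w + RtoC rho * eit t) * eit (- t))%C
      with ((f (w' + RtoC rho * eit t) - f (w + RtoC rho * eit t)) * eit (- t))%C by ring.
    rewrite Cmod_mult, Cmod_eit, Rmult_1_r. apply HM. }
  rewrite Cmod_mult, Cmod_R, Rabs_pos_eq in H by nra.
  apply Rmult_le_reg_l with (2 * PI * rho); [nra|].
  replace (2 * PI * rho * (M / rho)) with (2 * PI * M) by (field; lra). lra.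
Qed.

Section TaylorEstimates.

Variables (f : C -> C) (w : C) (rho B : R).
Hypothesis Hrho : 0 < rho.
Hypothesis Hf : Cdiff_on_disc f w rho.
Hypothesis HB : forall z, Cmod (z - w)%C <= rho -> Cmod (f z) <= B.

Lemma Lipschitz_half_disc (z h : C) : Cmod (z - w)%C + Cmod h <= rho / 2 ->
  Cmod (f (z + h) - f z)%C <= 2 * B / rho * Cmod h.
Proof.
  intros H.
  assert (Hz : forall t, 0 <= t <= 1 -> Cmod (z + RtoC t * h - w)%C <= rho / 2).
  { intros t Ht. replace (z + RtoC t * h - w)%C with ((z - w) + RtoC t * h)%C by ring.
    eapply Rle_trans; [apply Cmod_triangle|].
    rewrite Cmod_mult, Cmod_R, Rabs_pos_eq by lra. generalize (Cmod_ge_0 h). nra. }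
  apply Cderive_segment_bound with (df := C_derive f).
  - intros t Ht. apply ex_Cderive_correct, Hf. specialize (Hz t Ht). lra.
  - intros t Ht. specialize (Hz t Ht).
    replace (2 * B / rho) with (B / (rho / 2)) by (field; lra).
    apply Cauchy_estimate; [lra| |].
    + apply (Cdiff_on_disc_sub f w rho Hf); lra.
    + apply (bound_on_disc_sub f w rho B HB); lra.
Qed.

(** On circles of radius rho/4 the increment of f is at most (2B/rho)|h|, because both circles stay
    in the half disc; division by rho/4 gives the constant 8. *)
Lemma Cderive_Lipschitz (h : C) : Cmod h <= rho / 4 ->
  Cmod (C_derive f (w + h) - C_derive f w)%C <= 8 * B / rho ^ 2 * Cmod h.
Proof.
  intros Hh. assert (H0 := Cmod_ge_0 h).
  replace (8 * B / rho ^ 2 * Cmod h) with (2 * B / rho * Cmod h / (rho / 4)) by (field; lra).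
  assert (E0 : Cmod (w - w)%C = 0).
  { replace (w - w)%C with (RtoC 0) by ring. apply Cmod_0. }
  assert (Eh : Cmod (w + h - w)%C = Cmod h) by (f_equal; ring).
  apply Cauchy_difference_estimate; [lra| | |].
  - apply (Cdiff_on_disc_sub f w rho Hf); lra.
  - apply (Cdiff_on_disc_sub f w rho Hf); lra.
  - intros t.
    replace (w + h + RtoC (rho / 4) * eit t)%C with (w + RtoC (rho / 4) * eit t + h)%C by ring.
    apply Lipschitz_half_disc. rewrite Cmod_circle; lra.
Qed.

(** Mean value bound for f(z) - f'(w) z, whose derivative on the segment is an increment of f'. *)
Lemma Taylor_error (h : C) : Cmod h <= rho / 4 ->
  Cmod (f (w + h) - f w - h * C_derive f w)%C <= 8 * B / rho ^ 2 * Cmod h ^ 2.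
Proof.
  intros Hh. assert (H0 := Cmod_ge_0 h).
  set (l := C_derive f w).
  assert (Ht : forall t, 0 <= t <= 1 -> Cmod (RtoC t * h)%C <= Cmod h).
  { intros t Ht. rewrite Cmod_mult, Cmod_R, Rabs_pos_eq by lra. nra. }
  assert (E : (f (w + h) - f w - h * l = (f (w + h) - l * (w + h)) - (f w - l * w))%C) by ring.
  rewrite E.
  replace (8 * B / rho ^ 2 * Cmod h ^ 2) with (8 * B / rho ^ 2 * Cmod h * Cmod h) by ring.
  apply (Cderive_segment_bound (fun z => f z - l * z)%C (fun z => C_derive f z - l)%C).
  - intros t H.
    assert (D1 : is_Cderive f (w + RtoC t * h)%C (C_derive f (w + RtoC t * h)%C)).
    { apply ex_Cderive_correct, Hf.
      replace (w + RtoC t * h - w)%C with (RtoC t * h)%C by ring.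
      specialize (Ht t H). lra. }
    assert (D2 := is_Cderive_mult _ _ _ _ _ (is_Cderive_const (- l)%C (w + RtoC t * h)%C)
                    (is_Cderive_id (w + RtoC t * h)%C)).
    assert (D3 := is_Cderive_plus _ _ _ _ _ D1 D2).
    match type of D3 with is_derive _ _ ?e =>
      replace (C_derive f (w + RtoC t * h) - l)%C with e by Cring end.
    eapply (@is_derive_ext C_AbsRing C_NormedModule); [|exact D3].
    intros s. simpl. change (f s + - l * s = f s - l * s)%C. ring.
  - intros t H. eapply Rle_trans; [apply Cderive_Lipschitz; specialize (Ht t H); lra|].
    apply Rmult_le_compat_l; [|apply Ht, H].
    assert (0 <= B).
    { eapply Rle_trans; [apply Cmod_ge_0|apply (HB w)].
      replace (w - w)%C with (RtoC 0) by ring. rewrite Cmod_0. lra. }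
    apply Rdiv_le_0_compat; [lra|]. apply pow_lt; lra.
Qed.

End TaylorEstimates.

Lemma continuous_C_derive (f : C -> C) (g : R -> C) (t rho B : R) : 0 < rho ->
  Cdiff_on_disc f (g t) rho ->
  (forall z, Cmod (z - g t)%C <= rho -> Cmod (f z) <= B) ->
  continuous g t -> continuous (fun s : R => C_derive f (g s)) t.
Proof.
  intros Hr Hf HB Hg. rewrite continuous_R_C_eps in *. intros eps He.
  assert (HB0 : 0 <= B).
  { eapply Rle_trans; [apply Cmod_ge_0|apply (HB (g t))].
    replace (g t - g t)%C with (RtoC 0) by ring. rewrite Cmod_0. lra. }
  set (K := 8 * B / rho ^ 2).
  assert (HK : 0 <= K).
  { apply Rdiv_le_0_compat; [lra|]. apply pow_lt; lra. }
  destruct (Hg (Rmin (rho / 4) (eps / (K + 1)))) as [d [Hd H]].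
  { apply Rmin_glb_lt; [lra|]. apply Rdiv_lt_0_compat; lra. }
  exists d. split; auto. intros s Hs. specialize (H s Hs).
  assert (H1 := Rlt_le_trans _ _ _ H (Rmin_l _ _)).
  assert (H2 := Rlt_le_trans _ _ _ H (Rmin_r _ _)).
  assert (T := Cderive_Lipschitz f (g t) rho B Hr Hf HB (g s - g t)%C ltac:(lra)).
  rewrite Cplus_sub_cancel in T. eapply Rle_lt_trans; [exact T|]. fold K.
  assert (H3 := Cmod_ge_0 (g s - g t)%C).
  apply Rle_lt_trans with ((K + 1) * Cmod (g s - g t)%C); [nra|].
  apply (Rmult_lt_compat_l (K + 1)) in H2; [|lra].
  replace ((K + 1) * (eps / (K + 1))) with eps in H2 by (field; lra). exact H2.
Qed.

(** Cauchy's formula for f' is differentiated under the integral sign: the candidate derivative is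
    the same integral with f' in place of f, and the Taylor error is uniform on the circle. *)
Lemma ex_Cderive_C_derive (f : C -> C) (w : C) (rho B : R) : 0 < rho ->
  Cdiff_on_disc f w rho ->
  (forall z, Cmod (z - w)%C <= rho -> Cmod (f z) <= B) ->
  @ex_derive C_AbsRing C_NormedModule (C_derive f) w.
Proof.
  intros Hr Hf HB. assert (HPI := PI_RGT_0).
  assert (E0 : Cmod (w - w)%C = 0).
  { replace (w - w)%C with (RtoC 0) by ring. apply Cmod_0. }
  set (r := rho / 2). assert (Hr2 : 0 < r) by (unfold r; lra).
  assert (Hsub : forall z, Cmod (z - w)%C <= r -> Cdiff_on_disc f z r).
  { intros z Hz. apply (Cdiff_on_disc_sub f w rho Hf). unfold r in *; lra. }
  assert (Hsub' : forall z, Cmod (z - w)%C <= r -> forall x, Cmod (x - z)%C <= r -> Cmod (f x) <= B).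
  { intros z Hz. apply (bound_on_disc_sub f w rho B HB). unfold r in *; lra. }
  assert (Hc : forall t, Cmod (w + RtoC r * eit t - w)%C <= r) by (intros t; rewrite Cmod_circle; lra).
  set (E := CInt (fun t : R => C_derive f (w + RtoC r * eit t) * eit (- t))%C 0 (2 * PI)).
  assert (IE : is_CInt (fun t : R => C_derive f (w + RtoC r * eit t) * eit (- t))%C 0 (2 * PI) E).
  { apply CInt_correct, ex_CInt_continuous; [lra|]. intros t _.
    apply (continuous_R_Cmult (fun s : R => C_derive f (w + RtoC r * eit s)%C) (fun s : R => eit (- s)));
      [|apply continuous_eit_opp].
    refine (continuous_C_derive f (fun s : R => w + RtoC r * eit s)%C t r B Hr2
              (Hsub _ (Hc t)) (Hsub' _ (Hc t)) _).
    apply continuous_circle. }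
  exists (RtoC (/ (2 * PI * r)) * E)%C.
  assert (HB0 : 0 <= B).
  { eapply Rle_trans; [apply Cmod_ge_0|apply (HB w); lra]. }
  apply (is_Cderive_quadratic_error (C_derive f) w _ (8 * B / r ^ 3) (r / 4)); [lra|].
  intros h Hh.
  assert (Ehw : Cmod (w + h - w)%C = Cmod h) by (f_equal; ring).
  assert (D1 := Cauchy_derive f (w + h)%C r Hr2 (Hsub (w + h)%C ltac:(lra))).
  assert (D2 := Cauchy_derive f w r Hr2 (Hsub w ltac:(lra))).
  assert (I := is_CInt_minus _ _ _ _ _ _ (is_CInt_minus _ _ _ _ _ _ D1 D2) (is_CInt_Cmult h _ _ _ _ IE)).
  assert (H : Cmod (RtoC (2 * PI * r) * (C_derive f (w + h) - C_derive f w - h * (RtoC (/ (2 * PI * r)) * E)))%C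
     <= (2 * PI - 0) * (8 * B / r ^ 2 * Cmod h ^ 2)).
  { replace (RtoC (2 * PI * r) * (C_derive f (w + h) - C_derive f w - h * (RtoC (/ (2 * PI * r)) * E)))%C
      with (RtoC (2 * PI * r) * C_derive f (w + h) - RtoC (2 * PI * r) * C_derive f w - h * E)%C.
    2:{ assert (ER : (RtoC (2 * PI * r) * RtoC (/ (2 * PI * r)))%C = 1%C).
        { rewrite <- RtoC_mult, Rinv_r; [reflexivity|nra]. }
        transitivity (RtoC (2 * PI * r) * C_derive f (w + h) - RtoC (2 * PI * r) * C_derive f w
          - h * ((RtoC (2 * PI * r) * RtoC (/ (2 * PI * r))) * E))%C; [rewrite ER|]; ring. }
    rewrite <- (is_CInt_unique _ _ _ _ I).
    apply Cmod_CInt_le_const; [lra|eexists; exact I|].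
    intros t _. set (z := (w + RtoC r * eit t)%C).
    replace (w + h + RtoC r * eit t)%C with (z + h)%C by (unfold z; ring).
    replace (f (z + h) * eit (- t) - f z * eit (- t) - h * (C_derive f z * eit (- t)))%C
      with ((f (z + h) - f z - h * C_derive f z) * eit (- t))%C by ring.
    rewrite Cmod_mult, Cmod_eit, Rmult_1_r.
    apply Taylor_error; auto; try lra; [apply Hsub, Hc|apply Hsub', Hc]. }
  rewrite Cmod_mult, Cmod_R, Rabs_pos_eq in H by nra.
  apply Rmult_le_reg_l with (2 * PI * r); [nra|].
  eapply Rle_trans; [exact H|]. right. field. lra.
Qed.

Lemma holo_locally_bounded (f : C -> C) (z : C) :
  @ex_derive C_AbsRing C_NormedModule f z ->
  exists d, 0 < d /\ forall x, Cmod (x - z)%C < d -> Cmod (f x) <= Cmod (f z) + 1.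
Proof.
  intros H. apply ex_Cderive_correct in H. rewrite is_Cderive_eps in H.
  destruct (H 1 Rlt_0_1) as [d [Hd Hl]]. set (l := C_derive f z) in *.
  assert (H0 := Cmod_ge_0 l).
  (* The second radius makes |x - z| (1 + |l|) at most 1, which covers the remainder together with
     the linear term. *)
  exists (Rmin d (/ (1 + Cmod l))). split.
  { apply Rmin_glb_lt; auto. apply Rinv_0_lt_compat; lra. }
  intros x Hx.
  assert (H1 := Rlt_le_trans _ _ _ Hx (Rmin_l _ _)).
  assert (H2 := Rlt_le_trans _ _ _ Hx (Rmin_r _ _)).
  specialize (Hl _ H1). rewrite Cplus_sub_cancel in Hl.
  replace (f x) with (f z + (f x - f z - (x - z) * l) + (x - z) * l)%C by ring.
  eapply Rle_trans; [apply Cmod_triangle|].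
  eapply Rle_trans; [apply Rplus_le_compat_r, Cmod_triangle|].
  rewrite Cmod_mult.
  apply Rlt_le, (Rmult_le_compat_l (1 + Cmod l)) in H2; [|lra].
  rewrite Rinv_r in H2 by lra. lra.
Qed.

(** * Analytic functions on the unit disc and their primitives along rays *)

Lemma holo_Cdiff_on_disc (f : C -> C) (w : C) (rho : R) : holo f ->
  Cmod w + rho < 1 -> Cdiff_on_disc f w rho.
Proof.
  intros Hf H z Hz. apply Hf. unfold inD.
  replace z with ((z - w) + w)%C by ring.
  eapply Rle_lt_trans; [apply Cmod_triangle|]. lra.
Qed.

Lemma holo_C_derive (f : C -> C) : holo f -> holo (C_derive f).
Proof.
  intros Hf z Hz. unfold inD in Hz.
  destruct (holo_locally_bounded f z (Hf z Hz)) as [d [Hd H]].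
  set (rho := Rmin (d / 2) ((1 - Cmod z) / 2)).
  assert (H1 : rho <= d / 2) by apply Rmin_l.
  assert (H2 : rho <= (1 - Cmod z) / 2) by apply Rmin_r.
  apply (ex_Cderive_C_derive f z rho (Cmod (f z) + 1)).
  - apply Rmin_glb_lt; lra.
  - apply holo_Cdiff_on_disc; auto. lra.
  - intros x Hx. apply H. lra.
Qed.

Lemma holo_is_Cderive (f : C -> C) (z : C) : holo f -> inD z -> is_Cderive f z (C_derive f z).
Proof. intros Hf Hz. apply ex_Cderive_correct, Hf, Hz. Qed.

(** Bisection of the square [-1,1]^2 starting from local boundedness. A point outside the closed
    disc has a neighbourhood that misses the disc, where the bound 0 holds vacuously. *)
Lemma holo_bounded_on_disc (f : C -> C) (r : R) : holo f -> 0 <= r < 1 ->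
  exists B, forall z, Cmod z <= r -> Cmod (f z) <= B.
Proof.
  intros Hf Hr.
  destruct (bisection_induction (fun a b c d => exists B, forall x y, a <= x <= b -> c <= y <= d ->
     Cmod (x, y) <= r -> Cmod (f (x, y)) <= B)) with (a := -1) (b := 1) (c := -1) (d := 1)
    as [B HB]; try lra.
  - intros a b c d Hab Hcd m n [B1 H1] [B2 H2] [B3 H3] [B4 H4].
    exists (Rmax (Rmax B1 B2) (Rmax B3 B4)). intros x y Hx Hy H.
    destruct (Rle_dec x m) as [Hm|Hm]; destruct (Rle_dec y n) as [Hn|Hn].
    + eapply Rle_trans; [apply H1; auto; lra|]. eapply Rle_trans; [|apply Rmax_l]. apply Rmax_l.
    + eapply Rle_trans; [apply H3; auto; lra|]. eapply Rle_trans; [|apply Rmax_r]. apply Rmax_l.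
    + eapply Rle_trans; [apply H2; auto; lra|]. eapply Rle_trans; [|apply Rmax_l]. apply Rmax_r.
    + eapply Rle_trans; [apply H4; auto; lra|]. eapply Rle_trans; [|apply Rmax_r]. apply Rmax_r.
  - intros x y Hx Hy.
    assert (Hdist : forall a b c d x' y', a <= x <= b -> c <= y <= d -> a <= x' <= b -> c <= y' <= d ->
      Cmod ((x', y') - (x, y))%C <= (b - a) + (d - c)).
    { intros. eapply Rle_trans; [apply Cmod_le_re_im|]. simpl.
      apply Rplus_le_compat; apply Rabs_le; lra. }
    destruct (Rle_dec (Cmod (x, y)) r) as [Hin|Hout].
    + destruct (holo_locally_bounded f (x, y)) as [d [Hd H]]; [apply Hf; unfold inD; lra|].
      exists (d / 2). split; [lra|]. intros a' b' c' d' Ha Hb Hc Hd' H1 H2.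
      exists (Cmod (f (x, y)) + 1). intros x' y' Hx' Hy' _. apply H.
      eapply Rle_lt_trans; [apply (Hdist a' b' c' d')|]; lra.
    + exists ((Cmod (x, y) - r) / 2). split; [lra|]. intros a' b' c' d' Ha Hb Hc Hd' H1 H2.
      exists 0. intros x' y' Hx' Hy' Hr'. exfalso.
      assert (K := Hdist a' b' c' d' x' y' ltac:(lra) ltac:(lra) Hx' Hy').
      assert (K2 := Cmod_minus_ge (x, y) (x', y')).
      rewrite <- (Cmod_opp ((x, y) - (x', y'))) in K2.
      replace (- ((x, y) - (x', y')))%C with ((x', y') - (x, y))%C in K2
        by (apply injective_projections; simpl; ring).
      lra.
  - exists B. intros [x y] Hz.
    assert (K1 := re_le_Cmod (x, y)). assert (K2 := im_le_Cmod (x, y)). simpl in K1, K2.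
    apply Rabs_le_between in K1. apply Rabs_le_between in K2. apply HB; auto; lra.
Qed.

Lemma Cmod_real_scale_le (t : R) (z : C) : 0 <= t <= 1 -> Cmod (RtoC t * z)%C <= Cmod z.
Proof.
  intros Ht. rewrite Cmod_mult, Cmod_R, Rabs_pos_eq by lra. generalize (Cmod_ge_0 z). nra.
Qed.

Lemma continuous_ray (u : C -> C) (z : C) (t : R) : holo u -> inD z -> 0 <= t <= 1 ->
  continuous (fun s : R => u (RtoC s * z)%C) t.
Proof.
  intros Hu Hz Ht.
  apply (is_Cderive_continuous_comp u (fun s : R => RtoC s * z)%C t (C_derive u (RtoC t * z)%C)).
  - apply holo_is_Cderive; auto. unfold inD in *.
    eapply Rle_lt_trans; [apply Cmod_real_scale_le; auto|auto].
  - apply (continuous_ext (fun s : R => 0 + RtoC s * z)%C); [intros; apply Cplus_0_l|].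
    apply continuous_line.
Qed.

Definition ray_primitive (u : C -> C) (z : C) : C :=
  CInt (fun t : R => u (RtoC t * z) * z)%C 0 1.

Lemma ex_CInt_ray (u : C -> C) (z : C) : holo u -> inD z ->
  ex_CInt (fun t : R => u (RtoC t * z) * z)%C 0 1.
Proof.
  intros Hu Hz. apply ex_CInt_continuous; [lra|]. intros t Ht.
  apply continuous_R_Cmult; [apply continuous_ray; auto|apply continuous_const].
Qed.

(** To first order in h, u(t(z+h))(z+h) grows by h (u(tz) + tz u'(tz)). The remainder is uniform in
    t, since the discs of radius [rho] around the segment [0,z] lie in one compact disc. *)
Lemma is_Cderive_ray_primitive (u : C -> C) (z : C) : holo u -> inD z ->
  is_Cderive (ray_primitive u) z (u z).
Proof.
  intros Hu Hz. unfold inD in Hz. assert (Hz0 := Cmod_ge_0 z).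
  set (rho := (1 - Cmod z) / 2).
  destruct (holo_bounded_on_disc u (Cmod z + rho) Hu) as [B HB]; [unfold rho; lra|].
  assert (HB0 : 0 <= B).
  { eapply Rle_trans; [apply Cmod_ge_0|apply (HB z); unfold rho; lra]. }
  assert (Hrho : 0 < rho) by (unfold rho; lra).
  assert (Hu' := holo_C_derive u Hu).
  assert (Hdisc : forall t, 0 <= t <= 1 -> Cdiff_on_disc u (RtoC t * z)%C rho /\
     forall x, Cmod (x - RtoC t * z)%C <= rho -> Cmod (u x) <= B).
  { intros t Ht. assert (Hm := Cmod_real_scale_le t z Ht). split.
    - apply holo_Cdiff_on_disc; auto. unfold rho. lra.
    - intros x Hx. apply HB. replace x with (RtoC t * z + (x - RtoC t * z))%C by ring.
      eapply Rle_trans; [apply Cmod_triangle|]. lra. }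
  (* the derivative of [t * u (t z)] integrates to [u z] *)
  assert (I0 : is_CInt (fun t : R => u (RtoC t * z) + RtoC t * z * C_derive u (RtoC t * z))%C 0 1 (u z)).
  { assert (I := CInt_line (fun s => s * u (s * z))%C (fun s => u (s * z) + s * z * C_derive u (s * z))%C
       0%C 1%C 0 1).
    assert (E : forall t : R, (0 + RtoC t * 1)%C = RtoC t) by (intros; ring).
    rewrite !E in I.
    replace (RtoC 1 * u (RtoC 1 * z) - RtoC 0 * u (RtoC 0 * z))%C with (u z) in I.
    2:{ rewrite !Cmult_1_l. ring. }
    eapply is_RInt_ext; [|apply I].
    - intros t _. cbv beta. rewrite E. Cring.
    - intros t. rewrite Rmin_left, Rmax_right by lra. intros Ht. rewrite E.
      assert (Hin : inD (RtoC t * z)%C).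
      { unfold inD. assert (Hm := Cmod_real_scale_le t z Ht). lra. }
      assert (D1 := is_Cderive_mult _ _ _ _ _ (is_Cderive_id (RtoC t)) (is_Cderive_const z (RtoC t))).
      assert (D2 := is_Cderive_comp u (fun s => s * z)%C (RtoC t) _ _ (holo_is_Cderive u _ Hu Hin) D1).
      assert (D3 := is_Cderive_mult _ _ _ _ _ (is_Cderive_id (RtoC t)) D2).
      cbv beta in D3.
      match type of D3 with is_derive _ _ ?e =>
        replace (u (RtoC t * z) + RtoC t * z * C_derive u (RtoC t * z))%C with e by Cring end.
      exact D3.
    - intros t. rewrite Rmin_left, Rmax_right by lra. intros Ht.
      apply (continuous_ext (fun s : R => u (RtoC s * z) + RtoC s * z * C_derive u (RtoC s * z))%C).
      { intros s. rewrite E. reflexivity. }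
      apply (@continuous_plus R_UniformSpace R_AbsRing C_R_NormedModule).
      + apply continuous_ray; auto.
      + apply continuous_R_Cmult; [|apply continuous_ray; auto].
        apply (continuous_ext (fun s : R => 0 + RtoC s * z)%C); [intros; apply Cplus_0_l|].
        apply continuous_line. }
  apply (is_Cderive_quadratic_error _ z _ (8 * B / rho ^ 2 + B / rho) (rho / 4)); [lra|].
  intros h Hh. assert (Hh0 := Cmod_ge_0 h).
  assert (Hzh : Cmod (z + h)%C < 1).
  { eapply Rle_lt_trans; [apply Cmod_triangle|]. unfold rho in *. lra. }
  assert (I := is_CInt_minus _ _ _ _ _ _
    (is_CInt_minus _ _ _ _ _ _ (CInt_correct _ _ _ (ex_CInt_ray u (z + h)%C Hu Hzh))
       (CInt_correct _ _ _ (ex_CInt_ray u z Hu Hz)))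
    (is_CInt_Cmult h _ _ _ _ I0)).
  unfold ray_primitive. rewrite <- (is_CInt_unique _ _ _ _ I).
  set (K := (8 * B / rho ^ 2 + B / rho) * Cmod h ^ 2).
  replace K with ((1 - 0) * K) by ring.
  apply Cmod_CInt_le_const; [lra|eexists; exact I|].
  intros t Ht. destruct (Hdisc t Ht) as [H1 H2].
  set (x := (RtoC t * z)%C) in *.
  assert (Hth := Cmod_real_scale_le t h Ht).
  assert (T := Taylor_error u x rho B Hrho H1 H2 (RtoC t * h)%C ltac:(lra)).
  assert (T' := Cauchy_estimate u x rho B Hrho H1 H2).
  replace (RtoC t * (z + h))%C with (x + RtoC t * h)%C by (unfold x; ring).
  (* The first summand is a Taylor remainder, bounded through 8B/rho^2; the second is the cross term
     t h^2 u'(tz), bounded through B/rho. *)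
  replace (u (x + RtoC t * h) * (z + h) - u x * z - h * (u x + x * C_derive u x))%C
    with ((z + h) * (u (x + RtoC t * h) - u x - RtoC t * h * C_derive u x)
          + (RtoC t * h) * h * C_derive u x)%C by (unfold x; ring).
  eapply Rle_trans; [apply Cmod_triangle|]. rewrite !(Cmod_mult (z + h)), !(Cmod_mult (RtoC t * h * h)),
    (Cmod_mult (RtoC t * h) h).
  assert (HK : 0 <= 8 * B / rho ^ 2).
  { apply Rdiv_le_0_compat; [lra|]. apply pow_lt; lra. }
  assert (Hth0 := Cmod_ge_0 (RtoC t * h)%C).
  assert (Q1 : Cmod (z + h) * Cmod (u (x + RtoC t * h) - u x - RtoC t * h * C_derive u x)%C
     <= 1 * (8 * B / rho ^ 2 * Cmod h ^ 2)).
  { apply Rmult_le_compat; try apply Cmod_ge_0; [lra|].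
    eapply Rle_trans; [exact T|]. apply Rmult_le_compat_l; auto. apply pow_incr. lra. }
  assert (Q2 : Cmod (RtoC t * h) * Cmod h * Cmod (C_derive u x) <= Cmod h * Cmod h * (B / rho)).
  { apply Rmult_le_compat; auto; [apply Rmult_le_pos; auto|apply Cmod_ge_0|].
    apply Rmult_le_compat_r; auto. }
  unfold K. lra.
Qed.

Lemma C_derive_ray_primitive (u : C -> C) (z : C) : holo u -> inD z ->
  C_derive (ray_primitive u) z = u z.
Proof. intros Hu Hz. apply is_C_derive_unique, is_Cderive_ray_primitive; auto. Qed.

Lemma holo_ray_primitive (u : C -> C) : holo u -> holo (ray_primitive u).
Proof. intros Hu z Hz. exists (u z). apply is_Cderive_ray_primitive; auto. Qed.

(** * Series of dilations *)

Definition CSeries (a : nat -> C) : C :=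
  (Series (fun n => Re (a n)), Series (fun n => Im (a n))).

Definition Csummable (a : nat -> C) : Prop := ex_series (fun n => Cmod (a n)).

Lemma ex_series_Rabs_le (a b : nat -> R) :
  (forall n, Rabs (a n) <= b n) -> ex_series b -> ex_series a.
Proof.
  intros H Hb. apply (@ex_series_le R_AbsRing R_CompleteNormedModule a b); auto.
Qed.

Lemma Csummable_le (a : nat -> C) (b : nat -> R) :
  (forall n, Cmod (a n) <= b n) -> ex_series b -> Csummable a.
Proof.
  intros H Hb. apply (ex_series_Rabs_le _ b); auto.
  intros n. rewrite Rabs_pos_eq; auto. apply Cmod_ge_0.
Qed.

Lemma Csummable_Re (a : nat -> C) : Csummable a -> ex_series (fun n => Re (a n)).
Proof.
  intros H. eapply ex_series_Rabs_le; [|exact H]. intros n. apply re_le_Cmod.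
Qed.

Lemma Csummable_Im (a : nat -> C) : Csummable a -> ex_series (fun n => Im (a n)).
Proof.
  intros H. eapply ex_series_Rabs_le; [|exact H]. intros n. apply im_le_Cmod.
Qed.

Lemma CSeries_plus (a b : nat -> C) : Csummable a -> Csummable b ->
  CSeries (fun n => a n + b n)%C = (CSeries a + CSeries b)%C.
Proof.
  intros Ha Hb. unfold CSeries. apply injective_projections; simpl.
  - apply Series_plus; apply Csummable_Re; auto.
  - apply Series_plus; apply Csummable_Im; auto.
Qed.

Lemma CSeries_scal (c : C) (a : nat -> C) : Csummable a ->
  CSeries (fun n => c * a n)%C = (c * CSeries a)%C.
Proof.
  intros Ha. assert (H1 := Csummable_Re a Ha). assert (H2 := Csummable_Im a Ha).
  assert (S : forall k b, ex_series b -> ex_series (fun n : nat => k * b n)).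
  { intros k b Hb. apply (@ex_series_scal_l R_AbsRing); auto. }
  unfold CSeries. apply injective_projections; simpl.
  - rewrite <- !Series_scal_l, <- Series_minus; auto.
  - rewrite <- !Series_scal_l, <- Series_plus; auto.
Qed.

Lemma Series_nonneg (a : nat -> R) : (forall n, 0 <= a n) -> ex_series a -> 0 <= Series a.
Proof.
  intros Ha He. rewrite <- (Rmult_0_l (Series a)), <- Series_scal_l.
  apply Series_le; auto. intros n. generalize (Ha n). lra.
Qed.

(** With S the sum, |S|^2 is the real part of the series of conj(S) a_n, which reduces the infinite
    triangle inequality to a comparison of real series. *)
Lemma Cmod_CSeries_le (a : nat -> C) (b : nat -> R) :
  (forall n, Cmod (a n) <= b n) -> ex_series b -> Cmod (CSeries a) <= Series b.
Proof.
  intros H Hb. set (S := CSeries a).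
  assert (Ha := Csummable_le a b H Hb).
  assert (E : Cmod S ^ 2 = Re (CSeries (fun n => Cconj S * a n)%C)).
  { rewrite CSeries_scal by auto. fold S. rewrite Cmod2_alt. destruct S. simpl. ring. }
  assert (L : Cmod S ^ 2 <= Cmod S * Series b).
  { rewrite E, <- Series_scal_l. simpl.
    assert (HS : ex_series (fun n => Cmod S * b n)) by (apply (@ex_series_scal_l R_AbsRing); auto).
    assert (HR : forall n, Rabs (Re (Cconj S * a n)%C) <= Cmod S * b n).
    { intros n. eapply Rle_trans; [apply re_le_Cmod|]. rewrite Cmod_mult, Cmod_conj.
      apply Rmult_le_compat_l; [apply Cmod_ge_0|auto]. }
    eapply Rle_trans; [apply Rle_abs|].
    eapply Rle_trans; [apply Series_Rabs|].
    - eapply ex_series_Rabs_le; [|exact HS]. intros n. rewrite Rabs_Rabsolu. apply HR.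
    - apply Series_le; auto. intros n. split; [apply Rabs_pos|apply HR]. }
  assert (H0 := Cmod_ge_0 S).
  assert (Hb0 : 0 <= Series b).
  { apply Series_nonneg; auto. intros n. eapply Rle_trans; [apply Cmod_ge_0|apply H]. }
  destruct (Req_dec (Cmod S) 0); nra.
Qed.

Lemma CSeries_shift (a : nat -> C) : Csummable a ->
  CSeries a = (a 0%nat + CSeries (fun n => a (S n)))%C.
Proof.
  intros Ha. unfold CSeries. apply injective_projections; simpl;
    rewrite Series_incr_1; auto; [apply Csummable_Re|apply Csummable_Im]; auto.
Qed.

Lemma Series_ge_term (a : nat -> R) (n : nat) :
  (forall k, 0 <= a k) -> ex_series a -> a n <= Series a.
Proof.
  revert a. induction n as [|n IH]; intros a Ha He; rewrite Series_incr_1 by auto.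
  - assert (0 <= Series (fun k => a (S k))); [|lra].
    apply Series_nonneg; [auto|]. apply (proj1 (ex_series_incr_1 a)); auto.
  - assert (a (S n) <= Series (fun k => a (S k))).
    { apply (IH (fun k => a (S k))); [intros; apply Ha|].
      apply (proj1 (ex_series_incr_1 a)); auto. }
    generalize (Ha 0%nat). lra.
Qed.

Lemma is_series_half : is_series (fun n => (1 / 2) ^ n) 2.
Proof.
  assert (I := is_series_geom (1 / 2)). replace (/ (1 - 1 / 2)) with 2 in I by field.
  apply I. rewrite Rabs_pos_eq; lra.
Qed.

Lemma half_series_scal (K : R) : ex_series (fun n => (1 / 2) ^ n * K) /\
  Series (fun n => (1 / 2) ^ n * K) = 2 * K.
Proof.
  assert (I := is_series_scal_r K _ _ is_series_half).
  split; [eexists; exact I|apply is_series_unique; exact I].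
Qed.

(** * Weighted sums of dilations of a function with an increasing radial majorant *)

Section DilationSeries.

Variables (v : C -> C) (V : R -> R).
Hypothesis Hv : holo v.
Hypothesis HV : forall r s, 0 <= r -> r <= s -> s < 1 -> V r <= V s.
Hypothesis HvV : forall z, inD z -> Cmod (v z) <= V (Cmod z).

Definition dilation_series (rho : nat -> R) (z : C) : C :=
  CSeries (fun n => RtoC ((1 / 2) ^ n) * v (RtoC (rho n) * z))%C.

Lemma inD_dilation (rho : R) (z : C) : 0 <= rho <= 1 -> inD z -> inD (RtoC rho * z)%C.
Proof.
  unfold inD. intros H Hz. eapply Rle_lt_trans; [apply Cmod_real_scale_le|]; auto.
Qed.

Lemma dilation_term_le (n : nat) (K : R) (x : C) :
  Cmod x <= K -> Cmod (RtoC ((1 / 2) ^ n) * x)%C <= (1 / 2) ^ n * K.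
Proof.
  intros H. rewrite Cmod_mult, Cmod_R, Rabs_pos_eq by (apply pow_le; lra).
  apply Rmult_le_compat_l; auto. apply pow_le; lra.
Qed.

Lemma dilation_le (rho : R) (z : C) : 0 <= rho <= 1 -> inD z ->
  Cmod (v (RtoC rho * z)%C) <= V (Cmod z).
Proof.
  intros H Hz. eapply Rle_trans; [apply HvV, inD_dilation; auto|].
  apply HV; [apply Cmod_ge_0|apply Cmod_real_scale_le; auto|exact Hz].
Qed.

Variable rho : nat -> R.
Hypothesis Hrho : forall n, 0 <= rho n <= 1.

Lemma Csummable_dilation (z : C) : inD z ->
  Csummable (fun n => RtoC ((1 / 2) ^ n) * v (RtoC (rho n) * z))%C.
Proof.
  intros Hz. apply (Csummable_le _ (fun n => (1 / 2) ^ n * V (Cmod z))).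
  - intros n. apply dilation_term_le, dilation_le; auto.
  - apply half_series_scal.
Qed.

Lemma dilation_series_bound (z : C) : inD z -> Cmod (dilation_series rho z) <= 2 * V (Cmod z).
Proof.
  intros Hz. destruct (half_series_scal (V (Cmod z))) as [H1 H2].
  rewrite <- H2. apply Cmod_CSeries_le; auto.
  intros n. apply dilation_term_le, dilation_le; auto.
Qed.

Definition dilation_series_derive (z : C) : C :=
  CSeries (fun n => RtoC ((1 / 2) ^ n) * (RtoC (rho n) * C_derive v (RtoC (rho n) * z)))%C.

Lemma dilation_derive_bound (z : C) : inD z -> exists K, forall n,
  Cmod (RtoC (rho n) * C_derive v (RtoC (rho n) * z))%C <= K.
Proof.
  intros Hz. destruct (holo_bounded_on_disc (C_derive v) (Cmod z)) as [B HB].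
  - apply holo_C_derive, Hv.
  - split; [apply Cmod_ge_0|exact Hz].
  - exists B. intros n.
    assert (H := HB _ (Cmod_real_scale_le (rho n) z (Hrho n))).
    eapply Rle_trans; [apply Cmod_real_scale_le; auto|exact H].
Qed.

Lemma Csummable_dilation_derive (z : C) : inD z ->
  Csummable (fun n => RtoC ((1 / 2) ^ n) * (RtoC (rho n) * C_derive v (RtoC (rho n) * z)))%C.
Proof.
  intros Hz. destruct (dilation_derive_bound z Hz) as [K HK].
  apply (Csummable_le _ (fun n => (1 / 2) ^ n * K)).
  - intros n. apply dilation_term_le, HK.
  - apply half_series_scal.
Qed.

(** All dilated points lie in the disc of radius |z|, so one Taylor constant on discs of radius (1 -
    |z|)/2 serves every term; the factor 2 is the sum of the weights. *)
Lemma is_Cderive_dilation_series (z : C) : inD z ->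
  is_Cderive (dilation_series rho) z (dilation_series_derive z).
Proof.
  intros Hz. assert (Hz' := Hz). unfold inD in Hz'. assert (Hz0 := Cmod_ge_0 z).
  set (r := (1 - Cmod z) / 2). assert (Hr : 0 < r) by (unfold r; lra).
  set (B := V ((1 + Cmod z) / 2)).
  assert (HB0 : 0 <= B).
  { eapply Rle_trans; [apply (Cmod_ge_0 (v z))|]. eapply Rle_trans; [apply HvV, Hz|].
    apply HV; lra. }
  apply (is_Cderive_quadratic_error _ z _ (2 * (8 * B / r ^ 2)) (r / 4)); [lra|].
  intros h Hh. assert (Hh0 := Cmod_ge_0 h).
  assert (Hzh : inD (z + h)%C).
  { unfold inD. eapply Rle_lt_trans; [apply Cmod_triangle|]. unfold r in *; lra. }
  assert (S1 := Csummable_dilation (z + h)%C Hzh).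
  assert (S2 := Csummable_dilation z Hz).
  assert (S3 := Csummable_dilation_derive z Hz).
  set (a1 := fun n => (RtoC ((1 / 2) ^ n) * v (RtoC (rho n) * (z + h)))%C) in *.
  set (a2 := fun n => (RtoC ((1 / 2) ^ n) * v (RtoC (rho n) * z))%C) in *.
  set (a3 := fun n => (RtoC ((1 / 2) ^ n) * (RtoC (rho n) * C_derive v (RtoC (rho n) * z)))%C) in *.
  assert (Sc : forall c a, Csummable a -> Csummable (fun n => c * a n)%C).
  { intros c a Ha. apply (Csummable_le _ (fun n => Cmod c * Cmod (a n))).
    - intros n. rewrite Cmod_mult. lra.
    - apply (@ex_series_scal_l R_AbsRing); exact Ha. }
  assert (Sp : forall a b, Csummable a -> Csummable b -> Csummable (fun n => a n + b n)%C).
  { intros a b Ha Hb. apply (Csummable_le _ (fun n => Cmod (a n) + Cmod (b n))).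
    - intros n. apply Cmod_triangle.
    - apply (@ex_series_plus R_AbsRing R_NormedModule); [exact Ha|exact Hb]. }
  replace (dilation_series rho (z + h) - dilation_series rho z - h * dilation_series_derive z)%C
    with (CSeries (fun n => (a1 n + (- RtoC 1) * a2 n) + (- h) * a3 n)%C).
  2:{ rewrite !CSeries_plus, !CSeries_scal; auto.
      unfold dilation_series, dilation_series_derive. fold a1 a2 a3. ring. }
  set (K := 8 * B / r ^ 2 * Cmod h ^ 2).
  destruct (half_series_scal K) as [H1 H2].
  replace (2 * (8 * B / r ^ 2) * Cmod h ^ 2) with (2 * K) by (unfold K; ring).
  rewrite <- H2. apply Cmod_CSeries_le; auto.
  intros n. unfold a1, a2, a3.
  assert (Hrn := Cmod_real_scale_le (rho n) z (Hrho n)).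
  assert (Hrh := Cmod_real_scale_le (rho n) h (Hrho n)).
  set (x := (RtoC (rho n) * z)%C) in *. set (k := (RtoC (rho n) * h)%C) in *.
  replace (RtoC ((1 / 2) ^ n) * v (RtoC (rho n) * (z + h)) + (- RtoC 1) * (RtoC ((1 / 2) ^ n) * v x)
           + - h * (RtoC ((1 / 2) ^ n) * (RtoC (rho n) * C_derive v x)))%C
    with (RtoC ((1 / 2) ^ n) * (v (x + k) - v x - k * C_derive v x))%C.
  2:{ replace (RtoC (rho n) * (z + h))%C with (x + k)%C by (unfold x, k; ring).
      unfold k. ring. }
  apply dilation_term_le.
  eapply Rle_trans; [apply (Taylor_error v x r B Hr)|].
  - apply holo_Cdiff_on_disc; auto. unfold r; lra.
  - intros y Hy.
    assert (Hym : Cmod y <= (1 + Cmod z) / 2).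
    { replace y with (x + (y - x))%C by ring. eapply Rle_trans; [apply Cmod_triangle|].
      unfold r in *; lra. }
    eapply Rle_trans; [apply HvV; unfold inD; lra|]. apply HV; try lra. apply Cmod_ge_0.
  - lra.
  - unfold K. apply Rmult_le_compat_l.
    + apply Rdiv_le_0_compat; [lra|]. apply pow_lt; lra.
    + apply pow_incr. split; [apply Cmod_ge_0|lra].
Qed.

Lemma holo_dilation_series : holo (dilation_series rho).
Proof. intros z Hz. eexists. apply is_Cderive_dilation_series, Hz. Qed.

End DilationSeries.

(** Each of the first N terms is bounded on the disc, as its rho is below 1; the others carry
    weights of total 2 (1/2)^N. The sequence [rho] is quantified inside the induction, since each
    step shifts it. *)
Lemma dilation_series_tail (v : C -> C) (V : R -> R) :
  (forall r s, 0 <= r -> r <= s -> s < 1 -> V r <= V s) ->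
  (forall z, inD z -> Cmod (v z) <= V (Cmod z)) ->
  forall (N : nat) (rho : nat -> R), (forall n, 0 <= rho n < 1) ->
  exists M, forall z, inD z ->
    Cmod (dilation_series v rho z) <= M + 2 * (1 / 2) ^ N * V (Cmod z).
Proof.
  intros HV HvV. induction N as [|N IH]; intros rho Hrho.
  - exists 0. intros z Hz.
    assert (H := dilation_series_bound v V HV HvV rho (fun n => conj (proj1 (Hrho n)) (Rlt_le _ _ (proj2 (Hrho n)))) z Hz).
    simpl. lra.
  - destruct (IH (fun n => rho (S n)) (fun n => Hrho (S n))) as [M HM].
    exists (V (rho 0%nat) + M / 2). intros z Hz. specialize (HM z Hz).
    assert (Hr : forall n, 0 <= rho n <= 1).
    { intros n. destruct (Hrho n). lra. }
    assert (S0 := Csummable_dilation v V HV HvV rho Hr z Hz).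
    assert (S1 := Csummable_dilation v V HV HvV _ (fun n => Hr (S n)) z Hz).
    assert (E : dilation_series v rho z
      = (v (RtoC (rho 0%nat) * z) + RtoC (1 / 2) * dilation_series v (fun n => rho (S n)) z)%C).
    { unfold dilation_series at 1. rewrite CSeries_shift by auto. f_equal.
      - simpl. ring.
      - unfold dilation_series. rewrite <- CSeries_scal by auto.
        f_equal. apply FunctionalExtensionality.functional_extensionality. intros n.
        simpl. rewrite RtoC_mult. ring. }
    rewrite E. eapply Rle_trans; [apply Cmod_triangle|].
    rewrite (Cmod_mult (RtoC (1 / 2))), Cmod_R, Rabs_pos_eq by lra.
    assert (H0 : Cmod (v (RtoC (rho 0%nat) * z)%C) <= V (rho 0%nat)).
    { destruct (Hrho 0%nat) as [R0 R1].
      assert (Hm : Cmod (RtoC (rho 0%nat) * z)%C <= rho 0%nat).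
      { rewrite Cmod_mult, Cmod_R, Rabs_pos_eq by lra. unfold inD in Hz. generalize (Cmod_ge_0 z). nra. }
      eapply Rle_trans; [apply HvV; unfold inD; lra|]. apply HV; auto. apply Cmod_ge_0. }
    simpl. lra.
Qed.

(** The bounded head is killed by w -> 0 at the boundary, the tail by (1/2)^N because w V <= 1; each
    is made to cost at most eps/2. *)
Lemma dilation_series_vanishing (v : C -> C) (V : R -> R) (w : C -> R) (rho : nat -> R) :
  (forall r s, 0 <= r -> r <= s -> s < 1 -> V r <= V s) ->
  (forall z, inD z -> Cmod (v z) <= V (Cmod z)) ->
  (forall n, 0 <= rho n < 1) ->
  (forall z, inD z -> 0 <= w z /\ w z * V (Cmod z) <= 1) ->
  (forall eps, 0 < eps -> exists r, r < 1 /\ forall z, r < Cmod z -> Cmod z < 1 -> w z < eps) ->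
  forall eps, 0 < eps -> exists r, r < 1 /\ forall z, r < Cmod z -> Cmod z < 1 ->
    w z * Cmod (dilation_series v rho z) < eps.
Proof.
  intros HV HvV Hrho Hw Hlim eps He.
  destruct (pow_lt_1_zero (1 / 2)) with (y := eps / 4) as [N HN]; [rewrite Rabs_pos_eq; lra|lra|].
  specialize (HN N (le_n N)). rewrite Rabs_pos_eq in HN by (apply pow_le; lra).
  destruct (dilation_series_tail v V HV HvV N rho Hrho) as [M HM].
  assert (HM0 := Rabs_pos M).
  destruct (Hlim (eps / (2 * (Rabs M + 1)))) as [r [Hr Hwr]]; [apply Rdiv_lt_0_compat; lra|].
  exists r. split; auto. intros z H1 H2.
  specialize (Hwr z H1 H2). destruct (Hw z H2) as [Hw0 HwV]. specialize (HM z H2).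
  apply Rle_lt_trans with (w z * (M + 2 * (1 / 2) ^ N * V (Cmod z))).
  { apply Rmult_le_compat_l; auto. }
  assert (K1 : w z * M < eps / 2).
  { apply Rle_lt_trans with (w z * (Rabs M)).
    - apply Rmult_le_compat_l; auto. apply Rle_abs.
    - apply Rle_lt_trans with (w z * (Rabs M + 1)); [nra|].
      apply (Rmult_lt_compat_r (Rabs M + 1)) in Hwr; [|lra].
      replace (eps / (2 * (Rabs M + 1)) * (Rabs M + 1)) with (eps / 2) in Hwr by (field; lra). exact Hwr. }
  assert (K2 : (1 / 2) ^ N * (w z * V (Cmod z)) <= (1 / 2) ^ N * 1).
  { apply Rmult_le_compat_l; auto. apply pow_le; lra. }
  lra.
Qed.

(** * Consequences of quasi-normality *)

Lemma Cmod_RtoC_nonneg (r : R) : 0 <= r -> Cmod (RtoC r) = r.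
Proof. intros H. rewrite Cmod_R, Rabs_pos_eq; auto. Qed.

Lemma Re_mult_RtoC (c : C) (r : R) : Re (c * RtoC r)%C = Re c * r.
Proof. destruct c. simpl. ring. Qed.

Lemma inD_RtoC (r : R) : 0 <= r < 1 -> inD (RtoC r).
Proof. intros H. unfold inD. rewrite Cmod_RtoC_nonneg; lra. Qed.

(** The limit rho -> 1 for inequalities, used to pass from dilations back to the function itself. *)
Lemma le_of_le_scal_one_minus (x y K : R) :
  (forall rho, 0 <= rho < 1 -> x <= y + K * (1 - rho)) -> x <= y.
Proof.
  intros H. apply Rnot_lt_le. intros Hlt.
  assert (HK := Rabs_pos K). assert (HK' := Rle_abs K).
  set (d := Rmin 1 ((x - y) / (2 * (Rabs K + 1)))).
  assert (Hd : 0 < d) by (apply Rmin_glb_lt; [lra|apply Rdiv_lt_0_compat; lra]).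
  assert (Hd1 : d <= 1) by apply Rmin_l.
  assert (Hd2 : d <= (x - y) / (2 * (Rabs K + 1))) by apply Rmin_r.
  specialize (H (1 - d) ltac:(lra)). replace (1 - (1 - d)) with d in H by ring.
  apply (Rmult_le_compat_l (Rabs K + 1)) in Hd2; [|lra].
  replace ((Rabs K + 1) * ((x - y) / (2 * (Rabs K + 1)))) with ((x - y) / 2) in Hd2 by (field; lra).
  nra.
Qed.

(** Gliding hump, in the role of the closed graph theorem: if Q were unbounded, choosing rho_n where
    it exceeds 4^n would give 2^n < K for every n. *)
Lemma geometric_uniform_bound (Q : R -> R -> R) :
  (forall rho : nat -> R, (forall n, 0 <= rho n < 1) ->
     exists K, forall n r, 0 <= r < 1 -> (1 / 2) ^ n * Q (rho n) r <= K) ->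
  exists C0, forall rho r, 0 <= rho < 1 -> 0 <= r < 1 -> Q rho r <= C0.
Proof.
  intros H. apply NNPP. intros Hno.
  assert (Hc : forall n : nat, exists p : R * R,
    0 <= fst p < 1 /\ 0 <= snd p < 1 /\ 4 ^ n < Q (fst p) (snd p)).
  { intros n. apply NNPP. intros Hn. apply Hno. exists (4 ^ n). intros rho r H1 H2.
    apply Rnot_lt_le. intros Hlt. apply Hn. exists (rho, r). simpl. auto. }
  set (p := fun n => proj1_sig (constructive_indefinite_description _ (Hc n))).
  assert (Hp : forall n, 0 <= fst (p n) < 1 /\ 0 <= snd (p n) < 1 /\ 4 ^ n < Q (fst (p n)) (snd (p n))).
  { intros n. unfold p. apply (proj2_sig (constructive_indefinite_description _ (Hc n))). }
  destruct (H (fun n => fst (p n)) (fun n => proj1 (Hp n))) as [K HK].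
  destruct (Pow_x_infinity 2) with (b := Rabs K + 1) as [N HN]; [rewrite Rabs_pos_eq; lra|].
  specialize (HN N (le_n N)). rewrite Rabs_pos_eq in HN by (apply pow_le; lra).
  destruct (Hp N) as [_ [H2 H3]].
  specialize (HK N (snd (p N)) H2).
  assert (E : (1 / 2) ^ N * 4 ^ N = 2 ^ N).
  { rewrite <- Rpow_mult_distr. f_equal. field. }
  apply (Rmult_lt_compat_l ((1 / 2) ^ N)) in H3; [|apply pow_lt; lra].
  generalize (Rle_abs K). lra.
Qed.

Lemma vanishing_weighted_bounded (w : C -> R) (f : C -> C) (W : R) : holo f ->
  (forall z, inD z -> 0 <= w z <= W) ->
  (forall eps, 0 < eps -> exists r, r < 1 /\
     forall z, r < Cmod z -> Cmod z < 1 -> w z * Cmod (f z) < eps) ->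
  exists K, forall z, inD z -> w z * Cmod (f z) <= K.
Proof.
  intros Hf Hw Hlim. destruct (Hlim 1 Rlt_0_1) as [r [Hr H]].
  destruct (holo_bounded_on_disc f (Rmax r 0) Hf) as [B HB].
  { split; [apply Rmax_r|apply Rmax_lub_lt; lra]. }
  exists (W * B + 1). intros z Hz. destruct (Hw z Hz) as [H0 HW].
  assert (HB0 : 0 <= B).
  { eapply Rle_trans; [apply (Cmod_ge_0 (f 0%C))|apply HB]. rewrite Cmod_0. apply Rmax_r. }
  destruct (Rle_dec (Cmod z) r) as [Hzr|Hzr].
  - assert (Cmod (f z) <= B) by (apply HB; eapply Rle_trans; [exact Hzr|apply Rmax_l]).
    assert (w z * Cmod (f z) <= W * B) by (apply Rmult_le_compat; auto; apply Cmod_ge_0). lra.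
  - specialize (H z ltac:(lra) Hz). assert (0 <= W * B) by (apply Rmult_le_pos; lra). lra.
Qed.

Lemma is_derive_Re_real (f : C -> C) (r : R) (l : C) :
  is_Cderive f (RtoC r) l -> is_derive (fun s : R => Re (f (RtoC s))) r (Re l).
Proof.
  intros H.
  assert (E : forall s : R, (0 + RtoC s * 1)%C = RtoC s) by (intros; ring).
  assert (D := is_derive_line f 0%C 1%C l r).
  rewrite E in D. specialize (D H).
  assert (D1 : is_derive (fun s : R => Re (f (0 + RtoC s * 1)%C)) r (Re (l * 1)%C)).
  { apply (filterdiff_comp' (fun s : R => f (0 + RtoC s * 1)%C) (fst : C_R_NormedModule -> R) r
             _ (fst : C_R_NormedModule -> R) D).
    apply filterdiff_linear. apply is_linear_fst. }
  rewrite Cmult_1_r in D1.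
  eapply is_derive_ext; [|exact D1]. intros s. simpl. rewrite E. reflexivity.
Qed.

Lemma is_RInt_Re (f : R -> C) (a b : R) (l : C) :
  is_CInt f a b l -> is_RInt (fun t => Re (f t)) a b (Re l).
Proof.
  intros H. apply (@is_RInt_fct_extend_fst R_NormedModule R_NormedModule f a b l H).
Qed.

(** * Growth of [F] on the radius *)

Section AnalyticWeight.

Variables (nu : C -> R) (F : C -> C).
Hypothesis Hnu : weight nu.
Hypothesis HF : holo F.
Hypothesis HnuF : forall z, inD z ->
  (RtoC (nu z) * F (RtoC (Cmod z)) = 1)%C /\ Im (F (RtoC (Cmod z))) = 0 /\
  Cmod (F z) <= Re (F (RtoC (Cmod z))).

Definition radial (f : C -> C) (r : R) : R := Re (f (RtoC r)).

Lemma radial_real (r : R) : 0 <= r < 1 -> F (RtoC r) = RtoC (radial F r).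
Proof.
  intros Hr. destruct (HnuF (RtoC r) (inD_RtoC r Hr)) as [_ [H _]].
  rewrite Cmod_RtoC_nonneg in H by lra. unfold radial.
  destruct (F (RtoC r)) as [x y]. simpl in *. rewrite H. reflexivity.
Qed.

Lemma nu_radial (z : C) : inD z -> nu z * radial F (Cmod z) = 1.
Proof.
  intros Hz. destruct (HnuF z Hz) as [H _].
  rewrite radial_real, <- RtoC_mult in H by (split; [apply Cmod_ge_0|exact Hz]).
  apply RtoC_inj in H. exact H.
Qed.

Lemma nu_pos (z : C) : inD z -> 0 < nu z.
Proof.
  intros Hz. destruct (proj1 Hnu z Hz) as [H|H]; auto.
  generalize (nu_radial z Hz). rewrite <- H. lra.
Qed.

Lemma radial_pos (r : R) : 0 <= r < 1 -> 0 < radial F r.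
Proof.
  intros Hr. assert (H := nu_radial _ (inD_RtoC r Hr)).
  rewrite Cmod_RtoC_nonneg in H by lra. assert (H0 := nu_pos _ (inD_RtoC r Hr)). nra.
Qed.

Lemma nu_inv_radial (z : C) : inD z -> nu z = / radial F (Cmod z).
Proof.
  intros Hz. assert (H := nu_radial z Hz).
  assert (H0 := radial_pos (Cmod z) (conj (Cmod_ge_0 z) Hz)).
  apply Rmult_eq_reg_r with (radial F (Cmod z)); [|lra]. rewrite H, Rinv_l; lra.
Qed.

Lemma radial_mono (r s : R) : 0 <= r -> r <= s -> s < 1 -> radial F r <= radial F s.
Proof.
  intros H0 Hrs Hs.
  assert (Hr : 0 <= r < 1) by lra. assert (Hs' : 0 <= s < 1) by lra.
  destruct Hnu as [_ [_ [_ Hd]]].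
  assert (H := Hd (RtoC r) (RtoC s) (inD_RtoC r Hr) (inD_RtoC s Hs')).
  rewrite !Cmod_RtoC_nonneg in H by lra. specialize (H Hrs).
  rewrite !nu_inv_radial in H by (apply inD_RtoC; auto).
  rewrite !Cmod_RtoC_nonneg in H by lra.
  apply Rinv_le_contravar in H; [|apply Rinv_0_lt_compat, radial_pos; auto].
  rewrite !Rinv_inv in H. exact H.
Qed.

Lemma Cmod_le_radial (z : C) : inD z -> Cmod (F z) <= radial F (Cmod z).
Proof. intros Hz. apply HnuF, Hz. Qed.

(** The weight decreases, so [F] increases on the radius. This sign makes the derived series have
    nonnegative terms there. *)
Lemma radial_derive_nonneg (r : R) : 0 <= r < 1 -> 0 <= radial (C_derive F) r.
Proof.
  intros Hr. assert (D := holo_is_Cderive F _ HF (inD_RtoC r Hr)).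
  rewrite is_Cderive_eps in D. unfold radial. set (l := C_derive F (RtoC r)) in *.
  apply Rnot_lt_le. intros Hl.
  destruct (D (- Re l / 2)) as [d [Hd H]]; [lra|].
  set (h := Rmin (d / 2) ((1 - r) / 2)).
  assert (Hh : 0 < h) by (apply Rmin_glb_lt; lra).
  assert (Hh1 : h <= d / 2) by apply Rmin_l. assert (Hh2 : h <= (1 - r) / 2) by apply Rmin_r.
  specialize (H (RtoC h)). rewrite Cmod_RtoC_nonneg in H by lra.
  specialize (H ltac:(lra)).
  assert (K := re_le_Cmod (F (RtoC r + RtoC h) - F (RtoC r) - RtoC h * l)%C).
  rewrite <- RtoC_plus in K, H.
  assert (M := radial_mono r (r + h) ltac:(lra) ltac:(lra) ltac:(lra)). unfold radial in M.
  replace (Re (F (RtoC (r + h)) - F (RtoC r) - RtoC h * l)%C)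
    with (Re (F (RtoC (r + h))) - Re (F (RtoC r)) - h * Re l) in K
    by (destruct (F (RtoC (r + h))), (F (RtoC r)), l; simpl; ring).
  generalize (Rle_abs (Re (F (RtoC (r + h))) - Re (F (RtoC r)) - h * Re l)). nra.
Qed.

Definition nu1 (z : C) : R := nu z * (1 - Cmod z ^ 2).

Lemma one_minus_sqr_pos (r : R) : 0 <= r < 1 -> 0 < 1 - r ^ 2 <= 1.
Proof. intros H. nra. Qed.

Lemma nu_bounded (z : C) : inD z -> 0 <= nu z <= nu 0%C.
Proof.
  intros Hz. split; [left; apply nu_pos, Hz|].
  apply Hnu; auto; [unfold inD; rewrite Cmod_0; lra|rewrite Cmod_0; apply Cmod_ge_0].
Qed.

Lemma nu1_bounded (z : C) : inD z -> 0 <= nu1 z <= nu 0%C.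
Proof.
  intros Hz. destruct (nu_bounded z Hz) as [H1 H2].
  destruct (one_minus_sqr_pos (Cmod z) (conj (Cmod_ge_0 z) Hz)) as [H3 H4].
  unfold nu1. nra.
Qed.

Hypothesis Hqn : forall f, H0 nu f <-> B0 nu1 f.

(* The constant function [1] lies in the right-hand space. *)
Lemma nu_vanishing (eps : R) : 0 < eps ->
  exists r, r < 1 /\ forall z, r < Cmod z -> Cmod z < 1 -> nu z < eps.
Proof.
  intros He.
  assert (HB : B0 nu1 (fun _ => 1%C)).
  { split.
    - intros z _. eexists. apply (is_Cderive_const 1%C z).
    - intros e He'. exists 0. split; [lra|]. intros z _ _.
      rewrite (is_C_derive_unique _ z 0%C (is_Cderive_const 1%C z)), Cmod_0. lra. }
  apply Hqn in HB. destruct (proj2 HB eps He) as [r [Hr H]].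
  exists r. split; auto. intros z H1 H2. specialize (H z H1 H2).
  rewrite Cmod_1 in H. lra.
Qed.

Lemma nu1_vanishing (eps : R) : 0 < eps ->
  exists r, r < 1 /\ forall z, r < Cmod z -> Cmod z < 1 -> nu1 z < eps.
Proof.
  intros He. destruct (nu_vanishing eps He) as [r [Hr H]].
  exists r. split; auto. intros z H1 H2. specialize (H z H1 H2).
  destruct (nu_bounded z H2) as [H3 _].
  destruct (one_minus_sqr_pos (Cmod z) (conj (Cmod_ge_0 z) H2)) as [H4 H5].
  unfold nu1. nra.
Qed.

(* All the terms of the series are nonnegative on the radius, so that one term is a lower bound. *)
Lemma radial_derive_dilation_bound : exists C0, forall rho r, 0 <= rho < 1 -> 0 <= r < 1 ->
  (1 - r ^ 2) * (rho * radial (C_derive F) (rho * r)) / radial F r <= C0.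
Proof.
  apply (geometric_uniform_bound
    (fun rho r => (1 - r ^ 2) * (rho * radial (C_derive F) (rho * r)) / radial F r)).
  intros rho Hrho.
  assert (Hrho' : forall n, 0 <= rho n <= 1) by (intros n; specialize (Hrho n); lra).
  set (u := dilation_series F rho).
  assert (Hu : holo u) by (apply (holo_dilation_series F (radial F) HF radial_mono Cmod_le_radial rho Hrho')).
  assert (HH : H0 nu u).
  { split; auto.
    apply (dilation_series_vanishing F (radial F) nu rho radial_mono Cmod_le_radial Hrho).
    - intros z Hz. split; [apply nu_bounded, Hz|rewrite nu_radial; auto; lra].
    - apply nu_vanishing. }
  apply Hqn in HH.
  destruct (vanishing_weighted_bounded nu1 (C_derive u) (nu 0%C)) as [K HK].
  - apply holo_C_derive, Hu.
  - apply nu1_bounded.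
  - apply HH.
  - exists K. intros n r Hr.
    specialize (HK (RtoC r) (inD_RtoC r Hr)).
    rewrite (is_C_derive_unique u (RtoC r) _
      (is_Cderive_dilation_series F (radial F) HF radial_mono Cmod_le_radial rho Hrho' _ (inD_RtoC r Hr))) in HK.
    unfold nu1 in HK. rewrite nu_inv_radial in HK by (apply inD_RtoC; auto).
    rewrite Cmod_RtoC_nonneg in HK by lra.
    assert (Hp := radial_pos r Hr). destruct (one_minus_sqr_pos r Hr) as [H1 _].
    assert (T : (1 / 2) ^ n * (rho n * radial (C_derive F) (rho n * r))
       <= Cmod (dilation_series_derive F rho (RtoC r))).
    { eapply Rle_trans; [|apply re_le_Cmod]. eapply Rle_trans; [|apply Rle_abs].
      unfold dilation_series_derive, CSeries. simpl.
      assert (E : forall k, Re (RtoC ((1 / 2) ^ k) * (RtoC (rho k) * C_derive F (RtoC (rho k) * RtoC r)))%C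
        = (1 / 2) ^ k * (rho k * radial (C_derive F) (rho k * r))).
      { intros k. rewrite <- (RtoC_mult (rho k) r). unfold radial.
        destruct (C_derive F (RtoC (rho k * r))). simpl. ring. }
      rewrite <- (E n).
      apply (Series_ge_term (fun k => Re (RtoC ((1 / 2) ^ k) * (RtoC (rho k) * C_derive F (RtoC (rho k) * RtoC r)))%C)).
      - intros k. rewrite E. apply Rmult_le_pos; [apply pow_le; lra|].
        specialize (Hrho k). apply Rmult_le_pos; [lra|]. apply radial_derive_nonneg. nra.
      - apply Csummable_Re.
        apply (Csummable_dilation_derive F HF rho Hrho'). apply inD_RtoC; auto. }
    eapply Rle_trans; [|exact HK].
    replace ((1 / 2) ^ n * ((1 - r ^ 2) * (rho n * radial (C_derive F) (rho n * r)) / radial F r))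
      with (/ radial F r * (1 - r ^ 2) * ((1 / 2) ^ n * (rho n * radial (C_derive F) (rho n * r))))
      by (field; lra).
    apply Rmult_le_compat_l; auto.
    apply Rmult_le_pos; [left; apply Rinv_0_lt_compat, Hp|lra].
Qed.

(** The constant is uniform in x, so the estimate can also be integrated over the radius before rho
    tends to 1. *)
Lemma dilation_radial_close (v : C -> C) (r : R) : holo v -> 0 <= r < 1 ->
  exists L, forall rho x, 0 <= rho < 1 -> 0 <= x <= r ->
    Rabs (radial v x - radial v (rho * x)) <= L * (1 - rho).
Proof.
  intros Hv Hr.
  destruct (holo_bounded_on_disc (C_derive v) r (holo_C_derive v Hv) Hr) as [L HL].
  assert (HL0 : 0 <= L).
  { eapply Rle_trans; [apply Cmod_ge_0|apply (HL 0%C)]. rewrite Cmod_0. lra. }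
  exists L. intros rho x Hrho Hx.
  assert (E : forall t, (RtoC (rho * x) + RtoC t * RtoC ((1 - rho) * x))%C = RtoC (rho * x + t * ((1 - rho) * x))).
  { intros t. rewrite RtoC_plus, (RtoC_mult t). reflexivity. }
  assert (Hb : forall t, 0 <= t <= 1 -> 0 <= rho * x + t * ((1 - rho) * x) <= r).
  { intros t Ht. assert (Hc : 0 <= rho + t * (1 - rho) <= 1) by nra.
    replace (rho * x + t * ((1 - rho) * x)) with ((rho + t * (1 - rho)) * x) by ring. nra. }
  assert (B := Cderive_segment_bound v (C_derive v) (RtoC (rho * x)) (RtoC ((1 - rho) * x)) L).
  assert (B' : Cmod (v (RtoC (rho * x) + RtoC ((1 - rho) * x))%C - v (RtoC (rho * x)))%C
     <= L * Cmod (RtoC ((1 - rho) * x))).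
  { apply B; intros t Ht; rewrite E; specialize (Hb t Ht).
    - apply holo_is_Cderive; auto. apply inD_RtoC. lra.
    - apply HL. rewrite Cmod_RtoC_nonneg; lra. }
  rewrite Cmod_RtoC_nonneg, <- RtoC_plus in B' by nra.
  replace (rho * x + (1 - rho) * x) with x in B' by ring.
  unfold radial. replace (Re (v (RtoC x)) - Re (v (RtoC (rho * x)))) with (Re (v (RtoC x) - v (RtoC (rho * x)))%C)
    by reflexivity.
  eapply Rle_trans; [apply re_le_Cmod|]. eapply Rle_trans; [exact B'|].
  apply Rmult_le_compat_l; auto. nra.
Qed.

Lemma radial_derive_bound : exists C0, 0 <= C0 /\ forall r, 0 <= r < 1 ->
  (1 - r ^ 2) * radial (C_derive F) r <= C0 * radial F r.
Proof.
  destruct radial_derive_dilation_bound as [C0 HC0].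
  exists (Rmax C0 0). split; [apply Rmax_r|]. intros r Hr.
  destruct (dilation_radial_close (C_derive F) r (holo_C_derive F HF) Hr) as [L HL].
  assert (Hp := radial_pos r Hr). assert (Hq := one_minus_sqr_pos r Hr).
  assert (Hd := radial_derive_nonneg r Hr).
  (* Two errors proportional to 1 - rho: moving the argument of F' from rho r to r, and removing the
     factor rho in front of F'. *)
  apply (le_of_le_scal_one_minus _ _ (Rabs L + (1 - r ^ 2) * radial (C_derive F) r)).
  intros rho Hrho. specialize (HC0 rho r Hrho Hr). specialize (HL rho r Hrho ltac:(lra)).
  assert (HLa := Rle_abs L). assert (HLp := Rabs_pos L).
  assert (H1 : (1 - r ^ 2) * (rho * radial (C_derive F) (rho * r)) <= Rmax C0 0 * radial F r).
  { apply (Rmult_le_compat_r (radial F r)) in HC0; [|lra].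
    unfold Rdiv in HC0. rewrite Rmult_assoc, Rinv_l, Rmult_1_r in HC0 by lra.
    eapply Rle_trans; [exact HC0|]. apply Rmult_le_compat_r; [lra|apply Rmax_l]. }
  apply Rabs_le_between in HL.
  set (A := radial (C_derive F) r) in *. set (A' := radial (C_derive F) (rho * r)) in *.
  set (q := 1 - r ^ 2) in *.
  assert (H2 : q * (rho * A) <= q * (rho * A') + Rabs L * (1 - rho)).
  { assert (q * rho * (A - A') <= 1 * (Rabs L * (1 - rho))); [|lra].
    apply Rle_trans with (q * rho * (Rabs L * (1 - rho))).
    - apply Rmult_le_compat_l; [nra|]. apply Rle_trans with (L * (1 - rho)); [lra|].
      apply Rmult_le_compat_r; lra.
    - apply Rmult_le_compat_r; [|nra]. apply Rmult_le_pos; lra. }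
  nra.
Qed.

(** The logarithmic derivative of [F] is at most C0 / (1 - c^2), and [r, (1+r)/2] has bounded
    hyperbolic length. *)
Lemma radial_doubling : exists C0, 0 <= C0 /\ forall r, 0 <= r < 1 ->
  radial F ((1 + r) / 2) <= C0 * radial F r.
Proof.
  destruct radial_derive_bound as [C0 [HC0 H]].
  exists (exp C0). split; [left; apply exp_pos|]. intros r Hr.
  assert (D : forall x, 0 <= x < 1 ->
     is_derive (fun s => ln (radial F s)) x (radial (C_derive F) x * / radial F x)).
  { intros x Hx. apply (is_derive_comp ln (radial F) x).
    - apply is_derive_ln, radial_pos, Hx.
    - apply is_derive_Re_real, holo_is_Cderive; auto. apply inD_RtoC; auto. }
  destruct (MVT_gen (fun s => ln (radial F s)) r ((1 + r) / 2)
     (fun x => radial (C_derive F) x * / radial F x)) as [c [Hc E]].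
  - intros x. rewrite Rmin_left, Rmax_right by lra. intros Hx. apply D; lra.
  - intros x. rewrite Rmin_left, Rmax_right by lra. intros Hx.
    apply continuity_pt_filterlim.
    apply (ex_derive_continuous (K := R_AbsRing) (V := R_NormedModule) (fun s => ln (radial F s)) x).
    eexists. apply D; lra.
  - rewrite Rmin_left, Rmax_right in Hc by lra.
    assert (Hc1 : 0 <= c < 1) by lra.
    assert (Hp := radial_pos c Hc1). specialize (H c Hc1).
    set (A := radial (C_derive F) c * / radial F c) in *.
    assert (HA : (1 - c ^ 2) * A <= C0).
    { unfold A. rewrite <- Rmult_assoc. apply (Rmult_le_compat_r (/ radial F c)) in H.
      - rewrite (Rmult_assoc C0), Rinv_r, Rmult_1_r in H; lra.
      - left. apply Rinv_0_lt_compat, Hp. }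
    assert (HA0 : 0 <= A).
    { apply Rmult_le_pos; [apply radial_derive_nonneg, Hc1|left; apply Rinv_0_lt_compat, Hp]. }
    assert (Hln : ln (radial F ((1 + r) / 2)) <= C0 + ln (radial F r)).
    (* Since c <= (1+r)/2, one has (1-r)/2 <= 1 - c <= 1 - c^2. *)
    { assert (A * ((1 + r) / 2 - r) <= C0); [|lra].
      eapply Rle_trans; [|exact HA]. rewrite Rmult_comm. apply Rmult_le_compat_r; auto. nra. }
    assert (Hp1 := radial_pos r Hr). assert (Hp2 := radial_pos ((1 + r) / 2) ltac:(lra)).
    rewrite <- (exp_ln (radial F ((1 + r) / 2))), <- (exp_ln (radial F r)), <- exp_plus by auto.
    destruct Hln as [Hln|Hln]; [left; apply exp_increasing, Hln|right; rewrite Hln; reflexivity].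
Qed.

(** Cauchy's estimate on the disc of radius (1 - |z|)/2: its points have modulus at most (1 +
    |z|)/2, where doubling compares [F] with its value at |z|. *)
Lemma Hinf_derive_bound : exists C0, 0 <= C0 /\ forall f M, holo f ->
  (forall z, inD z -> nu z * Cmod (f z) <= M) ->
  forall z, inD z -> nu z * (1 - Cmod z ^ 2) * Cmod (C_derive f z) <= C0 * M.
Proof.
  destruct radial_doubling as [C0 [HC0 H]].
  exists (4 * C0). split; [lra|]. intros f M Hf HM z Hz.
  assert (Hz0 := Cmod_ge_0 z). assert (Hz1 := Hz). unfold inD in Hz1.
  set (r := Cmod z) in *. set (rho := (1 - r) / 2).
  assert (HM0 : 0 <= M).
  { eapply Rle_trans; [|apply (HM z Hz)]. apply Rmult_le_pos; [apply nu_bounded, Hz|apply Cmod_ge_0]. }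
  assert (B : Cmod (C_derive f z) <= M * (C0 * radial F r) / rho).
  { apply Cauchy_estimate; [unfold rho; lra| |].
    - apply holo_Cdiff_on_disc; auto. fold r. unfold rho; lra.
    - intros x Hx.
      assert (Hxm : Cmod x <= (1 + r) / 2).
      { replace x with (z + (x - z))%C by ring. eapply Rle_trans; [apply Cmod_triangle|].
        fold r. unfold rho in Hx. lra. }
      assert (HxD : inD x) by (unfold inD; lra).
      assert (Hfx := HM x HxD). rewrite nu_inv_radial in Hfx by auto.
      assert (Hp := radial_pos (Cmod x) (conj (Cmod_ge_0 x) HxD)).
      apply (Rmult_le_compat_l (radial F (Cmod x))) in Hfx; [|lra].
      rewrite <- Rmult_assoc, Rinv_r, Rmult_1_l in Hfx by lra.
      eapply Rle_trans; [exact Hfx|]. rewrite Rmult_comm. apply Rmult_le_compat_l; auto.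
      eapply Rle_trans; [apply radial_mono with (s := (1 + r) / 2); [apply Cmod_ge_0|auto|lra]|].
      apply H; lra. }
  rewrite nu_inv_radial by auto. fold r.
  assert (Hp := radial_pos r (conj Hz0 Hz1)).
  assert (Hq := one_minus_sqr_pos r (conj Hz0 Hz1)).
  apply Rle_trans with (/ radial F r * (1 - r ^ 2) * (M * (C0 * radial F r) / rho)).
  - apply Rmult_le_compat_l; auto. apply Rmult_le_pos; [left; apply Rinv_0_lt_compat, Hp|lra].
  - replace (/ radial F r * (1 - r ^ 2) * (M * (C0 * radial F r) / rho)) with (2 * (1 + r) * (C0 * M))
      by (unfold rho; field; lra).
    assert (0 <= C0 * M) by (apply Rmult_le_pos; auto). nra.
Qed.

Definition hyperbolic_radial (r : R) : R := radial F r / (1 - r ^ 2).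

(** This plays for [nu1] the part that [F] plays for [nu]: it equals 1/nu1 on the radius and is
    dominated by its radial values, because |1 - z^2| >= 1 - |z|^2. *)
Let v (z : C) : C := (F z / (1 - z * z))%C.

Lemma Cmod_one_minus_sqr_ge (z : C) : inD z -> 1 - Cmod z ^ 2 <= Cmod (1 - z * z)%C.
Proof.
  intros Hz. generalize (Cmod_minus_ge 1 (z * z)). rewrite Cmod_1, Cmod_mult. lra.
Qed.

Lemma one_minus_sqr_neq_0 (z : C) : inD z -> (1 - z * z)%C <> 0%C.
Proof.
  intros Hz. apply Cmod_gt_0. assert (H := Cmod_one_minus_sqr_ge z Hz).
  assert (Hq := one_minus_sqr_pos _ (conj (Cmod_ge_0 z) Hz)). lra.
Qed.

Lemma is_Cderive_one_minus_sqr (z : C) : is_Cderive (fun x => 1 - x * x)%C z (- (z + z))%C.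
Proof.
  assert (D := is_Cderive_mult _ _ _ _ _ (is_Cderive_id z) (is_Cderive_id z)).
  assert (D1 := is_Cderive_mult _ _ _ _ _ (is_Cderive_const (- RtoC 1)%C z) D).
  assert (D2 := is_Cderive_plus _ _ _ _ _ (is_Cderive_const 1%C z) D1). cbv beta in D2.
  match type of D2 with is_derive _ _ ?e => replace (- (z + z))%C with e by Cring end.
  eapply (@is_derive_ext C_AbsRing C_NormedModule); [|exact D2].
  intros s. simpl. change (1 + - RtoC 1 * (s * s) = 1 - s * s)%C. ring.
Qed.

Lemma holo_hyperbolic : holo v.
Proof.
  intros z Hz. eexists. apply is_Cderive_div.
  - apply one_minus_sqr_neq_0, Hz.
  - apply holo_is_Cderive; auto.
  - apply is_Cderive_one_minus_sqr.
Qed.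

Lemma hyperbolic_radial_mono (r s : R) : 0 <= r -> r <= s -> s < 1 ->
  hyperbolic_radial r <= hyperbolic_radial s.
Proof.
  intros H0 Hrs Hs. unfold hyperbolic_radial, Rdiv.
  assert (H1 := one_minus_sqr_pos r ltac:(lra)). assert (H2 := one_minus_sqr_pos s ltac:(lra)).
  apply Rmult_le_compat.
  - left. apply radial_pos. lra.
  - left. apply Rinv_0_lt_compat. lra.
  - apply radial_mono; auto.
  - apply Rinv_le_contravar; [lra|]. nra.
Qed.

Lemma Cmod_hyperbolic_le (z : C) : inD z -> Cmod (v z) <= hyperbolic_radial (Cmod z).
Proof.
  intros Hz. unfold v, hyperbolic_radial, Rdiv. rewrite Cmod_div by (apply one_minus_sqr_neq_0, Hz).
  apply Rmult_le_compat.
  - apply Cmod_ge_0.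
  - left. apply Rinv_0_lt_compat, Cmod_gt_0, one_minus_sqr_neq_0, Hz.
  - apply Cmod_le_radial, Hz.
  - apply Rinv_le_contravar; [|apply Cmod_one_minus_sqr_ge, Hz].
    apply one_minus_sqr_pos. split; [apply Cmod_ge_0|exact Hz].
Qed.

Lemma hyperbolic_real (r : R) : 0 <= r < 1 -> v (RtoC r) = RtoC (hyperbolic_radial r).
Proof.
  intros Hr. unfold v, hyperbolic_radial. rewrite radial_real by auto.
  assert (Hq := one_minus_sqr_pos r Hr).
  rewrite RtoC_div by lra. f_equal. rewrite RtoC_minus. simpl. rewrite Rmult_1_r, RtoC_mult. reflexivity.
Qed.

Lemma radial_hyperbolic (r : R) : 0 <= r < 1 -> radial v r = hyperbolic_radial r.
Proof. intros Hr. unfold radial at 1. rewrite hyperbolic_real; auto. Qed.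

Lemma hyperbolic_radial_nonneg (r : R) : 0 <= r < 1 -> 0 <= hyperbolic_radial r.
Proof.
  intros Hr. apply Rdiv_le_0_compat; [left; apply radial_pos, Hr|apply one_minus_sqr_pos, Hr].
Qed.

Lemma ex_RInt_hyperbolic (r rho : R) : 0 <= r < 1 -> 0 <= rho <= 1 ->
  ex_RInt (fun t => hyperbolic_radial (rho * (t * r)) * r) 0 1.
Proof.
  intros Hr Hrho.
  assert (Hrr : 0 <= rho * r <= r) by nra.
  assert (I0 : ex_RInt (fun t => radial v (t * (rho * r))) 0 1).
  { apply (@ex_RInt_continuous R_CompleteNormedModule). intros t.
    rewrite Rmin_left, Rmax_right by lra. intros Ht.
    assert (Cc := continuous_ray v (RtoC (rho * r)) t holo_hyperbolic (inD_RtoC (rho * r) ltac:(lra)) Ht).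
    apply (continuous_ext (fun s : R => fst (v (RtoC s * RtoC (rho * r))%C))).
    { intros s. unfold radial. rewrite <- RtoC_mult. reflexivity. }
    apply (continuous_comp (fun s : R => v (RtoC s * RtoC (rho * r))%C) fst); auto.
    apply continuous_fst. }
  apply (ex_RInt_ext (fun t => scal r (radial v (t * (rho * r))))).
  - intros t. rewrite Rmin_left, Rmax_right by lra. intros Ht.
    rewrite radial_hyperbolic by nra. unfold scal; simpl. unfold mult; simpl.
    replace (t * (rho * r)) with (rho * (t * r)) by ring. ring.
  - apply (@ex_RInt_scal R_NormedModule), I0.
Qed.

(** Uses the inclusion of B^0_nu1 in H^0_nu on the primitive of a dilation series of [v]. On the
    radius the integrand is a sum of nonnegative terms, so it dominates each of them. *)
Lemma hyperbolic_dilation_bound : exists C0, forall rho r, 0 <= rho < 1 -> 0 <= r < 1 ->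
  RInt (fun t => hyperbolic_radial (rho * (t * r)) * r) 0 1 / radial F r <= C0.
Proof.
  apply (geometric_uniform_bound
    (fun rho r => RInt (fun t => hyperbolic_radial (rho * (t * r)) * r) 0 1 / radial F r)).
  intros rho Hrho.
  assert (Hrho' : forall n, 0 <= rho n <= 1) by (intros n; specialize (Hrho n); lra).
  set (u := dilation_series v rho).
  assert (Hu : holo u) by (apply (holo_dilation_series v hyperbolic_radial holo_hyperbolic
     hyperbolic_radial_mono Cmod_hyperbolic_le rho Hrho')).
  assert (HB : B0 nu1 (ray_primitive u)).
  { split; [apply holo_ray_primitive, Hu|].
    intros eps He.
    destruct (dilation_series_vanishing v hyperbolic_radial nu1 rho
      hyperbolic_radial_mono Cmod_hyperbolic_le Hrho) with (eps := eps) as [r [Hr H]]; auto.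
    (* The product of [nu1] and [hyperbolic_radial] is exactly 1. *)
    - intros z Hz. split; [apply nu1_bounded, Hz|]. right.
      assert (Hp := radial_pos _ (conj (Cmod_ge_0 z) Hz)).
      assert (Hq := one_minus_sqr_pos _ (conj (Cmod_ge_0 z) Hz)).
      unfold nu1, hyperbolic_radial. rewrite nu_inv_radial by auto. field. lra.
    - apply nu1_vanishing.
    - exists r. split; auto. intros z H1 H2. rewrite C_derive_ray_primitive; auto. }
  apply Hqn in HB.
  destruct (vanishing_weighted_bounded nu (ray_primitive u) (nu 0%C)) as [K HK].
  - apply HB.
  - apply nu_bounded.
  - apply HB.
  - exists K. intros n r Hr. specialize (HK (RtoC r) (inD_RtoC r Hr)).
    rewrite nu_inv_radial, Cmod_RtoC_nonneg in HK by (try apply inD_RtoC; lra).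
    assert (Hp := radial_pos r Hr).
    assert (T : (1 / 2) ^ n * RInt (fun t => hyperbolic_radial (rho n * (t * r)) * r) 0 1
       <= Cmod (ray_primitive u (RtoC r))).
    { eapply Rle_trans; [|apply re_le_Cmod]. eapply Rle_trans; [|apply Rle_abs].
      assert (I := is_RInt_Re _ _ _ _ (CInt_correct _ _ _ (ex_CInt_ray u (RtoC r) Hu (inD_RtoC r Hr)))).
      assert (J := is_RInt_scal _ _ _ ((1 / 2) ^ n) _
         (@RInt_correct R_CompleteNormedModule _ _ _ (ex_RInt_hyperbolic r (rho n) Hr (Hrho' n)))).
      apply (is_RInt_le _ _ 0 1 _ _ ltac:(lra) J I).
      intros t Ht.
      change ((1 / 2) ^ n * (hyperbolic_radial (rho n * (t * r)) * r)
              <= Re (u (RtoC t * RtoC r) * RtoC r)%C).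
      rewrite <- RtoC_mult, Re_mult_RtoC, <- Rmult_assoc. apply Rmult_le_compat_r; [lra|].
      assert (Htr : 0 <= t * r < 1) by nra.
      assert (Hk : forall k, 0 <= rho k * (t * r) < 1) by (intros k; specialize (Hrho k); nra).
      unfold u, dilation_series, CSeries. simpl.
      assert (E : forall k, Re (RtoC ((1 / 2) ^ k) * v (RtoC (rho k) * RtoC (t * r)))%C
        = (1 / 2) ^ k * hyperbolic_radial (rho k * (t * r))).
      { intros k. rewrite <- RtoC_mult, hyperbolic_real by auto. simpl. ring. }
      rewrite <- (E n).
      apply (Series_ge_term (fun k => Re (RtoC ((1 / 2) ^ k) * v (RtoC (rho k) * RtoC (t * r)))%C)).
      - intros k. rewrite E. apply Rmult_le_pos; [apply pow_le; lra|]. apply hyperbolic_radial_nonneg; auto.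
      - apply Csummable_Re. apply (Csummable_dilation v hyperbolic_radial
          hyperbolic_radial_mono Cmod_hyperbolic_le rho Hrho'). apply inD_RtoC; auto. }
    eapply Rle_trans; [|exact HK].
    unfold Rdiv. rewrite <- Rmult_assoc, Rmult_comm.
    apply Rmult_le_compat_l; auto. left. apply Rinv_0_lt_compat, Hp.
Qed.

Lemma hyperbolic_integral_bound : exists C0, 0 <= C0 /\ forall r, 0 <= r < 1 ->
  RInt (fun t => hyperbolic_radial (t * r) * r) 0 1 <= C0 * radial F r.
Proof.
  destruct hyperbolic_dilation_bound as [C0 HC0].
  exists (Rmax C0 0). split; [apply Rmax_r|]. intros r Hr.
  destruct (dilation_radial_close v r holo_hyperbolic Hr) as [L HL].
  assert (Hp := radial_pos r Hr).
  apply (le_of_le_scal_one_minus _ _ (Rabs L)). intros rho Hrho.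
  specialize (HC0 rho r Hrho Hr).
  assert (H1 : RInt (fun t => hyperbolic_radial (rho * (t * r)) * r) 0 1 <= Rmax C0 0 * radial F r).
  { apply (Rmult_le_compat_r (radial F r)) in HC0; [|lra].
    unfold Rdiv in HC0. rewrite Rmult_assoc, Rinv_l, Rmult_1_r in HC0 by lra.
    eapply Rle_trans; [exact HC0|]. apply Rmult_le_compat_r; [lra|apply Rmax_l]. }
  assert (I1 := @RInt_correct R_CompleteNormedModule _ _ _ (ex_RInt_hyperbolic r 1 Hr ltac:(lra))).
  assert (I2 := @RInt_correct R_CompleteNormedModule _ _ _ (ex_RInt_hyperbolic r rho Hr ltac:(lra))).
  assert (I3 := is_RInt_plus _ _ _ _ _ _ I2 (@is_RInt_const R_NormedModule 0 1 (Rabs L * (1 - rho)))).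
  assert (E : RInt (fun t => hyperbolic_radial (t * r) * r) 0 1 = RInt (fun t => hyperbolic_radial (1 * (t * r)) * r) 0 1).
  { apply RInt_ext. intros t _. rewrite (Rmult_1_l (t * r)). reflexivity. }
  rewrite E.
  assert (Hle := is_RInt_le _ _ 0 1 _ _ ltac:(lra) I1 I3).
  unfold plus, scal in Hle; simpl in Hle. unfold mult in Hle; simpl in Hle.
  rewrite Rminus_0_r, Rmult_1_l in Hle.
  eapply Rle_trans; [apply Hle|lra].
  intros t Ht. rewrite Rmult_1_l.
  assert (Htr : 0 <= t * r <= r) by nra.
  specialize (HL rho (t * r) Hrho Htr). rewrite !radial_hyperbolic in HL by nra.
  apply Rabs_le_between in HL. assert (HLa := Rle_abs L).
  assert (L * (1 - rho) <= Rabs L * (1 - rho)) by (apply Rmult_le_compat_r; lra).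
  assert (HLp := Rabs_pos L).
  assert (0 <= Rabs L * (1 - rho)) by (apply Rmult_le_pos; lra).
  set (a := hyperbolic_radial (t * r)) in *. set (b := hyperbolic_radial (rho * (t * r))) in *.
  apply Rle_trans with (b * r + (Rabs L * (1 - rho)) * r); [nra|].
  apply Rplus_le_compat_l. nra.
Qed.

End AnalyticWeight.

(** * Unimodular combinations of peak functions *)

Fixpoint Rsum (a : nat -> R) (n : nat) : R :=
  match n with O => 0 | S k => Rsum a k + a k end.

Fixpoint Csum (a : nat -> C) (n : nat) : C :=
  match n with O => RtoC 0 | S k => (Csum a k + a k)%C end.

Lemma Rsum_le (a b : nat -> R) (n : nat) : (forall k, (k < n)%nat -> a k <= b k) ->
  Rsum a n <= Rsum b n.
Proof.
  induction n as [|n IH]; simpl; intros H; [lra|].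
  apply Rplus_le_compat; [apply IH; intros; apply H; lia|apply H; lia].
Qed.

Lemma Rsum_scal (c : R) (a : nat -> R) (n : nat) : Rsum (fun k => c * a k) n = c * Rsum a n.
Proof. induction n as [|n IH]; simpl; [ring|rewrite IH; ring]. Qed.

Lemma Cmod_Csum_le (a : nat -> C) (n : nat) : Cmod (Csum a n) <= Rsum (fun k => Cmod (a k)) n.
Proof.
  induction n as [|n IH]; simpl; [rewrite Cmod_0; lra|].
  eapply Rle_trans; [apply Cmod_triangle|]. lra.
Qed.

Lemma Re_Csum (a : nat -> C) (n : nat) : Re (Csum a n) = Rsum (fun k => Re (a k)) n.
Proof. induction n as [|n IH]; simpl; [reflexivity|]. rewrite <- IH. reflexivity. Qed.

Lemma Csum_scal_r (c : C) (a : nat -> C) (n : nat) :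
  (Csum a n * c = Csum (fun k => a k * c) n)%C.
Proof. induction n as [|n IH]; simpl; [ring|rewrite <- IH; ring]. Qed.

(** One good term outweighs the possible negativity of the others; e_j is subtracted as well, which
    is harmless as it is nonnegative. *)
Lemma Rsum_ge_one_term (a e : nat -> R) (c : R) (n j : nat) : (j < n)%nat ->
  (forall k, (k < n)%nat -> 0 <= e k) -> (forall k, (k < n)%nat -> - e k <= a k) -> c <= a j ->
  c - Rsum e n <= Rsum a n.
Proof.
  intros Hj He Ha Hc. revert Hj He Ha. induction n as [|n IH]; intros Hj He Ha; [lia|].
  simpl. assert (He' := He n ltac:(lia)). assert (Ha' := Ha n ltac:(lia)).
  destruct (Nat.eq_dec j n) as [<-|Hn].
  - assert (L : Rsum (fun k => -1 * e k) j <= Rsum a j).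
    { apply Rsum_le. intros k Hk. generalize (Ha k ltac:(lia)). lra. }
    rewrite Rsum_scal in L. lra.
  - specialize (IH ltac:(lia) (fun k Hk => He k ltac:(lia)) (fun k Hk => Ha k ltac:(lia))). lra.
Qed.

(** With x = e^(2d) this is sech^2 d; in particular it is invariant under x -> 1/x. *)
Definition peak_profile (x : R) : R := 4 * x / (1 + x) ^ 2.

(* With [alpha = (A - 1) / (A + 1)] this is [(1 - alpha^2) (1 - z^2) / (1 - alpha z)^2], that is
   [sech^2] of the hyperbolic distance to [alpha] on the radius. *)
Definition peak (A : R) (z : C) : C :=
  (RtoC (4 * A) * (1 - z * z) / ((1 + z + RtoC A * (1 - z)) * (1 + z + RtoC A * (1 - z))))%C.

(** The cross term in the expansion of the square is 2A (1 - |z|^2), hence nonnegative. *)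
Lemma Cmod_peak_denominator (A : R) (z : C) : 0 < A -> inD z ->
  Cmod (1 + z)%C ^ 2 + (A * Cmod (1 - z)%C) ^ 2 <= Cmod (1 + z + RtoC A * (1 - z))%C ^ 2.
Proof.
  intros HA Hz. assert (Hz2 : Cmod z ^ 2 < 1).
  { unfold inD in Hz. generalize (Cmod_ge_0 z). nra. }
  rewrite Rpow_mult_distr. rewrite Cmod2_alt in Hz2. rewrite !Cmod2_alt.
  destruct z as [x y]. simpl in *.
  assert (0 <= A * (1 - (x * (x * 1) + y * (y * 1)))) by (apply Rmult_le_pos; lra).
  nra.
Qed.

Lemma Cmod_1_plus_minus_pos (z : C) : inD z -> 0 < Cmod (1 + z)%C /\ 0 < Cmod (1 - z)%C.
Proof.
  intros Hz. unfold inD in Hz. split.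
  - generalize (Cmod_minus_ge 1 (- z)). rewrite Cmod_1, Cmod_opp.
    replace (1 - - z)%C with (1 + z)%C by ring. lra.
  - generalize (Cmod_minus_ge 1 z). rewrite Cmod_1. lra.
Qed.

Lemma peak_denominator_neq_0 (A : R) (z : C) : 0 < A -> inD z ->
  (1 + z + RtoC A * (1 - z))%C <> 0%C.
Proof.
  intros HA Hz. apply Cmod_gt_0.
  assert (H := Cmod_peak_denominator A z HA Hz).
  destruct (Cmod_1_plus_minus_pos z Hz) as [H1 H2].
  assert (H0 := Cmod_ge_0 (1 + z + RtoC A * (1 - z))%C).
  assert (0 <= (A * Cmod (1 - z)%C) ^ 2) by apply pow2_ge_0. nra.
Qed.

Lemma Cmod_peak_le (A : R) (z : C) : 0 < A -> inD z ->
  let x := Cmod (1 + z)%C / (A * Cmod (1 - z)%C) in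
  Cmod (peak A z) <= 4 * x / (1 + x ^ 2).
Proof.
  intros HA Hz x. destruct (Cmod_1_plus_minus_pos z Hz) as [H1 H2].
  assert (H := Cmod_peak_denominator A z HA Hz).
  assert (Hd := peak_denominator_neq_0 A z HA Hz).
  unfold peak. rewrite Cmod_div by (apply Cmult_neq_0; auto).
  replace (1 - z * z)%C with ((1 + z) * (1 - z))%C by ring.
  rewrite !Cmod_mult, Cmod_R, Rabs_pos_eq by lra.
  set (p := Cmod (1 + z)%C) in *. set (s := Cmod (1 - z)%C) in *.
  set (d := Cmod (1 + z + RtoC A * (1 - z))%C) in *.
  assert (HAs : 0 < A * s) by (apply Rmult_lt_0_compat; lra).
  replace (4 * x / (1 + x ^ 2)) with (4 * A * (p * s) / (p ^ 2 + (A * s) ^ 2)).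
  2:{ unfold x. field. repeat split; try lra. nra. }
  unfold Rdiv. apply Rmult_le_compat_l; [|apply Rinv_le_contravar].
  - apply Rmult_le_pos; [lra|]. apply Rmult_le_pos; lra.
  - nra.
  - simpl in H. lra.
Qed.

Lemma Cmod_peak_le_2 (A : R) (z : C) : 0 < A -> inD z -> Cmod (peak A z) <= 2.
Proof.
  intros HA Hz. eapply Rle_trans; [apply Cmod_peak_le; auto|].
  set (x := Cmod (1 + z)%C / (A * Cmod (1 - z)%C)). apply Rle_div_l; [generalize (pow2_ge_0 x); lra|]. generalize (pow2_ge_0 (1 - x)). lra.
Qed.

Lemma peak_real (A r : R) : 0 < A -> 0 <= r < 1 ->
  peak A (RtoC r) = RtoC (peak_profile ((1 + r) / (1 - r) / A)).
Proof.
  intros HA Hr.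
  assert (Hd : 1 + r + A * (1 - r) <> 0) by nra.
  unfold peak.
  replace (1 + RtoC r + RtoC A * (1 - RtoC r))%C with (RtoC (1 + r + A * (1 - r)))
    by (rewrite !RtoC_plus, RtoC_mult, RtoC_minus; reflexivity).
  replace (1 - RtoC r * RtoC r)%C with (RtoC (1 - r * r))
    by (rewrite RtoC_minus, RtoC_mult; reflexivity).
  rewrite <- !RtoC_mult, <- RtoC_div by (apply Rmult_integral_contrapositive; auto).
  f_equal. unfold peak_profile. field. repeat split; lra.
Qed.

(* [4 x / (1 + x^2)] is dominated by the increments of [x / (1 + x)] along [x, x / q, x / q^2, ...] *)
Lemma Rsum_peak_le (q : R) (N : nat) (z : C) : 1 < q -> inD z ->
  Rsum (fun j => Cmod (peak (q ^ j) z)) N <= 8 * q / (q - 1).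
Proof.
  intros Hq Hz. destruct (Cmod_1_plus_minus_pos z Hz) as [H1 H2].
  set (x := fun j : nat => Cmod (1 + z)%C / (q ^ j * Cmod (1 - z)%C)).
  assert (Hqj : forall j, 0 < q ^ j) by (intros j; apply pow_lt; lra).
  assert (Hx : forall j, 0 < x j).
  { intros j. apply Rdiv_lt_0_compat; auto. apply Rmult_lt_0_compat; auto. }
  set (psi := fun y => y / (1 + y)).
  assert (Hpsi : forall j, 0 <= psi (x j) <= 1).
  { intros j. specialize (Hx j). unfold psi. split.
    - apply Rdiv_le_0_compat; lra.
    - apply Rle_div_l; lra. }
  (* The increment of psi from y/q to y is (1 - 1/q) y / ((1 + y)(1 + y/q)), and (1 + y)(1 + y/q) <=
     2 (1 + y^2); this [K] makes K times the increment dominate 4y / (1 + y^2). *)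
  set (K := 8 * q / (q - 1)).
  assert (HK : 0 < K) by (apply Rdiv_lt_0_compat; lra).
  assert (Hs : forall n, Rsum (fun j => Cmod (peak (q ^ j) z)) n <= K * (psi (x 0%nat) - psi (x n))).
  { induction n as [|n IH]; [simpl; lra|].
    assert (T : Cmod (peak (q ^ n) z) <= K * (psi (x n) - psi (x (S n)))).
    { eapply Rle_trans; [apply Cmod_peak_le; auto|]. cbv zeta. fold (x n).
      assert (E : x (S n) = x n / q).
      { unfold x. simpl. field. repeat split; try lra. generalize (Hqj n). lra. }
      rewrite E. specialize (Hx n). set (y := x n) in *.
      assert (Hyq : 0 < y / q) by (apply Rdiv_lt_0_compat; lra).
      assert (E2 : K * (psi y - psi (y / q)) = 8 * y / ((1 + y) * (1 + y / q))).
      { unfold K, psi. field. repeat split; try lra; nra. }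
      rewrite E2.
      assert (Hyq' : y / q <= y) by (apply Rle_div_l; nra).
      replace (4 * y / (1 + y ^ 2)) with (8 * y * / (2 * (1 + y ^ 2))) by (field; nra).
      apply Rmult_le_compat_l; [lra|]. apply Rinv_le_contravar; [nra|].
      generalize (pow2_ge_0 (1 - y)). nra. }
    simpl. lra. }
  eapply Rle_trans; [apply Hs|].
  fold K. rewrite <- (Rmult_1_r K) at 2.
  apply Rmult_le_compat_l; [lra|].
  generalize (Hpsi 0%nat) (Hpsi N). lra.
Qed.

Lemma ex_Cderive_mult (f g : C -> C) (z : C) :
  @ex_derive C_AbsRing C_NormedModule f z -> @ex_derive C_AbsRing C_NormedModule g z ->
  @ex_derive C_AbsRing C_NormedModule (fun x => f x * g x)%C z.
Proof. intros [a Ha] [b Hb]. eexists. apply is_Cderive_mult; eassumption. Qed.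

Lemma holo_mult (f g : C -> C) : holo f -> holo g -> holo (fun z => f z * g z)%C.
Proof. intros Hf Hg z Hz. apply ex_Cderive_mult; auto. Qed.

Lemma holo_const (c : C) : holo (fun _ => c).
Proof. intros z _. eexists. apply (is_Cderive_const c z). Qed.

Lemma holo_Cpow (f : C -> C) (m : nat) : holo f -> holo (fun z => f z ^ m)%C.
Proof.
  intros Hf. induction m as [|m IH]; simpl; [apply holo_const|apply holo_mult; auto].
Qed.

Lemma holo_Csum (f : nat -> C -> C) (n : nat) : (forall k, holo (f k)) ->
  holo (fun z => Csum (fun k => f k z) n).
Proof.
  intros Hf. induction n as [|n IH]; simpl; [apply holo_const|].
  intros z Hz. destruct (IH z Hz) as [a Ha]. destruct (Hf n z Hz) as [b Hb].
  eexists. apply is_Cderive_plus; eassumption.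
Qed.

Lemma holo_rotation (f : C -> C) (c : C) : Cmod c = 1 -> holo f -> holo (fun z => f (c * z)%C).
Proof.
  intros Hc Hf z Hz.
  assert (Hcz : inD (c * z)%C) by (unfold inD; rewrite Cmod_mult, Hc, Rmult_1_l; exact Hz).
  destruct (Hf _ Hcz) as [a Ha].
  assert (D := is_Cderive_mult _ _ _ _ _ (is_Cderive_const c z) (is_Cderive_id z)).
  eexists. apply (is_Cderive_comp f (fun z => c * z)%C z _ _ Ha D).
Qed.

Lemma holo_peak (A : R) : 0 < A -> holo (peak A).
Proof.
  intros HA z Hz. unfold peak.
  assert (D0 := is_Cderive_mult _ _ _ _ _ (is_Cderive_const (RtoC (4 * A)) z) (is_Cderive_one_minus_sqr z)).
  assert (D1 := is_Cderive_mult _ _ _ _ _ (is_Cderive_const (1 - RtoC A)%C z) (is_Cderive_id z)).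
  assert (D2 := is_Cderive_plus _ _ _ _ _ (is_Cderive_const (1 + RtoC A)%C z) D1).
  assert (D3 : is_Cderive (fun x => 1 + x + RtoC A * (1 - x))%C z (0 + (0 * z + (1 - RtoC A) * 1))%C).
  { eapply (@is_derive_ext C_AbsRing C_NormedModule); [|exact D2].
    intros s. simpl. change (1 + RtoC A + (1 - RtoC A) * s = 1 + s + RtoC A * (1 - s))%C. ring. }
  assert (D4 := is_Cderive_mult _ _ _ _ _ D3 D3).
  assert (Hd := peak_denominator_neq_0 A z HA Hz).
  eexists.
  apply (is_Cderive_div (fun z => RtoC (4 * A) * (1 - z * z))%C
           (fun z => (1 + z + RtoC A * (1 - z)) * (1 + z + RtoC A * (1 - z)))%C z _ _
           (Cmult_neq_0 _ _ Hd Hd) D0 D4).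
Qed.

Lemma peak_profile_nonneg (x : R) : 0 < x -> 0 <= peak_profile x.
Proof. intros H. apply Rdiv_le_0_compat; nra. Qed.

Lemma peak_profile_pos (x : R) : 0 < x -> 0 < peak_profile x.
Proof. intros H. apply Rdiv_lt_0_compat; nra. Qed.

(** After clearing denominators, the difference of the two sides is 4 (y - x)(xy - 1). *)
Lemma peak_profile_decr (x y : R) : 0 < x -> 0 < y -> (y - x) * (x * y - 1) >= 0 ->
  peak_profile y <= peak_profile x.
Proof.
  intros Hx Hy H. unfold peak_profile.
  apply Rle_div_l; [nra|].
  replace (4 * x / (1 + x) ^ 2 * (1 + y) ^ 2) with (4 * x * (1 + y) ^ 2 / (1 + x) ^ 2) by (field; lra).
  apply -> Rle_div_r; [lra|nra].
Qed.

Lemma peak_profile_lt (q : R) : 1 < q -> peak_profile (q ^ 2) < peak_profile q.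
Proof.
  intros Hq. unfold peak_profile.
  apply Rlt_div_l; [nra|].
  replace (4 * q / (1 + q) ^ 2 * (1 + q ^ 2) ^ 2) with (4 * q * (1 + q ^ 2) ^ 2 / (1 + q) ^ 2) by (field; lra).
  apply -> Rlt_div_r; [|nra].
  assert (0 < (q - 1) * (q ^ 3 - 1)).
  { apply Rmult_lt_0_compat; [lra|]. simpl. nra. }
  assert (0 < 4 * q * ((q - 1) * (q ^ 3 - 1))) by (apply Rmult_lt_0_compat; lra).
  lra.
Qed.

(** A peak is at least [peak_profile q] within ratio q of its node and at most
    [peak_profile (q ^ 2)] beyond ratio q^2. For this power, all distant peaks together weigh at
    most half of the lower bound for the main term, whose cosine is at least 1/2. *)
Lemma peak_exponent (q : R) : 1 < q -> exists n : nat,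
  peak_profile (q ^ 2) ^ n * (8 * q / (q - 1)) <= peak_profile q ^ S n / 4.
Proof.
  intros Hq. set (k0 := peak_profile q). set (k1 := peak_profile (q ^ 2)).
  assert (Hk : k1 < k0) by (apply peak_profile_lt; auto).
  assert (Hk0 : 0 < k0) by (apply peak_profile_pos; lra).
  assert (Hk1 : 0 < k1) by (apply peak_profile_pos; nra).
  set (S8 := 8 * q / (q - 1)).
  assert (HS : 0 < S8) by (apply Rdiv_lt_0_compat; lra).
  destruct (pow_lt_1_zero (k1 / k0)) with (y := k0 / (4 * S8)) as [n Hn].
  { rewrite Rabs_pos_eq; [apply Rlt_div_l; lra|apply Rdiv_le_0_compat; lra]. }
  { apply Rdiv_lt_0_compat; lra. }
  specialize (Hn n (le_n n)). rewrite Rabs_pos_eq in Hn by (apply pow_le, Rdiv_le_0_compat; lra).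
  assert (Hk0n : 0 < k0 ^ n) by (apply pow_lt; lra).
  assert (Hn' : k1 ^ n * S8 <= k0 ^ S n / 4).
  { unfold Rdiv in Hn. rewrite Rpow_mult_distr, pow_inv in Hn.
    apply Rlt_le, (Rmult_le_compat_l (k0 ^ n * S8)) in Hn; [|apply Rmult_le_pos; lra].
    replace (k0 ^ n * S8 * (k1 ^ n * / k0 ^ n)) with (k1 ^ n * S8) in Hn by (field; lra).
    replace (k0 ^ n * S8 * (k0 * / (4 * S8))) with (k0 ^ S n / 4) in Hn by (simpl; field; lra).
    exact Hn. }
  exists n. exact Hn'.
Qed.

Lemma geometric_bracket (q x : R) (N : nat) : 1 < q -> 1 <= x < q ^ N ->
  exists j, (j < N)%nat /\ q ^ j <= x < q ^ S j.
Proof.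
  intros Hq. induction N as [|N IH]; intros Hx; [simpl in Hx; lra|].
  destruct (Rlt_le_dec x (q ^ N)) as [H|H].
  - destruct IH as [j [Hj H']]; [lra|]. exists j. split; [lia|exact H'].
  - exists N. split; [lia|]. lra.
Qed.

Lemma cos_ge_half (x : R) : Rabs x <= 1 -> 1 / 2 <= cos x.
Proof.
  intros H. rewrite <- cos_PI3.
  assert (HPI := PI2_3_2). assert (HPI' := PI_RGT_0).
  assert (E : cos x = cos (Rabs x)).
  { unfold Rabs. destruct (Rcase_abs x); [rewrite cos_neg|]; reflexivity. }
  rewrite E. apply cos_decr_1; try lra. apply Rabs_pos.
Qed.

Lemma Re_eit_mult (x y : R) : Re (eit x * eit y)%C = cos (x + y).
Proof. unfold eit. simpl. rewrite cos_plus. ring. Qed.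

(** * A bounded analytic function aligned with a phase that is Lipschitz for the hyperbolic
    distance *)

Section PhaseAlignment.

Variables (b : R -> R) (M : R).
Hypothesis HM : 0 <= M.
Hypothesis Hb : forall x y, 0 <= x -> x <= y -> y < 1 ->
  Rabs (b y - b x) * (1 - y ^ 2) <= M * (y - x).

(** Chosen so that M (q^2 - 1) <= 2: the phase then varies by at most one radian over a ratio q^2,
    that is, over two node spacings. *)
Let q := 1 + 1 / (2 * (M + 1)).

Lemma phase_ratio_bounds : 1 < q <= 3 / 2 /\ M * (q ^ 2 - 1) <= 2.
Proof.
  assert (H1 : 0 < 1 / (2 * (M + 1))) by (apply Rdiv_lt_0_compat; lra).
  assert (H2 : 1 / (2 * (M + 1)) <= 1 / 2) by (apply Rle_div_l; lra).
  assert (H3 : M * (1 / (2 * (M + 1))) <= 1 / 2).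
  { replace (M * (1 / (2 * (M + 1)))) with (M / (2 * (M + 1))) by (field; lra).
    apply Rle_div_l; lra. }
  unfold q. set (e := 1 / (2 * (M + 1))) in *. split; [lra|].
  replace (M * ((1 + e) ^ 2 - 1)) with (M * e * (2 + e)) by ring. nra.
Qed.

Definition node (j : nat) : R := (q ^ j - 1) / (q ^ j + 1).

Lemma node_spec (j : nat) : 0 <= node j < 1 /\ q ^ j * (1 - node j) = 1 + node j.
Proof.
  destruct phase_ratio_bounds as [[Hq _] _].
  assert (H : 1 <= q ^ j) by (apply pow_R1_Rle; lra).
  unfold node. repeat split.
  - apply Rdiv_le_0_compat; lra.
  - apply Rlt_div_l; lra.
  - field. lra.
Qed.

Lemma phase_close (r : R) (j : nat) : 0 <= r < 1 ->
  (1 + r) / (1 - r) / q ^ j <= q ^ 2 -> 1 <= q ^ 2 * ((1 + r) / (1 - r) / q ^ j) ->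
  Rabs (b r - b (node j)) <= 1.
Proof.
  intros Hr H1 H2. destruct phase_ratio_bounds as [[Hq Hq'] HMq].
  destruct (node_spec j) as [Ha Ea]. set (al := node j) in *.
  assert (HA : 0 < q ^ j) by (apply pow_lt; lra).
  assert (EA : q ^ j = (1 + al) / (1 - al)).
  { apply Rmult_eq_reg_r with (1 - al); [|lra]. rewrite Ea. field. lra. }
  rewrite EA in H1, H2.
  assert (H1' : (1 + r) * (1 - al) <= q ^ 2 * ((1 + al) * (1 - r))).
  { replace ((1 + r) / (1 - r) / ((1 + al) / (1 - al))) with ((1 + r) * (1 - al) / ((1 + al) * (1 - r))) in H1
      by (field; lra).
    apply -> Rle_div_l in H1; [exact H1|]. apply Rmult_lt_0_compat; lra. }
  assert (H2' : (1 + al) * (1 - r) <= q ^ 2 * ((1 + r) * (1 - al))).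
  { replace (q ^ 2 * ((1 + r) / (1 - r) / ((1 + al) / (1 - al))))
      with ((q ^ 2 * ((1 + r) * (1 - al))) / ((1 + al) * (1 - r))) in H2 by (field; lra).
    apply <- Rle_div_r in H2; [lra|]. apply Rmult_lt_0_compat; lra. }
  assert (Hq2 : 0 < q ^ 2 - 1) by nra.
  assert (Key : forall x y, 0 <= x -> x <= y -> y < 1 ->
    (1 + y) * (1 - x) <= q ^ 2 * ((1 + x) * (1 - y)) -> Rabs (b y - b x) <= 1).
  { intros x y Hx Hxy Hy H. specialize (Hb x y Hx Hxy Hy).
    assert (Hy2 : 0 < 1 - y ^ 2) by nra.
    (* (1+y)(1-x) - (1+x)(1-y) = 2 (y - x), and (1+x)(1-y) <= 1 - y^2. *)
    assert (D : 2 * (y - x) <= (q ^ 2 - 1) * (1 - y ^ 2)).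
    { apply Rle_trans with ((q ^ 2 - 1) * ((1 + x) * (1 - y))); [lra|].
      apply Rmult_le_compat_l; [lra|]. nra. }
    assert (D2 : M * (y - x) <= 1 * (1 - y ^ 2)).
    { apply (Rmult_le_compat_l M) in D; [|lra].
      assert (M * (q ^ 2 - 1) * (1 - y ^ 2) <= 2 * (1 - y ^ 2)) by (apply Rmult_le_compat_r; lra).
      lra. }
    apply Rmult_le_reg_r with (1 - y ^ 2); lra. }
  destruct (Rle_dec al r) as [Hle|Hle].
  - apply Key; lra.
  - rewrite Rabs_minus_sym. apply Key; lra.
Qed.

Definition aligned_sum (m N : nat) (z : C) : C :=
  Csum (fun j => eit (- b (node j)) * peak (q ^ j) z ^ m)%C N.

Lemma pow_q_pos (j : nat) : 0 < q ^ j.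
Proof. apply pow_lt. generalize phase_ratio_bounds. lra. Qed.

Lemma holo_aligned_sum (m N : nat) : holo (aligned_sum m N).
Proof.
  apply holo_Csum. intros k. apply holo_mult; [apply holo_const|].
  apply holo_Cpow, holo_peak, pow_q_pos.
Qed.

(** Of the n + 1 factors of each peak power, n are bounded by 2 and the last is summed over all
    nodes, so N does not enter the bound. *)
Lemma Cmod_aligned_sum_le (n N : nat) (z : C) : inD z ->
  Cmod (aligned_sum (S n) N z) <= 2 ^ n * (8 * q / (q - 1)).
Proof.
  intros Hz. destruct phase_ratio_bounds as [[Hq _] _].
  eapply Rle_trans; [apply Cmod_Csum_le|].
  eapply Rle_trans; [|apply Rmult_le_compat_l; [apply pow_le; lra|apply (Rsum_peak_le q N z Hq Hz)]].
  rewrite <- Rsum_scal. apply Rsum_le. intros k _.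
  rewrite Cmod_mult, Cmod_eit, Rmult_1_l, Cmod_pow. simpl. rewrite Rmult_comm.
  apply Rmult_le_compat_r; [apply Cmod_ge_0|]. apply pow_incr.
  split; [apply Cmod_ge_0|apply Cmod_peak_le_2; auto; apply pow_q_pos].
Qed.

(** The node just below r has ratio in [1, q) and contributes at least half of
    [peak_profile q ^ S n]. Nodes with ratio between q^-2 and q^2 have a phase within one radian,
    hence a nonnegative contribution. The remaining ones are dominated by [k1 ^ n] times a peak, and
    their sum is absorbed by the choice of n. *)
Lemma aligned_sum_lower_bound (n N : nat) (r : R) :
  peak_profile (q ^ 2) ^ n * (8 * q / (q - 1)) <= peak_profile q ^ S n / 4 ->
  0 <= r < 1 -> (1 + r) / (1 - r) < q ^ N ->
  peak_profile q ^ S n / 4 <= Re (aligned_sum (S n) N (RtoC r) * eit (b r))%C.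
Proof.
  destruct phase_ratio_bounds as [[Hq Hq'] _]. intros Hn'.
  set (k0 := peak_profile q) in *. set (k1 := peak_profile (q ^ 2)) in *.
  assert (Hk0 : 0 < k0) by (apply peak_profile_pos; lra).
  assert (Hk1 : 0 < k1) by (apply peak_profile_pos; nra).
  set (S8 := 8 * q / (q - 1)) in *.
  intros Hr HN. set (X := (1 + r) / (1 - r)) in *.
  assert (HX : 1 <= X) by (apply -> Rle_div_r; lra).
  destruct (geometric_bracket q X N Hq (conj HX HN)) as [j [Hj [Hj1 Hj2]]].
  unfold aligned_sum. rewrite Csum_scal_r, Re_Csum.
  set (x := fun k => X / q ^ k).
  assert (Hx : forall k, 0 < x k) by (intros k; apply Rdiv_lt_0_compat; [lra|apply pow_q_pos]).
  assert (E : forall k, Re (eit (- b (node k)) * peak (q ^ k) (RtoC r) ^ S n * eit (b r))%C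
     = cos (b r - b (node k)) * peak_profile (x k) ^ S n).
  { intros k. rewrite peak_real by (auto; apply pow_q_pos). fold X. fold (x k).
    rewrite <- RtoC_pow.
    replace (eit (- b (node k)) * RtoC (peak_profile (x k) ^ S n) * eit (b r))%C
      with (eit (- b (node k)) * eit (b r) * RtoC (peak_profile (x k) ^ S n))%C by ring.
    rewrite Re_mult_RtoC, Re_eit_mult. f_equal. f_equal. ring. }
  assert (Hclose : forall k, x k <= q ^ 2 -> 1 <= q ^ 2 * x k -> 1 / 2 <= cos (b r - b (node k))).
  { intros k H1 H2. apply cos_ge_half, phase_close; auto. }
  set (e := fun k => k1 ^ n * Cmod (peak (q ^ k) (RtoC r))).
  assert (Ep : forall k, Cmod (peak (q ^ k) (RtoC r)) = peak_profile (x k)).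
  { intros k. rewrite peak_real by (auto; apply pow_q_pos). fold X. fold (x k).
    apply Cmod_RtoC_nonneg, peak_profile_nonneg, Hx. }
  eapply Rle_trans; [|apply (Rsum_ge_one_term _ e (1 / 2 * k0 ^ S n) N j Hj)].
  - unfold e. rewrite Rsum_scal.
    assert (T : k1 ^ n * Rsum (fun k => Cmod (peak (q ^ k) (RtoC r))) N <= k1 ^ n * S8).
    { apply Rmult_le_compat_l; [apply pow_le; lra|]. apply Rsum_peak_le; auto. apply inD_RtoC, Hr. }
    lra.
  - intros k _. apply Rmult_le_pos; [apply pow_le; lra|apply Cmod_ge_0].
  - intros k _. rewrite E. unfold e. rewrite Ep.
    assert (Hp := peak_profile_nonneg (x k) (Hx k)).
    assert (He0 : 0 <= k1 ^ n * peak_profile (x k)) by (apply Rmult_le_pos; [apply pow_le; lra|auto]).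
    destruct (Rle_dec (x k) (q ^ 2)) as [H1|H1]; [destruct (Rle_dec 1 (q ^ 2 * x k)) as [H2|H2]|].
    + specialize (Hclose k H1 H2).
      assert (0 <= cos (b r - b (node k)) * peak_profile (x k) ^ S n); [|lra].
      apply Rmult_le_pos; [lra|apply pow_le; auto].
    + assert (Hkk : peak_profile (x k) <= k1).
      { specialize (Hx k). unfold k1.
        (* The symmetry x -> 1/x reduces the nodes beyond r to the case of a large ratio. *)
        assert (Es : peak_profile (x k) = peak_profile (/ x k)) by (unfold peak_profile; field; lra).
        rewrite Es. assert (Hi : q ^ 2 <= / x k).
        { apply Rmult_le_reg_r with (x k); [lra|]. rewrite Rinv_l; lra. }
        apply peak_profile_decr; [nra|apply Rinv_0_lt_compat; lra|].
        assert (Hq2 : 1 < q ^ 2) by nra. set (y := / x k) in *.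
        apply Rle_ge, Rmult_le_pos; [lra|]. nra. }
      assert (peak_profile (x k) ^ S n <= k1 ^ n * peak_profile (x k)).
      { simpl. rewrite Rmult_comm. apply Rmult_le_compat_r; auto. apply pow_incr; auto. }
      assert (0 <= peak_profile (x k) ^ S n) by (apply pow_le; auto).
      generalize (COS_bound (b r - b (node k))). nra.
    + assert (Hkk : peak_profile (x k) <= k1).
      { specialize (Hx k). assert (Hq2 : 1 < q ^ 2) by nra.
        apply peak_profile_decr; [lra|lra|].
        apply Rle_ge, Rmult_le_pos; [lra|]. nra. }
      assert (peak_profile (x k) ^ S n <= k1 ^ n * peak_profile (x k)).
      { simpl. rewrite Rmult_comm. apply Rmult_le_compat_r; auto. apply pow_incr; auto. }
      assert (0 <= peak_profile (x k) ^ S n) by (apply pow_le; auto).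
      generalize (COS_bound (b r - b (node k))). nra.
  - rewrite E.
    assert (Hxj : 1 <= x j <= q).
    { unfold x. assert (Hp := pow_q_pos j). simpl in Hj2. split.
      - apply -> Rle_div_r; lra.
      - apply Rle_div_l; lra. }
    apply Rmult_le_compat.
    + lra.
    + apply pow_le; lra.
    + apply Hclose; nra.
    + apply pow_incr. split; [lra|]. apply peak_profile_decr; try lra.
      apply Rle_ge, Rmult_le_pos; [lra|nra].
Qed.

End PhaseAlignment.

(** * Boundedness of the integral operator *)

Lemma polar_form (z : C) : exists theta, 0 <= theta < 2 * PI /\
  z = (RtoC (Cmod z) * eit theta)%C.
Proof.
  assert (HPI := PI_RGT_0).
  destruct (Req_dec (Cmod z) 0) as [H0|H0].
  { exists 0. split; [lra|]. rewrite H0. apply Cmod_eq_0 in H0. rewrite H0. ring. }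
  assert (Hm : 0 < Cmod z) by (generalize (Cmod_ge_0 z); lra).
  set (x := Re z / Cmod z). set (y := Im z / Cmod z).
  assert (Hxy : x ^ 2 + y ^ 2 = 1).
  { unfold x, y. replace ((Re z / Cmod z) ^ 2 + (Im z / Cmod z) ^ 2)
      with ((Re z ^ 2 + Im z ^ 2) / Cmod z ^ 2) by (field; auto).
    rewrite <- Cmod2_alt. field. auto. }
  assert (Hx : -1 <= x <= 1) by nra.
  assert (Ez : forall t, cos t = x -> sin t = y -> z = (RtoC (Cmod z) * eit t)%C).
  { intros t Hc Hs. unfold eit. rewrite Hc, Hs. unfold x, y. set (m := Cmod z) in *.
    destruct z as [u v]. simpl. apply injective_projections; simpl; field; auto. }
  assert (Es : sin (acos x) = Rabs y).
  { rewrite sin_acos by auto. rewrite <- sqrt_Rsqr_abs. f_equal. unfold Rsqr. lra. }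
  destruct (Rle_dec 0 y) as [Hy|Hy].
  - exists (acos x). generalize (acos_bound x). intros Hb. split; [lra|].
    apply Ez; [apply cos_acos; auto|]. rewrite Es. apply Rabs_pos_eq, Hy.
  - exists (- acos x + 2 * PI).
    assert (Hb : 0 < acos x < PI) by (apply acos_bound_lt; nra).
    split; [lra|].
    apply Ez.
    + rewrite cos_plus, cos_2PI, sin_2PI, cos_neg, cos_acos by auto. ring.
    + rewrite sin_plus, cos_2PI, sin_2PI, sin_neg, Es, Rabs_left; lra.
Qed.

Lemma ray_eit (s t theta : R) :
  (RtoC s * (RtoC t * eit theta))%C = (RtoC (s * t) * eit theta)%C.
Proof. rewrite RtoC_mult. ring. Qed.

Lemma Cmod_RtoC_eit (t theta : R) : 0 <= t -> Cmod (RtoC t * eit theta)%C = t.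
Proof. intros H. rewrite Cmod_mult, Cmod_eit, Cmod_RtoC_nonneg; lra. Qed.

Lemma inD_RtoC_eit (t theta : R) : 0 <= t < 1 -> inD (RtoC t * eit theta)%C.
Proof. intros H. unfold inD. rewrite Cmod_RtoC_eit; lra. Qed.

(** Im h is an argument of g when h is a logarithm of g. On the segment 1 - |z|^2 is smallest at the
    outer end y, which gives a mean value bound with that single factor. *)
Lemma Bloch_phase_Lipschitz (h : C -> C) (M theta : R) : holo h ->
  (forall z, inD z -> (1 - Cmod z ^ 2) * Cmod (C_derive h z) <= M) ->
  forall x y, 0 <= x -> x <= y -> y < 1 ->
    Rabs (Im (h (RtoC y * eit theta)%C) - Im (h (RtoC x * eit theta)%C)) * (1 - y ^ 2)
    <= M * (y - x).
Proof.
  intros Hh HM x y Hx Hxy Hy.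
  assert (Hy2 := one_minus_sqr_pos y ltac:(lra)).
  assert (E : forall t, (RtoC x * eit theta + RtoC t * (RtoC (y - x) * eit theta))%C
     = (RtoC (x + t * (y - x)) * eit theta)%C).
  { intros t. rewrite RtoC_plus, (RtoC_mult t). ring. }
  assert (B : Cmod (h (RtoC x * eit theta + RtoC (y - x) * eit theta) - h (RtoC x * eit theta))%C
     <= M / (1 - y ^ 2) * Cmod (RtoC (y - x) * eit theta)%C).
  { apply Cderive_segment_bound with (df := C_derive h); intros t Ht; rewrite E;
      assert (Hb : 0 <= x + t * (y - x) <= y) by nra.
    - apply holo_is_Cderive; auto. apply inD_RtoC_eit. lra.
    - apply -> Rle_div_r; [|lra].
      eapply Rle_trans; [|apply (HM _ (inD_RtoC_eit (x + t * (y - x)) theta ltac:(lra)))].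
      rewrite Cmod_RtoC_eit by lra. rewrite Rmult_comm.
      apply Rmult_le_compat_r; [apply Cmod_ge_0|]. nra. }
  rewrite Cmod_RtoC_eit in B by lra.
  replace (RtoC x * eit theta + RtoC (y - x) * eit theta)%C with (RtoC y * eit theta)%C in B
    by (rewrite RtoC_minus; ring).
  apply (Rmult_le_compat_r (1 - y ^ 2)) in B; [|lra].
  replace (M / (1 - y ^ 2) * (y - x) * (1 - y ^ 2)) with (M * (y - x)) in B by (field; lra).
  eapply Rle_trans; [|exact B]. apply Rmult_le_compat_r; [lra|].
  apply (im_le_Cmod (h (RtoC y * eit theta) - h (RtoC x * eit theta))%C).
Qed.

(** * Upper and lower bounds of S_g on a ray *)

Section Operator.

Variables (nu : C -> R) (F g : C -> C).
Hypothesis Hnu : weight nu.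
Hypothesis HF : holo F.
Hypothesis HnuF : forall z, inD z ->
  (RtoC (nu z) * F (RtoC (Cmod z)) = 1)%C /\ Im (F (RtoC (Cmod z))) = 0 /\
  Cmod (F z) <= Re (F (RtoC (Cmod z))).
Hypothesis Hg : holo g.

(** The integrand of the theorem after the substitution r = s t, with 1/nu written as [F], to match
    the parametrization of [Sg] over [0,1]. *)
Definition ray_integrand (t theta s : R) : R :=
  hyperbolic_radial F (s * t) * Cmod (g (RtoC (s * t) * eit theta)%C) * t.

Lemma radial_integral_ray (t theta : R) : 0 <= t < 1 ->
  ex_RInt (ray_integrand t theta) 0 1 /\
  RInt (fun r : R => Cmod (g (RtoC r * eit theta)%C) / ((1 - r ^ 2) * nu (RtoC r))) 0 t
  = RInt (ray_integrand t theta) 0 1.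
Proof.
  intros Ht.
  (* Written through an analytic function, the integrand inherits continuity from differentiability;
     it agrees with the radial formula on [0,1). *)
  set (G := fun r : R => radial (fun z => F z / (1 - z * z))%C r * Cmod (g (RtoC r * eit theta)%C)).
  assert (HG : forall r, 0 <= r < 1 -> G r = hyperbolic_radial F r * Cmod (g (RtoC r * eit theta)%C)).
  { intros r Hr. unfold G. rewrite (radial_hyperbolic nu F HnuF r Hr). reflexivity. }
  assert (HGi : ex_RInt G 0 t).
  { apply (@ex_RInt_continuous R_CompleteNormedModule). intros r.
    rewrite Rmin_left, Rmax_right by lra. intros Hr.
    apply (@continuous_mult R_UniformSpace R_AbsRing).
    - apply (ex_derive_continuous (K := R_AbsRing) (V := R_NormedModule)). eexists.
      apply is_derive_Re_real, holo_is_Cderive; [apply (holo_hyperbolic F HF)|apply inD_RtoC; lra].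
    - apply continuous_R_Cmod.
      apply (is_Cderive_continuous_comp g (fun s : R => RtoC s * eit theta)%C r
        (C_derive g (RtoC r * eit theta)%C)).
      + apply holo_is_Cderive; auto. apply inD_RtoC_eit. lra.
      + apply (continuous_ext (fun s : R => 0 + RtoC s * eit theta)%C); [intros; apply Cplus_0_l|].
        apply continuous_line. }
  assert (HGi' : ex_RInt G (t * 0 + 0) (t * 1 + 0)).
  { replace (t * 0 + 0) with 0 by ring. replace (t * 1 + 0) with t by ring. exact HGi. }
  assert (E : forall s, 0 < s < 1 -> scal t (G (t * s + 0)) = ray_integrand t theta s).
  { intros s Hs. change (t * G (t * s + 0) = ray_integrand t theta s). unfold ray_integrand.
    replace (t * s + 0) with (s * t) by ring. rewrite HG by nra. ring. }
  split.
  - apply (ex_RInt_ext (fun s => scal t (G (t * s + 0)))).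
    + intros s. rewrite Rmin_left, Rmax_right by lra. apply E.
    + apply (@ex_RInt_comp_lin R_NormedModule), HGi'.
  - transitivity (RInt G 0 t).
    + apply RInt_ext. intros r. rewrite Rmin_left, Rmax_right by lra. intros Hr.
      rewrite HG by lra. unfold hyperbolic_radial.
      assert (Hp := radial_pos nu F Hnu HnuF r ltac:(lra)).
      assert (Hq := one_minus_sqr_pos r ltac:(lra)).
      rewrite (nu_inv_radial nu F Hnu HnuF _ (inD_RtoC r ltac:(lra))), Cmod_RtoC_nonneg by lra.
      match goal with |- ?a = ?b => change (@eq R a b) end. field. lra.
    + assert (L := @RInt_comp_lin R_CompleteNormedModule G t 0 0 1 HGi').
      replace (t * 0 + 0) with 0 in L by ring. replace (t * 1 + 0) with t in L by ring.
      rewrite <- L. apply RInt_ext. intros s. rewrite Rmin_left, Rmax_right by lra. apply E.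
Qed.

Hypothesis Hqn : forall f, H0 nu f <-> B0 (nu1 nu) f.

Lemma Sg_ray_primitive (f : C -> C) (z : C) :
  Sg g f z = ray_primitive (fun w => C_derive f w * g w)%C z.
Proof. reflexivity. Qed.

(** The derivative bound |f'| <= C0 M / nu1 is inserted pointwise under the integral. *)
Lemma Sg_upper_bound : exists C0, 0 <= C0 /\ forall f M, holo f ->
  (forall z, inD z -> nu z * Cmod (f z) <= M) ->
  forall t theta, 0 <= t < 1 ->
    Cmod (Sg g f (RtoC t * eit theta)%C) <= C0 * M * RInt (ray_integrand t theta) 0 1.
Proof.
  destruct (Hinf_derive_bound nu F Hnu HF HnuF Hqn) as [C0 [HC0 H]].
  exists C0. split; auto. intros f M Hf HM t theta Ht.
  specialize (H f M Hf HM).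
  destruct (radial_integral_ray t theta Ht) as [Hi _].
  assert (I := is_RInt_scal _ _ _ (C0 * M) _ (@RInt_correct R_CompleteNormedModule _ _ _ Hi)).
  rewrite Sg_ray_primitive. unfold ray_primitive.
  assert (E : _ = C0 * M * RInt (ray_integrand t theta) 0 1) by exact (is_RInt_unique _ _ _ _ I).
  rewrite <- E.
  apply Cmod_CInt_le; [lra| |eexists; exact I|].
  - apply (ex_CInt_ray (fun w => C_derive f w * g w)%C); [|apply inD_RtoC_eit, Ht]. apply holo_mult; [apply holo_C_derive, Hf|exact Hg].
  - intros s Hs. unfold scal; simpl. unfold mult; simpl. unfold ray_integrand.
    rewrite ray_eit, !Cmod_mult, Cmod_eit, Cmod_RtoC_nonneg, Rmult_1_r by lra.
    assert (Hst : 0 <= s * t < 1) by nra.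
    specialize (H _ (inD_RtoC_eit (s * t) theta Hst)).
    rewrite (nu_inv_radial nu F Hnu HnuF) in H by (apply inD_RtoC_eit, Hst).
    rewrite Cmod_RtoC_eit in H by lra.
    assert (Hp := radial_pos nu F Hnu HnuF (s * t) Hst).
    assert (Hq := one_minus_sqr_pos (s * t) Hst).
    set (d := Cmod (C_derive f _)) in *. set (y := Cmod (g _)).
    assert (Hd : d <= C0 * M * hyperbolic_radial F (s * t)).
    { apply (Rmult_le_compat_r (hyperbolic_radial F (s * t))) in H;
        [|apply (hyperbolic_radial_nonneg nu F Hnu HnuF); auto].
      unfold hyperbolic_radial in *.
      replace (/ radial F (s * t) * (1 - (s * t) ^ 2) * d * (radial F (s * t) / (1 - (s * t) ^ 2)))
        with d in H by (field; lra). exact H. }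
    apply (Rmult_le_compat_r (y * t)) in Hd;
      [lra|apply Rmult_le_pos; [apply Cmod_ge_0|lra]].
Qed.

(* The test function has derivative [F / (1 - z^2)] times an aligned sum, in the coordinate rotated
   by [theta], so that [f' g] points in the direction [exp (- i theta)] up to a fixed angle. *)
Lemma Sg_test_function : log_in_Bloch g -> exists delta K, 0 < delta /\
  forall t theta, 0 <= t < 1 -> exists f, holo f /\
    (forall z, inD z -> nu z * Cmod (f z) <= K) /\
    delta * RInt (ray_integrand t theta) 0 1 <= Cmod (Sg g f (RtoC t * eit theta)%C).
Proof.
  intros [_ [h [[Hh [M HM]] Hexp]]].
  destruct (hyperbolic_integral_bound nu F Hnu HF HnuF Hqn) as [C1 [HC1 HV]].
  assert (HM0 : 0 <= M).
  { assert (H := HM 0%C ltac:(unfold inD; rewrite Cmod_0; lra)). rewrite Cmod_0 in H.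
    generalize (Cmod_ge_0 (C_derive h 0%C)). lra. }
  set (q := 1 + 1 / (2 * (M + 1))).
  destruct (phase_ratio_bounds M HM0) as [[Hq _] _]. fold q in Hq.
  destruct (peak_exponent q Hq) as [n Hn].
  set (delta := peak_profile q ^ S n / 4) in *.
  assert (Hdelta : 0 < delta).
  { apply Rdiv_lt_0_compat; [|lra]. apply pow_lt, peak_profile_pos. lra. }
  set (W := 2 ^ n * (8 * q / (q - 1))).
  assert (HW : 0 <= W).
  { apply Rmult_le_pos; [apply pow_le; lra|apply Rdiv_le_0_compat; lra]. }
  exists delta, (W * C1). split; auto. intros t theta Ht.
  set (b := fun r : R => Im (h (RtoC r * eit theta)%C)).
  assert (Hb := Bloch_phase_Lipschitz h M theta Hh HM). fold b in Hb.
  (* The nodes must reach beyond t. The number N depends on t, but [delta] and [W] are already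
     fixed. *)
  destruct (Pow_x_infinity q) with (b := (1 + t) / (1 - t) + 1) as [N HN].
  { rewrite Rabs_pos_eq; lra. }
  specialize (HN N (le_n N)). rewrite Rabs_pos_eq in HN by (apply pow_le; lra).
  set (Q := aligned_sum b M (S n) N).
  set (P0 := fun z : C => (F z / (1 - z * z) * Q z)%C).
  assert (HP0 : holo P0).
  { apply holo_mult; [apply (holo_hyperbolic F HF)|]. apply holo_aligned_sum; auto. }
  assert (HP0b : forall z, inD z -> Cmod (P0 z) <= W * hyperbolic_radial F (Cmod z)).
  { intros z Hz. unfold P0. rewrite Cmod_mult, Rmult_comm.
    apply Rmult_le_compat; try apply Cmod_ge_0.
    - apply Cmod_aligned_sum_le; auto.
    - apply (Cmod_hyperbolic_le nu F HnuF z Hz). }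
  (* The rotation carries the ray of angle theta to the positive radius, where F / (1 - z^2) is
     positive. *)
  set (c := eit (- theta)).
  assert (Hc : Cmod c = 1) by apply Cmod_eit.
  set (P := fun z : C => P0 (c * z)%C).
  assert (HP : holo P) by (apply holo_rotation; auto).
  exists (ray_primitive P). split; [apply holo_ray_primitive, HP|]. split.
  - intros z Hz. assert (Hz0 : 0 <= Cmod z < 1) by (split; [apply Cmod_ge_0|exact Hz]).
    assert (Hi : ex_RInt (fun s => hyperbolic_radial F (s * Cmod z) * Cmod z) 0 1).
    { eapply ex_RInt_ext; [|apply (ex_RInt_hyperbolic nu F HF HnuF (Cmod z) 1 Hz0); lra].
      intros s _. cbv beta. rewrite (Rmult_1_l (s * Cmod z)). reflexivity. }
    assert (I := is_RInt_scal _ _ _ W _ (@RInt_correct R_CompleteNormedModule _ _ _ Hi)).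
    assert (B : Cmod (ray_primitive P z) <= W * RInt (fun s => hyperbolic_radial F (s * Cmod z) * Cmod z) 0 1).
    { assert (E : _ = W * RInt (fun s => hyperbolic_radial F (s * Cmod z) * Cmod z) 0 1)
        by exact (is_RInt_unique _ _ _ _ I).
      rewrite <- E. unfold ray_primitive.
      apply Cmod_CInt_le; [lra|apply (ex_CInt_ray P); auto|eexists; exact I|].
      intros s Hs. unfold scal; simpl. unfold mult; simpl.
      assert (Hsz : Cmod (c * (RtoC s * z))%C = s * Cmod z).
      { rewrite !Cmod_mult, Hc, Cmod_RtoC_nonneg; lra. }
      rewrite Cmod_mult, <- Rmult_assoc. apply Rmult_le_compat_r; [lra|].
      rewrite <- Hsz. apply HP0b. unfold inD. rewrite Hsz. nra. }
    rewrite (nu_inv_radial nu F Hnu HnuF) by auto.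
    assert (Hp := radial_pos nu F Hnu HnuF (Cmod z) Hz0).
    specialize (HV (Cmod z) Hz0).
    apply Rmult_le_reg_l with (radial F (Cmod z)); auto.
    rewrite <- Rmult_assoc, Rinv_r, Rmult_1_l by lra.
    eapply Rle_trans; [exact B|].
    apply (Rmult_le_compat_l W) in HV; auto. lra.
  - destruct (radial_integral_ray t theta Ht) as [Hi _].
    assert (HtD := inD_RtoC_eit t theta Ht).
    set (u := fun w : C => (C_derive (ray_primitive P) w * g w)%C).
    assert (Hu : holo u).
    { apply holo_mult; auto. apply holo_C_derive, holo_ray_primitive, HP. }
    rewrite Sg_ray_primitive. fold u.
    (* The unimodular factor c cancels the e^(i theta) contained in dz, so that real parts can be
       compared under the integral. *)
    replace (Cmod (ray_primitive u (RtoC t * eit theta)%C))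
      with (Cmod (c * ray_primitive u (RtoC t * eit theta))%C)
      by (rewrite Cmod_mult, Hc, Rmult_1_l; reflexivity).
    eapply Rle_trans; [|apply re_le_Cmod]. eapply Rle_trans; [|apply Rle_abs].
    assert (I := is_RInt_Re _ _ _ _ (is_CInt_Cmult c _ _ _ _
       (CInt_correct _ _ _ (ex_CInt_ray u _ Hu HtD)))).
    assert (J := is_RInt_scal _ _ _ delta _ (@RInt_correct R_CompleteNormedModule _ _ _ Hi)).
    apply (is_RInt_le _ _ 0 1 _ _ ltac:(lra) J I).
    intros s Hs.
    change (delta * ray_integrand t theta s
      <= Re (c * (u (RtoC s * (RtoC t * eit theta)) * (RtoC t * eit theta)))%C).
    rewrite ray_eit. set (r := s * t). assert (Hr : 0 <= r < 1) by (unfold r; nra).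
    assert (HrD := inD_RtoC_eit r theta Hr).
    set (w := (RtoC r * eit theta)%C) in *.
    assert (Ew : (c * w)%C = RtoC r).
    { unfold c, w. replace (eit (- theta) * (RtoC r * eit theta))%C
        with (RtoC r * (eit theta * eit (- theta)))%C by ring.
      rewrite eit_opp. ring. }
    assert (Eg : g w = (RtoC (Cmod (g w)) * eit (b r))%C).
    { rewrite <- (Hexp w HrD), Cmod_cexp. apply cexp_polar. }
    assert (EP : P w = (RtoC (hyperbolic_radial F r) * Q (RtoC r))%C).
    { unfold P. rewrite Ew. unfold P0. rewrite (hyperbolic_real nu F HnuF r Hr). reflexivity. }
    unfold u. rewrite C_derive_ray_primitive by auto. rewrite EP.
    unfold ray_integrand. fold r. fold w.
    replace (c * (RtoC (hyperbolic_radial F r) * Q (RtoC r) * g w * (RtoC t * eit theta)))%C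
      with ((Q (RtoC r) * eit (b r)) * RtoC (hyperbolic_radial F r * Cmod (g w) * t))%C.
    2:{ rewrite Eg at 2. unfold c.
        transitivity (RtoC (hyperbolic_radial F r) * Q (RtoC r) * (RtoC (Cmod (g w)) * eit (b r)) * RtoC t
          * (eit theta * eit (- theta)))%C; [|ring].
        rewrite eit_opp, !RtoC_mult. ring. }
    rewrite Re_mult_RtoC. apply Rmult_le_compat_r.
    + apply Rmult_le_pos; [|lra]. apply Rmult_le_pos; [|apply Cmod_ge_0].
      apply (hyperbolic_radial_nonneg nu F Hnu HnuF r Hr).
    + apply (aligned_sum_lower_bound b M HM0 Hb n N r Hn Hr).
      fold q. assert (Hrt : r <= t) by (unfold r; nra).
      assert ((1 + r) / (1 - r) <= (1 + t) / (1 - t)); [|lra].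
      unfold Rdiv. apply Rmult_le_compat; try lra.
      * left. apply Rinv_0_lt_compat. lra.
      * apply Rinv_le_contravar; lra.
Qed.

End Operator.

Theorem theorem2 (g : C -> C) (nu mu : C -> R) :
  holo g -> log_in_Bloch g ->
  analytic_weight nu -> quasi_normal nu -> weight mu ->
  (Sg_bounded g nu mu <->
   exists K : R, forall t theta : R, 0 <= t < 1 -> 0 <= theta < 2 * PI ->
     mu (RtoC t) *
       RInt (fun r : R => Cmod (g (RtoC r * eit theta)%C)
                          / ((1 - r ^ 2) * nu (RtoC r))) 0 t <= K).
Proof.
  intros Hg Hlog [Hnu [F [HF HnuF]]] [_ Hqn] Hmu. split.
  - intros [K0 [HK0 Hbd]].
    destruct (Sg_test_function nu F g Hnu HF HnuF Hg Hqn Hlog) as [delta [K [Hd Hf]]].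
    (* K0 is the operator bound, K the norm bound of the test functions, delta their loss of
       alignment. *)
    exists (K0 * K / delta). intros t theta Ht _.
    destruct (Hf t theta Ht) as [f [Hfh [HfK Hlow]]].
    destruct (Hbd f (conj Hfh (ex_intro _ K HfK))) as [_ HS].
    specialize (HS K HfK _ (inD_RtoC_eit t theta Ht)).
    rewrite (proj1 (proj2 (proj2 Hmu)) _ (inD_RtoC_eit t theta Ht)), Cmod_RtoC_eit in HS by lra.
    rewrite (proj2 (radial_integral_ray nu F g Hnu HF HnuF Hg t theta Ht)).
    apply -> Rle_div_r; [|exact Hd].
    eapply Rle_trans; [|exact HS].
    rewrite Rmult_assoc, (Rmult_comm _ delta).
    apply Rmult_le_compat_l; [apply Hmu, inD_RtoC, Ht|exact Hlow].
  - intros [K0 HK].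
    destruct (Sg_upper_bound nu F g Hnu HF HnuF Hg Hqn) as [C0 [HC0 Hup]].
    assert (HK0 : 0 <= K0).
    (* At t = 0 the integral is over a point, so the bound itself is nonnegative. *)
    { assert (HPI := PI_RGT_0). specialize (HK 0 0 ltac:(lra) ltac:(lra)).
      rewrite RInt_point in HK. unfold zero in HK; simpl in HK. lra. }
    exists (C0 * K0). split; [apply Rmult_le_pos; auto|].
    intros f [Hf [M0 HM0]].
    assert (HM : forall M, (forall z, inD z -> nu z * Cmod (f z) <= M) ->
      forall z, inD z -> mu z * Cmod (Sg g f z) <= C0 * K0 * M).
    { intros M HM z Hz.
      assert (HMp : 0 <= M).
      { eapply Rle_trans; [|apply (HM z Hz)].
        apply Rmult_le_pos; [apply Hnu, Hz|apply Cmod_ge_0]. }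
      assert (Ht : 0 <= Cmod z < 1) by (split; [apply Cmod_ge_0|exact Hz]).
      destruct (polar_form z) as [theta [Hth Ez]].
      specialize (Hup f M Hf HM (Cmod z) theta Ht). rewrite <- Ez in Hup.
      specialize (HK (Cmod z) theta Ht Hth).
      rewrite (proj2 (radial_integral_ray nu F g Hnu HF HnuF Hg (Cmod z) theta Ht)) in HK.
      rewrite (proj1 (proj2 (proj2 Hmu)) z Hz).
      assert (Hm0 : 0 <= mu (RtoC (Cmod z))) by (apply Hmu, inD_RtoC, Ht).
      apply (Rmult_le_compat_l _ _ _ Hm0) in Hup.
      eapply Rle_trans; [exact Hup|].
      apply (Rmult_le_compat_l (C0 * M)) in HK; [lra|apply Rmult_le_pos; auto]. }
    split; [|exact HM]. split; [|exists (C0 * K0 * M0); apply HM, HM0].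
    apply (holo_ray_primitive (fun w => C_derive f w * g w)%C).
    apply holo_mult; auto. apply holo_C_derive, Hf.
Qed.
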